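(* Let $X$ be a $C^{\infty}$-manifold and $E$ a complex $C^{\infty}$ vector bundle of rank $r$ on $X$. Let $(y^1,\dots,y^n)$ be a global coordinate system on $\mathbb R^n$, as a $C^\infty$-manifold, and let $$\eta: y^i\longmapsto m_i\in C^{\infty}(\mathrm{End}_{\mathbb C}(E)),\qquad i=1,\dots,n,$$ be an assignment such that (1) $m_im_j=m_jm_i$ for all $i,j$; (2) for every $p\in X$ and every $i$, the eigenvalues of the restriction $m_i(p)\in \mathrm{End}_{\mathbb C}(E|_p)\simeq M_{r\times r}(\mathbb C)$ are all real. Then $\eta$ extends to a unique $C^{\infty}$-admissible ring-homomorphism $$\varphi_{\eta}^{\sharp}: C^{\infty}(\mathbb R^n)\longrightarrow C^{\infty}(\mathrm{End}_{\mathbb C}(E))$$ over $\mathbb R\hookrightarrow\mathbb C$ (that is, there is exactly one such $\varphi_\eta^\sharp$ with $\varphi_\eta^\sharp(y^i)=m_i$ for $i=1,\dots,n$), and hence $\eta$ defines a $C^\infty$-map $\varphi_\eta:(X^{A\!z},E)\to\mathbb R^n$.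
   Context: Conventions. All manifolds are paracompact, Hausdorff, admit locally finite partitions of unity, and are embeddable into some $\mathbb R^N$ as closed submanifolds. $C^\infty(X)$ denotes the ring of real-valued smooth functions on $X$. $C^{\infty}(\mathrm{End}_{\mathbb C}(E))$ denotes the (in general noncommutative) $\mathbb C$-algebra of smooth sections of the endomorphism bundle $\mathrm{End}_{\mathbb C}(E)\to X$; it contains $C^\infty(X)$ as a subring via $h\mapsto h\cdot \mathrm{Id}_E$ (a subring of its center). Ring-homomorphism over $\mathbb R\hookrightarrow \mathbb C$: a unital ring-homomorphism from an $\mathbb R$-algebra to a $\mathbb C$-algebra that is compatible with the inclusion $\mathbb R\hookrightarrow\mathbb C$ of scalars, i.e. an $\mathbb R$-algebra homomorphism. $C^\infty$-ring: a set $R$ with an operation $\Phi_h:R^n\to R$ for every $n\ge 0$ and $h\in C^\infty(\mathbb R^n)$, such that coordinate functions $\mathbb R^n\to\mathbb R$ give the coordinate projections $R^n\to R$, and $\Phi_{g\circ(h_1,\dots,h_m)}=\Phi_g\circ(\Phi_{h_1},\dots,\Phi_{h_m})$ for all $g\in C^\infty(\mathbb R^m)$, $h_1,\dots,h_m\in C^\infty(\mathbb R^n)$. It has an underlying commutative $\mathbb R$-algebra structure. A $C^\infty$-ring homomorphism is a map commuting with all operations. For a manifold $M$, $C^\infty(M)$ is a $C^\infty$-ring via $\Phi_h(f_1,\dots,f_n)=h(f_1,\dots,f_n)$ (composition). A $C^\infty$-ring structure on an $\mathbb R$-algebra is required to be compatible with (i.e. to induce) the given $\mathbb R$-algebra structure.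 $C^\infty$-admissible: let $Y$ be a $C^\infty$-manifold (here $Y=\mathbb R^n$), let $pr_X:X\times Y\to X$ and $pr_Y:X\times Y\to Y$ be the projections, with pullbacks $pr_X^\sharp:C^\infty(X)\to C^\infty(X\times Y)$ and $pr_Y^\sharp:C^\infty(Y)\to C^\infty(X\times Y)$. A ring-homomorphism $\varphi^\sharp:C^\infty(Y)\to C^\infty(\mathrm{End}_{\mathbb C}(E))$ over $\mathbb R\hookrightarrow\mathbb C$ is $C^\infty$-admissible if there is a ring-homomorphism $\tilde\varphi^\sharp: C^\infty(X\times Y)\to C^\infty(\mathrm{End}_{\mathbb C}(E))$ over $\mathbb R\hookrightarrow\mathbb C$ with $\tilde\varphi^\sharp\circ pr_Y^\sharp=\varphi^\sharp$ and with $\tilde\varphi^\sharp\circ pr_X^\sharp$ equal to the inclusion $C^\infty(X)\hookrightarrow C^\infty(\mathrm{End}_{\mathbb C}(E))$, such that: (i) the $C^\infty$-ring structure of $C^\infty(X\times Y)$ descends via $\tilde\varphi^\sharp$ to a $C^\infty$-ring structure on the image $A_\varphi:=\mathrm{Im}(\tilde\varphi^\sharp)$; and (ii) with this $C^\infty$-ring structure on $A_\varphi$, the maps $\varphi^\sharp:C^\infty(Y)\to A_\varphi$, $C^\infty(X)\hookrightarrow A_\varphi$, $\tilde\varphi^\sharp:C^\infty(X\times Y)\to A_\varphi$, $pr_X^\sharp$ and $pr_Y^\sharp$ form a commutative diagram of $C^\infty$-ring homomorphisms. $C^\infty$-map: $(X^{A\!z},E)$ denotes the ''Azumaya/matrix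 manifold with fundamental module'' consisting of $X$ with the function algebra $C^\infty(\mathrm{End}_{\mathbb C}(E))$ and the bundle $E$. By definition, a $C^\infty$-map $\varphi:(X^{A\!z},E)\to Y$ is the datum of a $C^\infty$-admissible ring-homomorphism $\varphi^\sharp:C^\infty(Y)\to C^\infty(\mathrm{End}_{\mathbb C}(E))$ over $\mathbb R\hookrightarrow\mathbb C$; so the last clause of the claim has no content beyond the existence of $\varphi_\eta^\sharp$. *)

(* Defs.v *)
From HB Require Import structures.
From mathcomp Require Import all_boot all_order all_algebra.
From mathcomp Require Import boolp classical_sets functions cardinality fsbigop.
From mathcomp Require Import reals topology normedtype landau derive.
From mathcomp Require Import complex.

Set Implicit Arguments.
Unset Strict Implicit.
Unset Printing Implicit Defensive.

Import Order.TTheory GRing.Theory Num.Theory.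
Import numFieldNormedType.Exports.

Local Open Scope classical_set_scope.
Local Open Scope ring_scope.

Section Smooth.
Context {R : realType}.

(* Only used for open [U]: then the derivatives at points of [U] do not depend
   on the junk values of [f] outside [U]. [f] is C^(k+1) on [U] iff it is
   Frechet differentiable there and every x |-> df_x(v) is C^k on [U]. *)
Fixpoint Ck (V : normedModType R) (k : nat) (U : set V) (f : V -> R) : Prop :=
  match k with
  | 0 => forall x, U x -> {for x, continuous f}
  | k'.+1 => (forall x, U x -> differentiable f x) /\
             (forall v, Ck k' U (fun x => 'D_v f x))
  end.

Definition smooth (V : normedModType R) (U : set V) (f : V -> R) : Prop :=
  forall k, Ck k U f.

Lemma Ck_le (V : normedModType R) k (U : set V) f : Ck k.+1 U f -> Ck k U f.
Proof.
elim: k f => [|k IH] f /= [df Df].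
  by move=> x Ux; apply: differentiable_continuous; exact: df.
by split=> // v; apply: IH; exact: Df.
Qed.

Lemma Ck0 (V : normedModType R) k (U : set V) f : Ck k U f ->
  forall x, U x -> {for x, continuous f}.
Proof. by elim: k f => // k IH f /Ck_le; exact: IH. Qed.

Lemma Ck_sub (V : normedModType R) k (U W : set V) f : W `<=` U ->
  Ck k U f -> Ck k W f.
Proof.
move=> WU; elim: k f => [|k IH] f /=; first by move=> h x /WU; exact: h.
by case=> df Df; split=> [x /WU|v]; [exact: df|exact: IH].
Qed.

Lemma near_differentiable (V : normedModType R) (f g : V -> R) x :
  (\near x, f x = g x) -> differentiable f x -> differentiable g x.
Proof.
move=> fg df.
have h : g \o shift x = cst (g x) + 'd f x +o_ 0 id.
  apply/eqaddoP => e e0; move/diff_locally/eqaddoP: df => /(_ e e0) df.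
  have fgx : f x = g x by exact: (nbhs_singleton fg).
  have fg' : \forall y \near 0, f (y + x) = g (y + x).
    by move: fg; rewrite (near_shift 0 x) /=; apply: filterS => y /=; rewrite subr0.
  near=> y.
  have -> : (g \o shift x - (cst (g x) + 'd f x)) y =
            (f \o shift x - (cst (f x) + 'd f x)) y.
    rewrite !fctE /= fgx; congr (_ - _); apply/esym; near: y; exact: fg'.
  by near: y.
have dE := diff_unique (diff_continuous df) h.
by apply/diff_locallyP; rewrite dE; split=> //; exact: diff_continuous df.
Unshelve. all: by end_near. Qed.

Lemma Ck_ext (V : normedModType R) k (U : set V) f g : open U ->
  (forall x, U x -> f x = g x) -> Ck k U f -> Ck k U g.
Proof.
move=> oU; elim: k f g => [|k IH] f g fg.
  move=> cf x Ux; have nfg : \near x, f x = g x.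
    by apply: filterS fg _; exact: open_nbhs_nbhs.
  have cfx : f @ x --> f x := cf x Ux.
  by rewrite (fg x Ux) in cfx; apply: cvg_trans cfx; exact: near_eq_cvg.
have nfg x : U x -> \near x, f x = g x.
  by move=> Ux; apply: filterS fg _; exact: open_nbhs_nbhs.
case=> df Df; split=> [x Ux|v].
  by apply: near_differentiable (nfg _ Ux) _; exact: df.
by apply: IH (Df v) => x Ux; apply: near_eq_derive; exact: nfg.
Qed.

Lemma Ck_cst (V : normedModType R) k (U : set V) a : Ck k U (fun=> a).
Proof.
elim: k a => [|k IH] a; first by move=> x _; exact: cst_continuous.
split=> [x _|v]; first exact: differentiable_cst.
have -> : (fun x => 'D_v (fun=> a : R) x) = (fun=> 0) by apply/funext => x; rewrite derive_cst.
exact: IH.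
Qed.

Lemma CkD (V : normedModType R) k (U : set V) f g : open U ->
  Ck k U f -> Ck k U g -> Ck k U (fun x => f x + g x).
Proof.
move=> oU; elim: k f g => [|k IH] f g.
  by move=> cf cg x Ux; apply: cvgD; [exact: cf|exact: cg].
case=> df Df [dg Dg]; split=> [x Ux|v].
  by apply: differentiableD; [exact: df|exact: dg].
apply: Ck_ext (IH _ _ (Df v) (Dg v)) => // x Ux.
by rewrite [RHS]deriveD //; apply: diff_derivable; [exact: df|exact: dg].
Qed.

Lemma CkM (V : normedModType R) k (U : set V) f g : open U ->
  Ck k U f -> Ck k U g -> Ck k U (fun x => f x * g x).
Proof.
move=> oU; elim: k f g => [|k IH] f g.
  by move=> cf cg x Ux; apply: cvgM; [exact: cf|exact: cg].
move=> Cf Cg; have [df Df] := Cf; have [dg Dg] := Cg; split=> [x Ux|v].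
  by apply: differentiableM; [exact: df|exact: dg].
have h := CkD oU (IH _ _ (Ck_le Cf) (Dg v)) (IH _ _ (Ck_le Cg) (Df v)).
apply: Ck_ext h => // x Ux.
by rewrite [RHS]deriveM //; apply: diff_derivable; [exact: df|exact: dg].
Qed.

Lemma Ck_sum (V : normedModType R) k (U : set V) n (f : 'I_n -> V -> R) : open U ->
  (forall i, Ck k U (f i)) -> Ck k U (fun x => \sum_i f i x).
Proof.
move=> oU; elim: n f => [|n IH] f Cf.
  by under eq_fun do rewrite big_ord0; exact: Ck_cst.
by under eq_fun do rewrite big_ord_recr; apply: CkD => //; exact: IH.
Qed.

Lemma Ck_comp (V : normedModType R) k n (U : set V) (W : set 'rV[R]_n)
    (g : 'rV[R]_n -> R) (h : 'I_n -> V -> R) : open U ->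
  (forall x, U x -> W (\row_i h i x)) -> (forall i, Ck k U (h i)) -> Ck k W g ->
  Ck k U (fun x => g (\row_i h i x)).
Proof.
move=> oU hW; elim: k g => [|k IH] g Ch Cg.
  move=> x Ux; apply: (@continuous_comp _ _ _ (fun x => \row_i h i x) g); last first.
    exact/Cg/hW.
  apply/cvg_ballP => e e0.
  have hn : \forall y \near x, forall j, ball (h j x) e (h j y).
    by apply: filter_forall => j; have /cvg_ballP := Ch j x Ux; exact.
  by apply: filterS hn => y hy; split=> // i j; rewrite !mxE; exact: hy.
have [dg Dg] := Cg.
pose e i : 'rV[R]_n := delta_mx 0 i.
have HE : (fun x => \row_i h i x) = \sum_i (fun x => h i x *: e i).
  apply/funext => x; rewrite fct_sumE; apply/rowP => j; rewrite !mxE summxE.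
  rewrite (bigD1 j) //= !mxE !eqxx mulr1 big1 ?addr0// => i ij.
  by rewrite !mxE eqxx eq_sym (negPf ij) mulr0.
have dh i x : U x -> differentiable (h i) x by move=> Ux; exact: (Ch i).1.
have dH x : U x -> differentiable (fun x => \row_i h i x) x.
  move=> Ux; rewrite HE; apply: differentiable_sum => i.
  exact/differentiableZl/dh.
split=> [x Ux|v].
  apply: (@differentiable_comp _ _ _ _ (fun x => \row_i h i x) g); first exact: dH.
  exact/dg/hW.
apply: (@Ck_ext _ _ _ (fun x => \sum_i 'D_v (h i) x * 'D_(e i) g (\row_i h i x))) => //.
  move=> x Ux; apply/esym.
  rewrite deriveE; last first.
    by apply: (@differentiable_comp _ _ _ _ (fun x => \row_i h i x) g); [exact: dH|exact/dg/hW].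
  rewrite (@diff_comp _ _ _ _ (fun x => \row_i h i x) g); [|exact: dH|exact/dg/hW].
  rewrite /=; have -> : 'd (fun x => \row_i h i x) x v = \sum_i 'D_v (h i) x *: e i :> 'rV[R]_n.
    rewrite -deriveE; last exact: dH.
    rewrite HE derive_sum; last first.
      by move=> i; apply: diff_derivable; exact/differentiableZl/dh.
    apply: eq_bigr => i _; rewrite deriveE; last exact/differentiableZl/dh.
    by rewrite diffZl ?deriveE //; exact: dh.
  rewrite /= linear_sum; apply: eq_bigr => i _.
  by rewrite linearZ /= -deriveE //; exact/dg/hW.
apply: Ck_sum => // i; apply: CkM => //; first exact: (Ch i).2.
exact: (IH _ (fun j => Ck_le (Ch j)) (Dg (e i))).
Qed.
End Smooth.


Section SmoothClosure.
Context {R : realType}.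
Implicit Types (V : normedModType R).

Lemma smooth_sub V (U W : set V) (f : V -> R) : W `<=` U -> smooth U f -> smooth W f.
Proof. by move=> WU sf k; apply: Ck_sub (sf k). Qed.

Lemma smooth_ext V (U : set V) (f g : V -> R) : open U ->
  (forall x, U x -> f x = g x) -> smooth U f -> smooth U g.
Proof. by move=> oU fg sf k; apply: Ck_ext (sf k). Qed.

Lemma smooth_coord n i (U : set 'rV[R]_n) : smooth U (fun v => v 0 i).
Proof.
case=> [|k] /=; first by move=> x _; exact: coord_continuous.
split=> [x _|v]; first exact: differentiable_coord.
have -> : (fun x : 'rV[R]_n => 'D_v (fun w : 'rV[R]_n => w 0 i : R) x) = fun=> v 0 i.
  apply/funext => x; rewrite deriveE; last exact: differentiable_coord.
  pose c := fun w : 'rV[R]_n => w 0 i : R.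
  have clin : linear c by move=> a u w; rewrite /c !mxE.
  pose cM := GRing.isLinear.Build _ _ _ _ _ clin.
  pose cL : {linear _ -> _} := HB.pack c cM.
  by rewrite (_ : (fun w => _) = cL) // diff_lin //; exact: coord_continuous.
exact: Ck_cst.
Qed.

Lemma smooth_comp V n (U : set V) (W : set 'rV[R]_n)
    (g : 'rV[R]_n -> R) (h : 'I_n -> V -> R) : open U ->
  (forall x, U x -> W (\row_i h i x)) -> (forall i, smooth U (h i)) ->
  smooth W g -> smooth U (fun x => g (\row_i h i x)).
Proof. by move=> oU hW sh sg k; apply: Ck_comp (sg k) => // i; exact: sh. Qed.

Lemma smooth_comp_mx V n (U : set V) (W : set 'rV[R]_n)
    (g : 'rV[R]_n -> R) (h : V -> 'rV[R]_n) : open U ->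
  (forall x, U x -> W (h x)) -> (forall i, smooth U (fun x => h x 0 i)) ->
  smooth W g -> smooth U (fun x => g (h x)).
Proof.
move=> oU hW sh sg.
have E x : h x = \row_i (fun i x => h x 0 i) i x by apply/rowP => i; rewrite mxE.
rewrite (_ : (fun x => g (h x)) = fun x => g (\row_i (fun i x => h x 0 i) i x)).
  by apply: smooth_comp sg => // x Ux; rewrite -E; exact: hW.
by apply/funext => x; rewrite -E.
Qed.

End SmoothClosure.

Section Spaces.
Context {R : realType}.

(* [cmap] and [cinv] are total functions, meaningful only on [cdom], [ccod]. *)
Record chart (T : topologicalType) (d : nat) := Chart {
  cdom : set T;
  ccod : set 'rV[R]_d;
  cmap : T -> 'rV[R]_d;
  cinv : 'rV[R]_d -> T;
  cdom_open : open cdom;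
  ccod_open : open ccod;
  cmap_cod : forall x, cdom x -> ccod (cmap x);
  cinv_dom : forall v, ccod v -> cdom (cinv v);
  cmapK : forall x, cdom x -> cinv (cmap x) = x;
  cinvK : forall v, ccod v -> cmap (cinv v) = v;
  cmap_continuous : forall x, cdom x -> {for x, continuous cmap};
  cinv_continuous : forall v, ccod v -> {for v, continuous cinv} }.

Arguments cdom_open {T d} c.
Arguments ccod_open {T d} c.

(* A locally Euclidean space with a C^oo-atlas (not necessarily a maximal one);
   the point-set conditions on a manifold are in [is_manifold] below. *)
Record cinfSpace := CinfSpace {
  carrier :> topologicalType;
  sdim : nat;
  atlas : set (chart carrier sdim);
  atlas_cover : forall x, exists2 c, atlas c & cdom c x;
  atlas_compat : forall c c', atlas c -> atlas c' -> forall j,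
    smooth (ccod c `&` cinv c @^-1` cdom c') (fun v => cmap c' (cinv c v) 0 j) }.

Definition smooth_on (M : cinfSpace) (W : set M) (f : M -> R) : Prop :=
  forall c, atlas c -> smooth (ccod c `&` cinv c @^-1` W) (f \o cinv c).

Lemma open_nbhsT (T : topologicalType) (A : set T) x : open A -> A x -> nbhs x A.
Proof. by rewrite openE => oA Ax; exact: oA. Qed.

Lemma chart_open (M : cinfSpace) (c : chart M (sdim M)) (W : set M) : open W ->
  open (ccod c `&` cinv c @^-1` W).
Proof.
move=> oW; rewrite openE => v [cv Wv].
apply: filterI; first exact: open_nbhsT (ccod_open c) cv.
by apply: (cinv_continuous cv); exact: open_nbhsT.
Qed.

Section SmoothOn.
Variables (M : cinfSpace) (W : set M).
Hypothesis oW : open W.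
Implicit Types f g : M -> R.

Lemma smooth_on_ext f g : (forall p, W p -> f p = g p) ->
  smooth_on W f -> smooth_on W g.
Proof.
move=> fg sf c ac; apply: smooth_ext (sf c ac) => [|v [_ Wv]].
  exact: chart_open.
exact: fg.
Qed.

Lemma smooth_on_cst (a : R) : smooth_on W (fun=> a).
Proof. by move=> c _ k; exact: Ck_cst. Qed.

Lemma smooth_onD f g : smooth_on W f -> smooth_on W g ->
  smooth_on W (fun p => f p + g p).
Proof.
by move=> sf sg c ac k; apply: CkD; [exact: chart_open|exact: sf|exact: sg].
Qed.

Lemma smooth_onM f g : smooth_on W f -> smooth_on W g ->
  smooth_on W (fun p => f p * g p).
Proof.
by move=> sf sg c ac k; apply: CkM; [exact: chart_open|exact: sf|exact: sg].
Qed.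

Lemma smooth_onN f : smooth_on W f -> smooth_on W (fun p => - f p).
Proof.
move=> sf; apply: smooth_on_ext (smooth_onM (smooth_on_cst (-1)) sf) => p _.
by rewrite mulN1r.
Qed.

End SmoothOn.

Record smoothFun (M : cinfSpace) := SmoothFun {
  sfun :> M -> R;
  sfunP : smooth_on setT sfun }.

End Spaces.

Arguments cdom_open {R T d} c.
Arguments ccod_open {R T d} c.

Arguments cinfSpace : clear implicits.
Arguments chart : clear implicits.

Section SmoothFunAlgebra.
Context {R : realType} (M : cinfSpace R).
Implicit Types f g h : smoothFun M.

Lemma smoothFun_eq f g : (forall p, f p = g p) -> f = g.
Proof.
case: f g => [f fP] [g gP] /= /funext fg; subst g.
by congr SmoothFun; exact: Prop_irrelevance.
Qed.

HB.instance Definition _ := gen_eqMixin (smoothFun M).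
HB.instance Definition _ := gen_choiceMixin (smoothFun M).

Definition sf_cst (a : R) := SmoothFun (@smooth_on_cst _ M setT a).
Definition sf_add f g := SmoothFun (smooth_onD openT (@sfunP _ _ f) (@sfunP _ _ g)).
Definition sf_mul f g := SmoothFun (smooth_onM openT (@sfunP _ _ f) (@sfunP _ _ g)).
Definition sf_opp f := SmoothFun (smooth_onN openT (@sfunP _ _ f)).

Fact sf_addA : associative sf_add.
Proof. by move=> f g h; apply: smoothFun_eq => p /=; rewrite addrA. Qed.
Fact sf_addC : commutative sf_add.
Proof. by move=> f g; apply: smoothFun_eq => p /=; rewrite addrC. Qed.
Fact sf_add0 : left_id (sf_cst 0) sf_add.
Proof. by move=> f; apply: smoothFun_eq => p /=; rewrite add0r. Qed.
Fact sf_addN : left_inverse (sf_cst 0) sf_opp sf_add.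
Proof. by move=> f; apply: smoothFun_eq => p /=; rewrite addNr. Qed.
HB.instance Definition _ :=
  GRing.isZmodule.Build (smoothFun M) sf_addA sf_addC sf_add0 sf_addN.

Fact sf_mulA : associative sf_mul.
Proof. by move=> f g h; apply: smoothFun_eq => p /=; rewrite mulrA. Qed.
Fact sf_mulC : commutative sf_mul.
Proof. by move=> f g; apply: smoothFun_eq => p /=; rewrite mulrC. Qed.
Fact sf_mul1 : left_id (sf_cst 1) sf_mul.
Proof. by move=> f; apply: smoothFun_eq => p /=; rewrite mul1r. Qed.
Fact sf_mulD : left_distributive sf_mul +%R.
Proof. by move=> f g h; apply: smoothFun_eq => p /=; rewrite mulrDl. Qed.
HB.instance Definition _ := GRing.Zmodule_isComPzRing.Build (smoothFun M)
  sf_mulA sf_mulC sf_mul1 sf_mulD.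

Definition sf_scale (a : R) f := sf_mul (sf_cst a) f.
Fact sf_scaleA a b f : sf_scale a (sf_scale b f) = sf_scale (a * b) f.
Proof. by apply: smoothFun_eq => p /=; rewrite mulrA. Qed.
Fact sf_scale1 : left_id 1 sf_scale.
Proof. by move=> f; apply: smoothFun_eq => p /=; rewrite mul1r. Qed.
Fact sf_scaleDr : right_distributive sf_scale +%R.
Proof. by move=> a f g; apply: smoothFun_eq => p /=; rewrite mulrDr. Qed.
Fact sf_scaleDl f : {morph sf_scale^~ f : a b / a + b}.
Proof. by move=> a b; apply: smoothFun_eq => p /=; rewrite mulrDl. Qed.
HB.instance Definition _ := GRing.Zmodule_isLmodule.Build R (smoothFun M)
  sf_scaleA sf_scale1 sf_scaleDr sf_scaleDl.

End SmoothFunAlgebra.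

Section Models.
Context {R : realType}.

Section Rn.
Variable n : nat.

Definition Rn_chart : chart R 'rV[R]_n n.
Proof.
refine (@Chart _ _ _ setT setT id id openT openT _ _ _ _ _ _) => //;
  by move=> x _; exact: cvg_id.
Defined.

Fact Rn_cover (x : 'rV[R]_n) : exists2 c, [set Rn_chart] c & cdom c x.
Proof. by exists Rn_chart. Qed.

Fact Rn_compat c c' : [set Rn_chart] c -> [set Rn_chart] c' -> forall j,
  smooth (ccod c `&` cinv c @^-1` cdom c') (fun v => cmap c' (cinv c v) 0 j).
Proof. by move=> -> -> j; exact: smooth_coord. Qed.

Definition Rn : cinfSpace R := CinfSpace Rn_cover Rn_compat.

Lemma smooth_on_RnP (f : 'rV[R]_n -> R) :
  smooth_on (M := Rn) setT f <-> smooth [set: 'rV[R]_n] f.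
Proof.
split=> [/(_ Rn_chart erefl)|sf c ->]; first by rewrite preimage_setT setIT.
by rewrite preimage_setT setIT.
Qed.

Definition Rn_coord (i : 'I_n) : smoothFun Rn :=
  SmoothFun ((smooth_on_RnP _).2 (@smooth_coord R n i setT)).

End Rn.

Section Prod.
Variables M N : cinfSpace R.

Section ProdChart.
Variables (c : chart R M (sdim M)) (c' : chart R N (sdim N)).
Let dom : set (M * N) := cdom c `*` cdom c'.
Let cod : set 'rV[R]_(sdim M + sdim N) :=
  lsubmx @^-1` ccod c `&` rsubmx @^-1` ccod c'.
Let map (p : M * N) : 'rV[R]_(sdim M + sdim N) := row_mx (cmap c p.1) (cmap c' p.2).
Let inv (v : 'rV[R]_(sdim M + sdim N)) : M * N :=
  (cinv c (lsubmx v), cinv c' (rsubmx v)).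

Definition prod_chart : chart R (M * N)%type (sdim M + sdim N).
Proof.
refine (@Chart _ _ _ dom cod map inv _ _ _ _ _ _ _ _).
- rewrite openE => -[x y] [/= dx dy]; exists (cdom c, cdom c') => //=.
  by split; [exact: open_nbhsT (cdom_open c) dx|exact: open_nbhsT (cdom_open c') dy].
- apply: openI; apply: open_comp; try exact: ccod_open; move=> x _.
    exact: continuous_lsubmx.
  exact: continuous_rsubmx.
- by move=> [x y] [/= dx dy]; split; rewrite /map /= ?row_mxKl ?row_mxKr; apply: cmap_cod.
- by move=> v [/= dx dy]; split; apply: cinv_dom.
- by move=> [x y] [/= dx dy]; rewrite /inv /map /= row_mxKl row_mxKr !cmapK.
- by move=> v [/= dx dy]; rewrite /inv /map /= !cinvK // hsubmxK.
- move=> [x y] [/= dx dy].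
  have hx : (fun p : M * N => cmap c p.1) @ (x, y) --> cmap c x.
    by apply: (@cvg_comp _ _ _ fst (cmap c) _ (nbhs x)); [exact: cvg_fst|exact: cmap_continuous].
  have hy : (fun p : M * N => cmap c' p.2) @ (x, y) --> cmap c' y.
    by apply: (@cvg_comp _ _ _ snd (cmap c') _ (nbhs y)); [exact: cvg_snd|exact: cmap_continuous].
  apply/cvg_ballP => e e0; move/cvg_ballP: hx => /(_ e e0) hx.
  move/cvg_ballP: hy => /(_ e e0) hy; near=> p; split=> // i j.
  have [_ bx] : ball (cmap c x) e (cmap c p.1) by near: p.
  have [_ by_] : ball (cmap c' y) e (cmap c' p.2) by near: p.
  by rewrite /map !mxE /=; case: split_ordP => k _; [exact: bx|exact: by_].
- move=> v [/= dx dy].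
  have hl : cinv c \o lsubmx @ v --> cinv c (lsubmx v).
    by apply: continuous_comp; [exact: continuous_lsubmx|exact: cinv_continuous].
  have hr : cinv c' \o rsubmx @ v --> cinv c' (rsubmx v).
    by apply: continuous_comp; [exact: continuous_rsubmx|exact: cinv_continuous].
  exact: cvg_pair hl hr.
Unshelve. all: by end_near.
Defined.

End ProdChart.

Definition prod_atlas : set (chart R (M * N)%type (sdim M + sdim N)) :=
  [set prod_chart c c' | c in @atlas R M & c' in @atlas R N].

Fact prod_cover (p : M * N) : exists2 c, prod_atlas c & cdom c p.
Proof.
case: p => x y; have [c ac cx] := atlas_cover x; have [c' ac' cy] := atlas_cover y.
by exists (prod_chart c c') => //; exists c => //; exists c'.
Qed.

Lemma smooth_lsubmx (W : set 'rV[R]_(sdim M)) (U : set 'rV[R]_(sdim M + sdim N)) f :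
  open U -> (forall v, U v -> W (lsubmx v)) -> smooth W f ->
  smooth U (fun v => f (lsubmx v)).
Proof.
move=> oU UW; apply: smooth_comp_mx => // i.
by under eq_fun do rewrite mxE; exact: smooth_coord.
Qed.

Lemma smooth_rsubmx (W : set 'rV[R]_(sdim N)) (U : set 'rV[R]_(sdim M + sdim N)) f :
  open U -> (forall v, U v -> W (rsubmx v)) -> smooth W f ->
  smooth U (fun v => f (rsubmx v)).
Proof.
move=> oU UW; apply: smooth_comp_mx => // i.
by under eq_fun do rewrite mxE; exact: smooth_coord.
Qed.

Fact prod_compat c c' : prod_atlas c -> prod_atlas c' -> forall j,
  smooth (ccod c `&` cinv c @^-1` cdom c') (fun v => cmap c' (cinv c v) 0 j).
Proof.
move=> [a Aa [b Ab <-]] [a' Aa' [b' Ab' <-]] j.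
set U := _ `&` _.
have oU : open U.
  rewrite openE => v [cv Wv].
  apply: filterI; first exact: open_nbhsT (ccod_open (prod_chart a b)) cv.
  apply: (@cinv_continuous _ _ _ (prod_chart a b) v cv).
  exact: open_nbhsT (cdom_open (prod_chart a' b')) Wv.
rewrite /=; case: (split_ordP j) => k ->.
  under eq_fun do rewrite row_mxEl.
  apply: smooth_lsubmx (atlas_compat Aa Aa' k) => // v [[/= h1 _] [/= h2 _]].
  by split.
under eq_fun do rewrite row_mxEr.
apply: smooth_rsubmx (atlas_compat Ab Ab' k) => // v [[/= _ h1] [/= _ h2]].
by split.
Qed.

Definition prod_space : cinfSpace R := CinfSpace prod_cover prod_compat.

Fact pull_fst_subproof (f : smoothFun M) :
  smooth_on (M := prod_space) setT (fun p => f p.1).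
Proof.
move=> _ [a Aa [b Ab <-]]; rewrite preimage_setT setIT.
have := sfunP f Aa; rewrite preimage_setT setIT; apply: smooth_lsubmx.
  exact: ccod_open.
by move=> v [].
Qed.

Fact pull_snd_subproof (f : smoothFun N) :
  smooth_on (M := prod_space) setT (fun p => f p.2).
Proof.
move=> _ [a Aa [b Ab <-]]; rewrite preimage_setT setIT.
have := sfunP f Ab; rewrite preimage_setT setIT; apply: smooth_rsubmx.
  exact: ccod_open.
by move=> v [].
Qed.

Definition pull_fst (f : smoothFun M) : smoothFun prod_space :=
  SmoothFun (pull_fst_subproof f).
Definition pull_snd (f : smoothFun N) : smoothFun prod_space :=
  SmoothFun (pull_snd_subproof f).

End Prod.

Section Composition.
Variables (M : cinfSpace R) (n : nat).

Fact sf_comp_subproof (h : smoothFun (Rn n)) (a : 'I_n -> smoothFun M) :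
  smooth_on setT (fun p => h (\row_i a i p)).
Proof.
move=> c ac; have /smooth_on_RnP sh := sfunP h.
apply: (smooth_comp (h := fun i => a i \o cinv c) _ _ _ sh) => //.
  exact: chart_open openT.
by move=> i; exact: sfunP.
Qed.

(* The C^oo-ring operation p |-> h (a_1 p, ..., a_n p) on C^oo(M). *)
Definition sf_comp (h : smoothFun (Rn n)) (a : 'I_n -> smoothFun M) : smoothFun M :=
  SmoothFun (sf_comp_subproof h a).

End Composition.
End Models.

Arguments Rn {R} n.
Arguments pull_fst {R M} N f.
Arguments pull_snd {R} M {N} f.

Section Manifolds.
Context {R : realType}.

Definition locally_finite (T : topologicalType) (I : Type) (U : I -> set T) :=
  forall x : T, exists2 W, nbhs x W & finite_set [set i | U i `&` W !=set0].

Definition paracompact (T : topologicalType) :=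
  forall (I : Type) (U : I -> set T),
    (forall i, open (U i)) -> \bigcup_i U i = setT ->
  exists (J : Type) (V : J -> set T),
    [/\ forall j, open (V j), \bigcup_j V j = setT,
        forall j, exists i, V j `<=` U i & locally_finite V].

Definition has_partitions_of_unity (M : cinfSpace R) :=
  forall (I : choiceType) (U : I -> set M),
    (forall i, open (U i)) -> \bigcup_i U i = setT ->
  exists rho : I -> smoothFun M,
    let supp i := closure [set p | rho i p != 0] in
    [/\ forall i p, 0 <= rho i p, forall i, supp i `<=` U i, locally_finite supp
      & forall p, \sum_(i \in [set: I]) rho i p = 1].

(* A continuous injective closed map is a homeomorphism onto a closed subset;
   the last clause is injectivity of the differential, read in charts. *)
Definition closed_embedding (M : cinfSpace R) N (iota : M -> 'rV[R]_N) :=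
  [/\ forall j, smooth_on setT (fun p => iota p 0 j), injective iota,
      forall A : set M, closed A -> closed (iota @` A)
    & forall c, @atlas R M c -> forall v, ccod c v -> forall u,
        (forall j, 'D_u (fun w => iota (cinv c w) 0 j) v = 0) -> u = 0].

(* The dimension [sdim M] is constant. Partitions of unity follow from
   Hausdorffness and paracompactness; they are listed because the conventions
   in force list them. *)
Definition is_manifold (M : cinfSpace R) :=
  [/\ hausdorff_space M, paracompact M, has_partitions_of_unity M
    & exists N (iota : M -> 'rV[R]_N), closed_embedding iota].

End Manifolds.

Section Bundles.
Context {R : realType}.
Local Notation C := R[i].

Definition csmooth_on (M : cinfSpace R) (W : set M) (f : M -> C) : Prop :=
  smooth_on W (fun p => complex.Re (f p)) /\ smooth_on W (fun p => complex.Im (f p)).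

Section CsmoothOn.
Variables (M : cinfSpace R) (W : set M).
Hypothesis oW : open W.
Implicit Types f g : M -> C.

Lemma csmooth_on_ext f g : (forall p, W p -> f p = g p) ->
  csmooth_on W f -> csmooth_on W g.
Proof.
by move=> fg [sr si]; split; [apply: smooth_on_ext sr|apply: smooth_on_ext si]
  => // p Wp; rewrite fg.
Qed.

Lemma csmooth_on_cst (a : C) : csmooth_on W (fun=> a).
Proof. by split; exact: smooth_on_cst. Qed.

Lemma csmooth_on_real (f : M -> R) : smooth_on W f ->
  csmooth_on W (fun p => (f p)%:C%C).
Proof. by move=> sf; split=> //=; exact: smooth_on_cst. Qed.

Lemma csmooth_onD f g : csmooth_on W f -> csmooth_on W g ->
  csmooth_on W (fun p => f p + g p).
Proof.
move=> [fr fi] [gr gi]; split.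
  apply: smooth_on_ext (smooth_onD oW fr gr) => // p _.
  by case: (f p) (g p) => [a b] [c d].
apply: smooth_on_ext (smooth_onD oW fi gi) => // p _.
by case: (f p) (g p) => [a b] [c d].
Qed.

Lemma csmooth_onM f g : csmooth_on W f -> csmooth_on W g ->
  csmooth_on W (fun p => f p * g p).
Proof.
move=> [fr fi] [gr gi]; split.
  apply: smooth_on_ext (smooth_onD oW (smooth_onM oW fr gr)
    (smooth_onN oW (smooth_onM oW fi gi))) => // p _.
  by case: (f p) (g p) => [a b] [c d].
apply: smooth_on_ext (smooth_onD oW (smooth_onM oW fr gi)
  (smooth_onM oW fi gr)) => // p _.
by case: (f p) (g p) => [a b] [c d].
Qed.

Lemma csmooth_on_sum n (f : 'I_n -> M -> C) :
  (forall i, csmooth_on W (f i)) -> csmooth_on W (fun p => \sum_i f i p).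
Proof.
elim: n f => [|n IH] f sf.
  by under eq_fun do rewrite big_ord0; exact: csmooth_on_cst.
by under eq_fun do rewrite big_ord_recr; apply: csmooth_onD => //; exact: IH.
Qed.

End CsmoothOn.

(* A local frame over the open set [fdom]: the image of the standard basis of
   C^r under a local trivialization, fibre by fibre. *)
Record frame (X : cinfSpace R) (E : X -> vectType C) (r : nat) := Frame {
  fdom : set X;
  fvec : forall p, r.-tuple (E p);
  fdom_open : open fdom;
  fvec_basis : forall p, fdom p -> basis_of fullv (fvec p) }.

(* A complex vector bundle of rank r, given by its fibres and by local frames
   whose transition matrices are smooth; these frames determine the topology
   and the smooth structure of the total space. *)
Record bundle (X : cinfSpace R) (r : nat) := Bundle {
  fiber :> X -> vectType C;
  frames : set (frame fiber r);
  frames_cover : forall p, exists2 e, frames e & fdom e p;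
  frames_compat : forall e e', frames e -> frames e' -> forall i j : 'I_r,
    csmooth_on (fdom e `&` fdom e')
      (fun p => coord (fvec e p) i (fvec e' p)`_j) }.

Definition smooth_section (X : cinfSpace R) r (E : bundle X r)
    (s : forall p, 'End(E p)) : Prop :=
  forall e, @frames _ _ E e -> forall i j : 'I_r,
    csmooth_on (fdom e) (fun p => coord (fvec e p) i (s p (fvec e p)`_j)).

(* Smooth sections of End_C(E): the matrix in each local frame is smooth. *)
Record endSection (X : cinfSpace R) r (E : bundle X r) := EndSection {
  esec :> forall p, 'End(E p);
  esecP : smooth_section esec }.

End Bundles.

Arguments bundle {R} X r.
Arguments fdom_open {R X E r} f.

Section EndAlgebra.
Context {R : realType} (X : cinfSpace R) (r : nat) (E : bundle X r).
Implicit Types s t u : endSection E.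

Lemma endSection_eq s t : (forall p, s p = t p) -> s = t.
Proof.
case: s t => [s sP] [t tP] /= st.
have {}st : s = t by apply: functional_extensionality_dep.
by subst t; congr EndSection; exact: Prop_irrelevance.
Qed.

HB.instance Definition _ := gen_eqMixin (endSection E).
HB.instance Definition _ := gen_choiceMixin (endSection E).

Fact es_zero_subproof : smooth_section (E := E) (fun p => 0).
Proof.
move=> e _ i j; apply: csmooth_on_ext (csmooth_on_cst _ 0); first exact: fdom_open.
by move=> p _; rewrite zero_lfunE linear0.
Qed.
Definition es_zero := EndSection es_zero_subproof.

Fact es_add_subproof s t : smooth_section (E := E) (fun p => s p + t p).
Proof.
move=> e ee i j; have oe := fdom_open e.
apply: csmooth_on_ext (csmooth_onD oe (esecP s ee i j) (esecP t ee i j)) => // p _.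
by rewrite add_lfunE linearD.
Qed.
Definition es_add s t := EndSection (es_add_subproof s t).

Fact es_opp_subproof s : smooth_section (E := E) (fun p => - s p).
Proof.
move=> e ee i j; have oe := fdom_open e.
apply: csmooth_on_ext (csmooth_onM oe (csmooth_on_cst _ (-1)) (esecP s ee i j)) => // p _.
by rewrite opp_lfunE linearN mulN1r.
Qed.
Definition es_opp s := EndSection (es_opp_subproof s).

Fact es_mul_subproof s t : smooth_section (E := E) (fun p => (s p \o t p)%VF).
Proof.
move=> e ee i j; have oe := fdom_open e.
have := csmooth_on_sum oe (fun k => csmooth_onM oe (esecP t ee k j) (esecP s ee i k)).
apply: csmooth_on_ext => // p ep; rewrite comp_lfunE.
rewrite [in RHS](coord_basis (fvec_basis ep) (memvf (t p _))) !linear_sum.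
by apply: eq_bigr => k _; rewrite !linearZ.
Qed.
Definition es_mul s t := EndSection (es_mul_subproof s t).

Fact sf_incl_subproof (h : smoothFun X) :
  smooth_section (E := E) (fun p => (h p)%:C%C *: \1%VF).
Proof.
move=> e ee i j; have oe := fdom_open e.
have sh : smooth_on (fdom e) h.
  by move=> c ac; apply: smooth_sub (sfunP h ac) => v [].
have := csmooth_onM oe (csmooth_on_real sh) (csmooth_on_cst (fdom e) (j == i)%:R).
apply: csmooth_on_ext => // p ep.
by rewrite scale_lfunE id_lfunE linearZ /= coord_free // (basis_free (fvec_basis ep)).
Qed.
(* C^oo(X) -> C^oo(End_C(E)), h |-> h . Id_E. *)
Definition sf_incl (h : smoothFun X) := EndSection (sf_incl_subproof h).

Fact es_addA : associative es_add.
Proof. by move=> s t u; apply: endSection_eq => p /=; rewrite addrA. Qed.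
Fact es_addC : commutative es_add.
Proof. by move=> s t; apply: endSection_eq => p /=; rewrite addrC. Qed.
Fact es_add0 : left_id es_zero es_add.
Proof. by move=> s; apply: endSection_eq => p /=; rewrite add0r. Qed.
Fact es_addN : left_inverse es_zero es_opp es_add.
Proof. by move=> s; apply: endSection_eq => p /=; rewrite addNr. Qed.
HB.instance Definition _ :=
  GRing.isZmodule.Build (endSection E) es_addA es_addC es_add0 es_addN.

Definition es_one := sf_incl 1.
Fact es_mulA : associative es_mul.
Proof. by move=> s t u; apply: endSection_eq => p /=; rewrite comp_lfunA. Qed.
Fact es_mul1l : left_id es_one es_mul.
Proof. by move=> s; apply: endSection_eq => p /=; rewrite scale1r comp_lfun1l. Qed.
Fact es_mul1r : right_id es_one es_mul.
Proof. by move=> s; apply: endSection_eq => p /=; rewrite scale1r comp_lfun1r. Qed.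
Fact es_mulDl : left_distributive es_mul +%R.
Proof. by move=> s t u; apply: endSection_eq => p /=; rewrite comp_lfunDl. Qed.
Fact es_mulDr : right_distributive es_mul +%R.
Proof. by move=> s t u; apply: endSection_eq => p /=; rewrite comp_lfunDr. Qed.
HB.instance Definition _ := GRing.Zmodule_isPzRing.Build (endSection E)
  es_mulA es_mul1l es_mul1r es_mulDl es_mulDr.

Definition es_scale (a : R) s : endSection E := sf_incl (sf_cst X a) * s.
Lemma es_scaleE a s p : es_scale a s p = a%:C%C *: s p.
Proof. by apply/lfunP => v; rewrite comp_lfunE !scale_lfunE id_lfunE. Qed.
Fact es_scaleA a b s : es_scale a (es_scale b s) = es_scale (a * b) s.
Proof. by apply: endSection_eq => p; rewrite !es_scaleE scalerA -rmorphM. Qed.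
Fact es_scale1 : left_id 1 es_scale.
Proof. by move=> s; apply: endSection_eq => p; rewrite es_scaleE scale1r. Qed.
Fact es_scaleDr : right_distributive es_scale +%R.
Proof. by move=> a s t; exact: mulrDr. Qed.
Fact es_scaleDl s : {morph es_scale^~ s : a b / a + b}.
Proof.
move=> a b; apply: endSection_eq => p.
by rewrite es_scaleE rmorphD scalerDl -!es_scaleE.
Qed.
HB.instance Definition _ := GRing.Zmodule_isLmodule.Build R (endSection E)
  es_scaleA es_scale1 es_scaleDr es_scaleDl.

End EndAlgebra.

Section CinfRings.
Context {R : realType}.

Record cinfRing (A : Type) := CinfRing {
  cop : forall n, smoothFun (@Rn R n) -> ('I_n -> A) -> A;
  cop_coord : forall n (i : 'I_n) a, cop (Rn_coord i) a = a i;
  cop_comp : forall m n (g : smoothFun (Rn m)) (h : 'I_m -> smoothFun (Rn n)) a,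
    cop (sf_comp g h) a = cop g (fun i => cop (h i) a) }.

Definition cinf_hom (A B : Type) (SA : cinfRing A) (SB : cinfRing B) (f : A -> B) :=
  forall n (h : smoothFun (Rn n)) a, f (cop SA h a) = cop SB h (f \o a).

Section SmoothFunCinfRing.
Variable M : cinfSpace R.

Fact sf_comp_coord n (i : 'I_n) (a : 'I_n -> smoothFun M) :
  sf_comp (Rn_coord i) a = a i.
Proof. by apply: smoothFun_eq => p /=; rewrite mxE. Qed.

Fact sf_comp_comp m n (g : smoothFun (Rn m)) (h : 'I_m -> smoothFun (Rn n))
    (a : 'I_n -> smoothFun M) :
  sf_comp (sf_comp g h) a = sf_comp g (fun i => sf_comp (h i) a).
Proof. exact: smoothFun_eq. Qed.

Definition sf_cinfRing : cinfRing (smoothFun M) :=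
  CinfRing sf_comp_coord sf_comp_comp.

End SmoothFunCinfRing.

End CinfRings.

Section Admissible.
Context {R : realType}.
Variables (X Y : cinfSpace R) (r : nat) (E : bundle X r).

(* A unital ring-homomorphism over R -> C; [linear] is linearity over R. *)
Definition alg_hom (M : cinfSpace R) (phi : smoothFun M -> endSection E) : Prop :=
  linear phi /\ monoid_morphism phi.

(* The operations attached to x1 + x2, x1 * x2 and the constants are those of
   the R-algebra C^oo(End_C(E)). *)
Definition compatible (P : set (endSection E)) (S : cinfRing {s | P s}) : Prop :=
  [/\ forall a : 'I_2 -> {s | P s},
        sval (cop S (Rn_coord 0 + Rn_coord 1) a) = sval (a 0) + sval (a 1),
      forall a : 'I_2 -> {s | P s},
        sval (cop S (Rn_coord 0 * Rn_coord 1) a) = sval (a 0) * sval (a 1)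
    & forall (c : R) (a : 'I_0 -> {s | P s}),
        sval (cop S (sf_cst (Rn 0) c) a) = c *: (1 : endSection E)].

Definition corestrict (A B : Type) (f : A -> B) (x : A) : {y | range f y} :=
  exist _ (f x) (imageT f x).

(* The image A_phi is [{s | range phit s}]; [phiA] and [inclA] are phi and the
   inclusion of C^oo(X) with codomain cut down to it. *)
Definition admissible (phi : smoothFun Y -> endSection E) : Prop :=
  exists phit : smoothFun (prod_space X Y) -> endSection E,
  [/\ alg_hom phit,
      forall f, phit (pull_snd X f) = phi f,
      forall h, phit (pull_fst Y h) = sf_incl E h
    & exists S : cinfRing {s | range phit s},
      [/\ compatible S,
          cinf_hom (sf_cinfRing (prod_space X Y)) S (corestrict phit)
        & exists (phiA : smoothFun Y -> {s | range phit s})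
                 (inclA : smoothFun X -> {s | range phit s}),
          [/\ forall f, sval (phiA f) = phi f,
              forall h, sval (inclA h) = sf_incl E h,
              corestrict phit \o pull_snd X =1 phiA
                /\ corestrict phit \o pull_fst Y =1 inclA,
              cinf_hom (sf_cinfRing Y) S phiA
                /\ cinf_hom (sf_cinfRing X) S inclA
            & cinf_hom (sf_cinfRing X) (sf_cinfRing _) (pull_fst Y)
                /\ cinf_hom (sf_cinfRing Y) (sf_cinfRing _) (pull_snd X)]]].

End Admissible.

(* (y^1, ..., y^n) is a diffeomorphism of R^n onto R^n, with inverse z. *)
Definition global_coordinates {R : realType} n (y : 'I_n -> smoothFun (@Rn R n)) :=
  exists z : 'I_n -> smoothFun (Rn n),
    (forall v, \row_i z i (\row_j y j v) = v) /\
    (forall v, \row_i y i (\row_j z j v) = v).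

(* Main.v *)
(* A homomorphism phi : C^oo(R^n) -> C^oo(End(E)) is determined fibrewise. Over
   a point of X the image of a coordinate is a matrix killed by a product of
   real linear factors, so Newton interpolation f = P + R, one variable at a
   time with smooth (Hadamard) remainder, leaves only the polynomial P. Read
   backwards, this interpolation formula defines f(m_1, ..., m_n).

   Smoothness in the base point rests on the same formula. It bounds f(A)
   locally uniformly in the commuting tuple A; applying the bound to the tuple
   [[A, (A - B)/d], [0, B]], which is conjugate to diag(A, B), shows that f is
   Lipschitz, and the derivative of f(A) in a direction v is the upper right
   block of f([[A, D_v A], [0, A]]), so induction on the order of
   differentiability applies, doubling the size of the matrices. A function on
   X x R^n is evaluated by adjoining the base coordinates as scalar matrices.

   The C^oo-ring structure on the image of an algebra homomorphism always
   exists: phi(h(F_1, ..., F_k)) depends only on the phi(F_i), again by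
   fibrewise uniqueness, applied to h |-> phi(h(F_1, ..., F_k)). *)
Require Import Defs.
From HB Require Import structures.
From mathcomp Require Import all_boot all_order all_algebra.
From mathcomp Require Import boolp classical_sets functions.
From mathcomp Require Import reals topology normedtype landau derive.
From mathcomp Require Import realfun ereal measure lebesgue_measure.
From mathcomp Require Import lebesgue_integral ftc.
From mathcomp Require Import complex ring.

Set Implicit Arguments.
Unset Strict Implicit.
Unset Printing Implicit Defensive.

Import Order.TTheory GRing.Theory Num.Theory.
Import numFieldNormedType.Exports.

Local Open Scope classical_set_scope.
Local Open Scope ring_scope.

(** The obstacle is that eigenvalues, the natural interpolation nodes, cannot in general be chosen
    smoothly in the base point, so the interpolation formula cannot be differentiated there. Hence
    every estimate is uniform over all node lists of bounded length and range. Divided differences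
    are written as Hadamard integrals, whose derivatives are bounded by those of [f] wherever the
    nodes lie, even when they collide; only a crude bound on eigenvalues is then required, never
    their continuity. The choice of nodes is immaterial: interpolation at any annihilating lists is
    a homomorphism with prescribed values on the coordinates, and such a homomorphism is unique.
    Interpolation involves only ring operations and central scalars. It is therefore developed in an
    arbitrary ring and then used for sections, for complex matrices and for real ones. The estimates
    live in real matrices: a complex matrix of size [r] is read as a real one of size [r + r], whose
    entries display real and imaginary parts. *)

Section Mean.
Context {R : realType}.
Implicit Types f g F : R -> R.

Definition mean f : R := \int[lebesgue_measure]_(t in `[0%R, 1%R]) f t.

Lemma integrable_unit_itv f : continuous f ->
  (@lebesgue_measure R).-integrable `[0%R, 1%R] (EFin \o f).
Proof.
move=> cf; apply: continuous_compact_integrable; first exact: segment_compact.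
exact: continuous_subspaceT.
Qed.

Lemma meanD f g : continuous f -> continuous g ->
  mean (fun t => f t + g t) = mean f + mean g.
Proof. by move=> cf cg; rewrite /mean RintegralD//; exact: integrable_unit_itv. Qed.

Lemma meanZ a f : continuous f -> mean (fun t => a * f t) = a * mean f.
Proof. by move=> cf; rewrite /mean RintegralZl//; exact: integrable_unit_itv. Qed.

Lemma mean_sum n (F : 'I_n -> R -> R) : (forall i, continuous (F i)) ->
  mean (fun t => \sum_i F i t) = \sum_i mean (F i).
Proof.
move=> cF; suff [] : continuous (fun t => \sum_i F i t) /\
  mean (fun t => \sum_i F i t) = \sum_i mean (F i) by [].
elim: n F cF => [|n IH] F cF.
  under eq_fun do rewrite big_ord0; split; first exact: cst_continuous.
  by rewrite big_ord0 /mean Rintegral_cst// mul0r.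
have [cS mS] := IH (fun i => F (widen_ord (leqnSn n) i)) (fun i => cF _).
under eq_fun do rewrite big_ord_recr; split.
  by move=> t; apply: cvgD; [exact: cS|exact: cF].
by rewrite meanD // mS big_ord_recr.
Qed.

Lemma mean_bound f (C : R) : continuous f ->
  (forall t : R, 0 <= t <= 1 -> `|f t| <= C) -> `|mean f| <= C.
Proof.
move=> cf fC; apply: le_trans (le_normr_Rintegral _ (integrable_unit_itv cf)) _ => //.
have cnf : continuous (fun t => `|f t|).
  move=> t; apply: (@continuous_comp _ _ _ f (@Num.norm _ R^o)); first exact: cf.
  exact: norm_continuous.
have cC : continuous (fun _ : R => C) by move=> t; exact: cst_continuous.
have le_fC (t : R) : `[0%R, 1%R]%classic t -> `|f t| <= C by rewrite /= in_itv /=; exact: fC.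
have le_mean := @le_Rintegral _ _ R (@lebesgue_measure R) `[0%R, 1%R] (fun t => `|f t|)
  (fun=> C) (measurable_itv _) (integrable_unit_itv cnf) (integrable_unit_itv cC) le_fC.
apply: le_trans le_mean _.
have len01 : C * fine (lebesgue_measure (`[0%R, 1%R]%classic : set R)) <= C.
  by rewrite lebesgue_measure_itv /= lte_fin ltr01 oppr0 adde0 /= mulr1.
by rewrite Rintegral_cst.
Qed.

Lemma mean_derive f F : continuous f -> (forall t, is_derive t (1 : R) F (f t)) ->
  mean f = F 1 - F 0.
Proof.
move=> cf dF; have cF : continuous F.
  by move=> t; apply: differentiable_continuous; apply/derivable1_diffP; case: (dF t).
rewrite /mean /Rintegral (@continuous_FTC2 _ f F 0 1) //.
- exact: continuous_subspaceT.
- split.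
  + by move=> t _; case: (dF t).
  + exact/cvg_at_right_filter/cF.
  + exact/cvg_at_left_filter/cF.
- by move=> t _; rewrite derive1E; case: (dF t).
Qed.

End Mean.

(** * Derivatives from remainder estimates *)

Section Remainders.
Context {R : realType}.

Lemma continuous_sumr (T : topologicalType) n (F : 'I_n -> T -> R) :
  (forall j, continuous (F j)) -> continuous (fun t => \sum_j F j t).
Proof.
elim: n F => [|n IH] F cF.
  by under eq_fun do rewrite big_ord0; move=> t; exact: cst_continuous.
under eq_fun do rewrite big_ord_recr.
by move=> t; apply: cvgD; [exact: IH|exact: cF].
Qed.

Lemma continuousMr (T : topologicalType) (a : R) (F : T -> R) :
  continuous F -> continuous (fun t => a * F t).
Proof. by move=> cF t; apply: cvgM; [exact: cvg_cst|exact: cF]. Qed.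

Lemma rv_norm_leP n (x : 'rV[R]_n) (c : R) : 0 <= c ->
  `|x| <= c <-> forall j, `|x 0 j| <= c.
Proof.
move=> c0; have -> : `|x| = mx_norm x by [].
rewrite mx_normrE; split.
  move=> xc j; apply: le_trans xc.
  by apply/bigmax_geP; right => /=; exists (0, j).
by move=> xc; apply: bigmax_le => // -[i j] _ /=; rewrite ord1.
Qed.

Lemma rv_coord_le n (x : 'rV[R]_n) j : `|x 0 j| <= `|x|.
Proof. by move: j; apply/rv_norm_leP. Qed.

(** Certifies a derivative guessed in advance, as needed for the Hadamard integrals and for the
    functional calculus of matrices. *)
Lemma differentiable_of_remainder (V : normedModType R) (f : V -> R) x
    (L : {linear V -> R}) : continuous L ->
  (forall e : R, 0 < e -> \forall h \near (0 : V), `|f (h + x) - f x - L h| <= e * `|h|) ->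
  differentiable f x /\ 'd f x = L :> (V -> R).
Proof.
move=> cL fL; have h : f \o shift x = cst (f x) + L +o_ 0 id.
  apply/eqaddoP => e e0; apply: filterS (fL e e0) => v.
  by rewrite !fctE /= opprD addrA.
have dE := diff_unique cL h.
split; last exact: dE.
by apply/diff_locallyP; rewrite dE.
Qed.

Lemma MVT01 (f df : R -> R) : (forall t : R, is_derive t (1 : R) f (df t)) ->
  exists2 t : R, 0 <= t <= 1 & f 1 - f 0 = df t.
Proof.
move=> fdf; have cf : continuous f.
  by move=> t; apply: differentiable_continuous; apply/derivable1_diffP; case: (fdf t).
have [|t] := @MVT_segment _ f df 0 1 ler01 (fun t _ => fdf t).
  exact: continuous_subspaceT.
by rewrite in_itv /= subr0 mulr1 => t01 E; exists t.
Qed.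

End Remainders.

(** * Mean value and Taylor estimates on boxes *)

Section EuclideanSmooth.
Context {R : realType} {n : nat}.
Local Notation S := (smoothFun (@Rn R n)).
Implicit Types (f g : S) (x y : 'rV[R]_n) (i j : 'I_n).

Lemma sfun_smooth f : smooth [set: 'rV[R]_n] f.
Proof. exact/smooth_on_RnP/sfunP. Qed.

Lemma sfun_differentiable f x : differentiable (f : 'rV[R]_n -> R) x.
Proof. exact: (sfun_smooth f 1).1. Qed.

Lemma sfun_continuous f : continuous (f : 'rV[R]_n -> R).
Proof. by move=> x; apply: differentiable_continuous; exact: sfun_differentiable. Qed.

Definition pd i f : S :=
  SmoothFun ((smooth_on_RnP _).2
    (fun k => (sfun_smooth f k.+1).2 (delta_mx 0 i)) : smooth_on (M := Rn n) setT _).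

Lemma rv_sum_delta x : x = \sum_j x 0 j *: delta_mx 0 j.
Proof. exact: row_sum_delta. Qed.

Lemma derive_pd f v x : 'D_v (f : 'rV[R]_n -> R) x = \sum_j v 0 j * pd j f x.
Proof.
rewrite deriveE; last exact: sfun_differentiable.
rewrite [v in LHS]rv_sum_delta linear_sum; apply: eq_bigr => j _.
by rewrite linearZ /= deriveE //; exact: sfun_differentiable.
Qed.

Lemma is_derive_line f x v t :
  is_derive t (1 : R) (fun t : R => f (x + t *: v)) (\sum_j v 0 j * pd j f (x + t *: v)).
Proof.
rewrite -derive_pd.
have dl : is_diff t (fun t : R => x + t *: v) (fun s => s *: v).
  have h := is_diffD (is_diff_cst x t) (is_diff_scalel t v).
  by apply: is_diff_eq h _; rewrite add0r.
have df := sfun_differentiable f (x + t *: v).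
have dl' : differentiable (fun t : R => x + t *: v) t by exact: ex_diff.
have dc : differentiable (fun t : R => f (x + t *: v)) t.
  exact: (@differentiable_comp _ _ _ _ (fun t : R => x + t *: v) f t dl' df).
split; first by apply: diff_derivable.
rewrite deriveE // (@diff_comp _ _ _ _ (fun t : R => x + t *: v) f t dl' df).
by rewrite /= deriveE // diff_val scale1r.
Qed.

Lemma line_continuous f x v : continuous (fun t : R => f (x + t *: v)).
Proof.
move=> t; apply: differentiable_continuous; apply/derivable1_diffP.
by case: (is_derive_line f x v t).
Qed.

(** A sup-norm ball around 0: compact, so continuous functions are bounded on it, and convex, so it
    contains the segments of the mean value theorem. *)
Definition in_box (c : R) x := forall j, `|x 0 j| <= c.

Lemma in_box_line c x y (t : R) : in_box c x -> in_box c y -> 0 <= t <= 1 ->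
  in_box c (x + t *: (y - x)).
Proof.
move=> xc yc /andP[t0 t1] j; rewrite !mxE.
have -> : x 0 j + t * (y 0 j - x 0 j) = (1 - t) * x 0 j + t * y 0 j by ring.
apply: le_trans (ler_normD _ _) _; rewrite !normrM.
have -> : c = (1 - t) * c + t * c by ring.
have s0 : 0 <= 1 - t by rewrite subr_ge0.
by rewrite (ger0_norm t0) (ger0_norm s0); apply: lerD; apply: ler_wpM2l.
Qed.

Lemma box_bounded f c : exists2 C : R, 0 <= C & forall x, in_box c x -> `|f x| <= C.
Proof.
have Kc : compact [set v : 'rV[R]_n | forall i, `[- c, c]%classic (v ord0 i)].
  apply: (@rV_compact _ _ (fun=> `[- c, c]%classic)) => _; exact: segment_compact.
have cf : {within [set v : 'rV[R]_n | forall i, `[- c, c]%classic (v ord0 i)],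
    continuous (f : 'rV[R]_n -> R)}.
  exact/continuous_subspaceT/sfun_continuous.
have [M [_ fM]] := compact_bounded (continuous_compact cf Kc).
have CM : M < Num.max 0 (M + 1) by rewrite lt_max ltrDl ltr01 orbT.
exists (Num.max 0 (M + 1)); first by rewrite le_max lexx.
move=> x xc; apply: (fM _ CM); exists x => // j /=.
by rewrite in_itv /= -ler_norml.
Qed.

Lemma box_lipschitz f c : exists2 C : R, 0 <= C &
  forall x y, in_box c x -> in_box c y -> `|f y - f x| <= C * `|y - x|.
Proof.
have /choice[C CP] : forall j, exists C : R, 0 <= C /\ forall x, in_box c x -> `|pd j f x| <= C.
  by move=> j; have [C C0 CP] := box_bounded (pd j f) c; exists C.
exists (\sum_j C j); first by apply: sumr_ge0 => j _; case: (CP j).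
move=> x y xc yc; have [t t01] := MVT01 (is_derive_line f x (y - x)).
rewrite scale1r scale0r addr0 subrKC => ->.
apply: le_trans (ler_norm_sum _ _ _) _; rewrite mulr_suml; apply: ler_sum => j _.
rewrite normrM mulrC; apply: ler_pM => //; last exact: rv_coord_le.
exact/(CP j).2/in_box_line.
Qed.

(** The mean value theorem turns the remainder into increments of partial derivatives along the
    segment; these are Lipschitz on the box, whence the square. *)
Lemma box_taylor1 f c : exists2 C : R, 0 <= C &
  forall x y, in_box c x -> in_box c y ->
    `|f y - f x - \sum_j (y - x) 0 j * pd j f x| <= C * `|y - x| ^+ 2.
Proof.
have /choice[C CP] : forall j, exists C : R, 0 <= C /\
    forall x y, in_box c x -> in_box c y -> `|pd j f y - pd j f x| <= C * `|y - x|.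
  by move=> j; have [C C0 CP] := box_lipschitz (pd j f) c; exists C.
exists (\sum_j C j); first by apply: sumr_ge0 => j _; case: (CP j).
move=> x y xc yc; have [t t01] := MVT01 (is_derive_line f x (y - x)).
rewrite scale1r scale0r addr0 subrKC => ->.
rewrite -sumrB; apply: le_trans (ler_norm_sum _ _ _) _.
rewrite mulr_suml; apply: ler_sum => j _; rewrite -mulrBr normrM expr2 mulrA mulrC.
apply: ler_pM => //; last exact: rv_coord_le.
apply: le_trans ((CP j).2 _ _ xc (in_box_line xc yc t01)) _.
rewrite addrAC subrr add0r; apply: ler_wpM2l; first exact: (CP j).1.
case/andP: t01 => t0 t1; rewrite normrZ ger0_norm //.
by rewrite ler_piMl.
Qed.

End EuclideanSmooth.

(** * Hadamard difference quotients *)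

Section DifferenceQuotient.
Context {R : realType} {n : nat}.
Local Notation S := (smoothFun (@Rn R n)).
Implicit Types (f g : S) (x y v : 'rV[R]_n) (i j : 'I_n) (l t c C : R).

Definition set_coord i l x : 'rV[R]_n := \row_j if j == i then l else x 0 j.

(** At [t = 0] the point lies on the hyperplane [x_i = l], at [t = 1] it is [x]. *)
Definition seg i l x t : 'rV[R]_n :=
  set_coord i l x + t *: ((x 0 i - l) *: delta_mx 0 i).

Lemma segE i l x t j :
  seg i l x t 0 j = if j == i then l + t * (x 0 i - l) else x 0 j.
Proof.
rewrite !mxE eqxx /=; case: eqP => _; first by rewrite mulr1.
by rewrite !mulr0 addr0.
Qed.

Lemma seg1 i l x : seg i l x 1 = x.
Proof. by apply/rowP => j; rewrite segE; case: eqP => [->|//]; rewrite mul1r subrKC. Qed.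

Lemma seg_box i l x t c : `|l| <= c -> in_box c x -> 0 <= t <= 1 -> in_box c (seg i l x t).
Proof.
move=> lc xc t01; have sc : in_box c (set_coord i l x).
  by move=> j; rewrite mxE; case: ifP.
suff -> : seg i l x t = set_coord i l x + t *: (x - set_coord i l x).
  exact: in_box_line.
apply/rowP => j; rewrite segE !mxE; case: eqP => [->|_] //.
by rewrite subrr mulr0 addr0.
Qed.

(* The powers of [t] make the family [avg k] stable under differentiation. *)
Definition avg k i l f x : R := mean (fun t => t ^+ k * f (seg i l x t)).

Lemma avg_continuous k i l f x : continuous (fun t => t ^+ k * f (seg i l x t)).
Proof.
by move=> t; apply: cvgM; [exact: exprn_continuous|exact: line_continuous].
Qed.

Lemma avg_bound k i l f x c C : `|l| <= c -> in_box c x ->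
  (forall y, in_box c y -> `|f y| <= C) -> `|avg k i l f x| <= C.
Proof.
move=> lc xc fC; apply: mean_bound; first exact: avg_continuous.
move=> t t01; have /andP[t0 t1] := t01.
rewrite normrM normrX ger0_norm // -[leRHS]mul1r.
apply: ler_pM => //; first exact: exprn_ge0.
  exact: exprn_ile1.
exact/fC/seg_box.
Qed.

(** Differentiation under the integral: moving [x_i] moves the point of the segment at rate [t],
    hence one more power of [t] exactly when [j = i]. *)
Definition avg_grad k i l f x v : R := \sum_j avg (k + (j == i)) i l (pd j f) x * v 0 j.

Lemma avg_grad_linear k i l f x : linear (avg_grad k i l f x).
Proof.
move=> a u v; rewrite /avg_grad scaler_sumr -big_split; apply: eq_bigr => j _ /=.
by rewrite !mxE mulrDr; congr (_ + _); rewrite mulrCA.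
Qed.

Lemma avg_grad_continuous k i l f x : continuous (avg_grad k i l f x).
Proof.
by apply: continuous_sumr => j; apply: continuousMr; exact: coord_continuous.
Qed.

Lemma avg_taylor1 k i l f x : exists2 C : R, 0 <= C & forall h : 'rV[R]_n, `|h| <= 1 ->
  `|avg k i l f (h + x) - avg k i l f x - avg_grad k i l f x h| <= C * `|h| ^+ 2.
Proof.
(* This box contains the segments of [x] and of every [h + x] with [|h| <= 1]. *)
pose c := `|x| + `|l| + 1.
have [C C0 fC] := box_taylor1 f c; exists C => // h h1.
have lc : `|l| <= c by rewrite /c -addrA addrCA lerDl addr_ge0.
have xc : in_box c x.
  by move=> j; apply: le_trans (rv_coord_le x j) _; rewrite /c -addrA lerDl addr_ge0.
have hxc : in_box c (h + x).
  move=> j; rewrite mxE; apply: le_trans (ler_normD _ _) _.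
  rewrite /c addrC lerD //; last exact: le_trans (rv_coord_le h j) h1.
  by apply: le_trans (rv_coord_le x j) _; rewrite lerDl.
have c1 := @avg_continuous k i l f (h + x); have c2 := @avg_continuous k i l f x.
have c3 j := @avg_continuous (k + (j == i)) i l (pd j f) x.
have c2' := continuousMr (a := -1) c2.
have c12 : continuous (fun t => t ^+ k * f (seg i l (h + x) t) +
    (-1) * (t ^+ k * f (seg i l x t))).
  by move=> t; apply: cvgD; [exact: c1|exact: c2'].
have cs : continuous (fun t => \sum_j (- h 0 j) * (t ^+ (k + (j == i)) * pd j f (seg i l x t))).
  by apply: continuous_sumr => j; exact: continuousMr.
have -> : avg k i l f (h + x) - avg k i l f x - avg_grad k i l f x h =
    mean (fun t => t ^+ k * f (seg i l (h + x) t) + (-1) * (t ^+ k * f (seg i l x t)) +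
      \sum_j (- h 0 j) * (t ^+ (k + (j == i)) * pd j f (seg i l x t))).
  rewrite meanD // meanD // ?meanZ // ?mean_sum //; last by move=> j; exact: continuousMr.
  rewrite mulN1r; congr (_ + _); rewrite /avg_grad -sumrN; apply: eq_bigr => j _.
  by rewrite meanZ // mulNr mulrC.
apply: mean_bound => [|t t01].
  by move=> t; apply: cvgD; [exact: c12|exact: cs].
have /andP[t0 t1] := t01.
set y := seg i l x t; set z := seg i l (h + x) t.
have zyE j : (z - y) 0 j = t ^+ (j == i) * h 0 j.
  rewrite mxE [(- y) 0 j]mxE !segE !mxE; case: eqP => [->|_] /=; ring.
have zy : `|z - y| <= `|h|.
  apply/rv_norm_leP => // j; rewrite zyE normrM; apply: le_trans (rv_coord_le h j).
  by rewrite ler_piMl // normrX ger0_norm // exprn_ile1.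
rewrite [X in `|X|](_ : _ = t ^+ k * (f z - f y - \sum_j (z - y) 0 j * pd j f y)); last first.
  rewrite !mulrBr mulr_sumr -sumrN mulN1r; congr (_ + _); apply: eq_bigr => j _.
  by rewrite zyE exprD; ring.
rewrite normrM normrX ger0_norm //; apply: le_trans.
  apply: ler_piMl; [exact: normr_ge0|exact: exprn_ile1].
apply: le_trans (fC _ _ _ _) _; [exact: seg_box|exact: seg_box|].
by apply: ler_wpM2l => //; rewrite ler_sqr ?nnegrE.
Qed.

Lemma avg_diff k i l f x : differentiable (avg k i l f) x /\
  'd (avg k i l f) x = avg_grad k i l f x :> ('rV[R]_n -> R).
Proof.
pose LM := GRing.isLinear.Build _ _ _ _ _ (avg_grad_linear k i l f x).
pose L : {linear 'rV[R]_n -> R} := HB.pack (avg_grad k i l f x) LM.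
have [C C0 CP] := avg_taylor1 k i l f x.
apply: (@differentiable_of_remainder _ _ (avg k i l f) x L); first exact: avg_grad_continuous.
move=> e e0; pose d := Num.min 1 (e / (C + 1)).
have C1 : 0 < C + 1 by rewrite ltr_wpDl.
have d0 : 0 < d by rewrite lt_min ltr01 divr_gt0.
near=> h; have hd : `|h| <= d.
  by near: h; exact: (@nbhs0_le _ 'rV[R]_n d d0).
apply: le_trans (CP h _) _; first by apply: le_trans hd _; rewrite ge_min lexx.
rewrite expr2 mulrA ler_wpM2r //.
have hC : `|h| * (C + 1) <= e.
  by rewrite -ler_pdivlMr //; apply: le_trans hd _; rewrite ge_min lexx orbT.
by apply: le_trans hC; rewrite mulrC ler_wpM2l // lerDl.
Unshelve. all: by end_near. Qed.

Lemma derive_avg k i l f v x :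
  'D_v (avg k i l f) x = \sum_j v 0 j * avg (k + (j == i)) i l (pd j f) x.
Proof.
have [df dE] := avg_diff k i l f x.
by rewrite deriveE // dE; apply: eq_bigr => j _; rewrite mulrC.
Qed.

Lemma avg_smooth k i l f : smooth [set: 'rV[R]_n] (avg k i l f).
Proof.
move=> m; elim: m k f => [|m IH] k f.
  by move=> x _; apply: differentiable_continuous; exact: (avg_diff k i l f x).1.
split=> [x _|v]; first exact: (avg_diff k i l f x).1.
rewrite (_ : (fun x => _) = fun x => \sum_j v 0 j * avg (k + (j == i)) i l (pd j f) x).
  by apply: Ck_sum => [|j]; [exact: openT|apply: CkM; [exact: openT|exact: Ck_cst|exact: IH]].
by apply/funext => x; rewrite derive_avg.
Qed.

Definition savg k i l f : S := SmoothFun ((smooth_on_RnP _).2 (avg_smooth k i l f)).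

Lemma pd_savg k i l f j : pd j (savg k i l f) = savg (k + (j == i)) i l (pd j f).
Proof.
apply: smoothFun_eq => x /=; rewrite derive_avg (bigD1 j) //= mxE !eqxx mul1r.
rewrite big1 ?addr0 // => j' j'j; rewrite mxE eqxx /=.
by rewrite (negPf j'j) mul0r.
Qed.

Lemma restr_smooth i l f : smooth [set: 'rV[R]_n] (fun x => f (set_coord i l x)).
Proof.
apply: smooth_comp_mx (sfun_smooth f) => // [|j]; first exact: openT.
under eq_fun do rewrite /set_coord mxE.
case: (j == i); last exact: smooth_coord.
by move=> k; exact: Ck_cst.
Qed.

Definition restr i l f : S := SmoothFun ((smooth_on_RnP _).2 (restr_smooth i l f)).

Lemma restrE i l f x : restr i l f x = f (set_coord i l x).
Proof. by []. Qed.

(** Hadamard's form of the quotient of [f - restr i l f] by ['X_i - l]. It is smooth across the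
    hyperplane [x_i = l], where it equals the partial derivative. *)
Definition dq i l f : S := savg 0 i l (pd i f).

Local Notation "''X_' i" := (Rn_coord i : S).
Local Notation "l %:S" := (sf_cst (Rn n) l : S) (at level 2, format "l %:S").

Lemma dqE i l f : f = restr i l f + ('X_i - l%:S) * dq i l f.
Proof.
apply: smoothFun_eq => x.
change (f x = f (set_coord i l x) + (x 0 i - l) * avg 0 i l (pd i f) x).
apply/eqP; rewrite addrC -subr_eq; apply/eqP; rewrite /avg.
 under eq_fun do rewrite expr0 mul1r.
rewrite -meanZ; last exact: line_continuous.
have dseg (t : R) := is_derive_line f (set_coord i l x) ((x 0 i - l) *: delta_mx 0 i) t.
have sumE t : \sum_j ((x 0 i - l) *: delta_mx 0 i : 'rV[R]_n) 0 j * pd j f (seg i l x t) =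
    (x 0 i - l) * pd i f (seg i l x t).
  rewrite (bigD1 i) //= !mxE !eqxx mulr1 big1 ?addr0 // => j ji.
  by rewrite !mxE (negPf ji) andbF mulr0 mul0r.
have dseg' t : is_derive t (1 : R) (fun t => f (seg i l x t)) ((x 0 i - l) * pd i f (seg i l x t)).
  by rewrite -sumE.
rewrite (mean_derive _ dseg'); last by apply: continuousMr; exact: line_continuous.
by rewrite seg1 /seg scale0r addr0.
Qed.

(** Off the hyperplane [x_i = l] one divides; on it [g] is a limit of zeros along the i-th
    coordinate line. *)
Lemma coord_cancel i l g : ('X_i - l%:S) * g = 0 -> g = 0.
Proof.
move=> g0; apply: smoothFun_eq => x; change (g x = 0).
have {}g0 y : (y 0 i - l) * g y = 0 by have := congr1 (fun g : S => g y) g0.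
have [xl|xl] := eqVneq (x 0 i) l; last first.
  by have /eqP := g0 x; rewrite mulf_eq0 subr_eq0 (negPf xl) => /eqP.
have cg : (fun t : R => g (x + t *: delta_mx 0 i)) @ (0 : R)^' --> g x.
  have h := @line_continuous _ _ g x (delta_mx 0 i) 0.
  rewrite /continuous_at scale0r addr0 in h.
  exact: cvg_within_filter h.
apply: cvg_unique cg _ => //; apply: cvg_near_cst.
near=> t; have t0 : t != 0 by near: t; exact: nbhs_dnbhs_neq.
have /eqP := g0 (x + t *: delta_mx 0 i).
by rewrite !mxE !eqxx mulr1 xl addrAC subrr add0r mulf_eq0 (negPf t0) => /eqP.
Unshelve. all: by end_near. Qed.

Lemma restrD i l f g : restr i l (f + g) = restr i l f + restr i l g.
Proof. exact: smoothFun_eq. Qed.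

Lemma restrM i l f g : restr i l (f * g) = restr i l f * restr i l g.
Proof. exact: smoothFun_eq. Qed.

Lemma restr_cst i l a : restr i l a%:S = a%:S.
Proof. exact: smoothFun_eq. Qed.

Lemma restr_coord i l j : restr i l 'X_j = if j == i then l%:S else 'X_j.
Proof. by apply: smoothFun_eq => x /=; rewrite !mxE; case: eqP. Qed.

Lemma restr_restr i l m f : restr i m (restr i l f) = restr i l f.
Proof.
apply: smoothFun_eq => x /=; congr (f _); apply/rowP => j.
by rewrite !mxE; case: eqP.
Qed.

Lemma restrC i j l m f : i != j -> restr i l (restr j m f) = restr j m (restr i l f).
Proof.
move=> ij; apply: smoothFun_eq => x /=; congr (f _); apply/rowP => k.
by rewrite !mxE; case: eqP => [->|//]; rewrite eq_sym (negPf ij).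
Qed.

Definition indep i f := forall l, restr i l f = f.

(** Evaluation at [x_i = l] recovers the remainder, then [coord_cancel] the quotient. The algebraic
    rules for [dq] below follow from this uniqueness. *)
Lemma dq_unique i l f (c q : S) : indep i c -> f = c + ('X_i - l%:S) * q ->
  restr i l f = c /\ dq i l f = q.
Proof.
move=> ic fE; have rf : restr i l f = c.
  rewrite fE; apply: smoothFun_eq => x.
  have /= := congr1 (fun f : S => f x) (ic l).
  by rewrite mxE eqxx subrr mul0r addr0.
have E : ('X_i - l%:S) * dq i l f = ('X_i - l%:S) * q.
  by apply: (@addrI _ c); rewrite -fE -rf -dqE.
split=> //; apply: subr0_eq; apply: (@coord_cancel i l).
by rewrite mulrBr E subrr.
Qed.

Lemma restr_indep i l f : indep i (restr i l f).
Proof. by move=> m; exact: restr_restr. Qed.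

Lemma restr_indepT i j l f : indep i f -> indep i (restr j l f).
Proof.
move=> fi m; have [->|ij] := eqVneq i j; first exact: restr_restr.
by rewrite restrC // fi.
Qed.

Lemma cst_indep i a : indep i a%:S.
Proof. by move=> l; rewrite restr_cst. Qed.

Lemma coord_indep i j : j != i -> indep i 'X_j.
Proof. by move=> ji l; rewrite restr_coord (negPf ji). Qed.

Lemma dqD i l f g : dq i l (f + g) = dq i l f + dq i l g.
Proof.
apply: (@dq_unique i l _ (restr i l f + restr i l g) _ _ _).2.
  by move=> m; rewrite restrD !restr_restr.
by rewrite mulrDr addrACA -!dqE.
Qed.

(** The Leibniz rule of divided differences, with one factor frozen at the node; it is what makes
    interpolation multiplicative. *)
Lemma dqM i l f g : dq i l (f * g) = restr i l f * dq i l g + dq i l f * g.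
Proof.
apply: (@dq_unique i l _ (restr i l f * restr i l g) _ _ _).2.
  by move=> m; rewrite restrM !restr_restr.
rewrite [in LHS](dqE i l f) mulrDl {1}[in LHS](dqE i l g).
by rewrite !mulrDr !mulrA addrA [_ * restr i l f]mulrC.
Qed.

Lemma dq_indep i l (c : S) : indep i c -> dq i l c = 0.
Proof.
by move=> ic; apply: (@dq_unique i l _ c _ _ _).2 => //; rewrite mulr0 addr0.
Qed.

Lemma dq_indepM i l (c f : S) : indep i c -> dq i l (c * f) = c * dq i l f.
Proof. by move=> ic; rewrite dqM ic (@dq_indep i l c ic) mul0r addr0. Qed.

Lemma dq_coordM i l m f : dq i l (('X_i - m%:S) * f) = (l - m)%:S * dq i l f + f.
Proof.
apply: (@dq_unique i l _ ((l - m)%:S * restr i l f) _ _ _).2.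
  by move=> k; rewrite restrM restr_cst restr_restr.
have -> : 'X_i - m%:S = (l - m)%:S + ('X_i - l%:S).
  by apply: smoothFun_eq => x /=; ring.
by rewrite mulrDl {1}(dqE i l f) !mulrDr -!addrA !mulrA [_ * (l - m)%:S]mulrC.
Qed.

Lemma restr_dq i j l m f : i != j -> restr j m (dq i l f) = dq i l (restr j m f).
Proof.
move=> ij; apply/esym; apply: (@dq_unique i l _ (restr j m (restr i l f)) _ _ _).2.
  by apply: restr_indepT; exact: restr_indep.
rewrite {1}(dqE i l f) restrD restrM; congr (_ + _ * _).
by apply: smoothFun_eq => x /=; rewrite mxE (negPf ij).
Qed.

Lemma dq_indepT i j l f : indep j f -> indep j (dq i l f).
Proof.
have [->|ij] := eqVneq i j; last by move=> fj m; rewrite restr_dq // fj.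
by move=> fj m; rewrite dq_indep // /restr; exact: smoothFun_eq.
Qed.

(** One bound for all iterated partial derivatives up to order [k]. A divided difference costs one
    order but leaves [c] and [C] unchanged, wherever the node lies in [[-c, c]]. *)
Fixpoint bounded_jet (k : nat) (c C : R) f : Prop :=
  (forall x, in_box c x -> `|f x| <= C) /\
  match k with
  | 0 => True
  | k'.+1 => forall j, bounded_jet k' c C (pd j f)
  end.

Lemma bounded_jet_leC k c C C' f : C <= C' -> bounded_jet k c C f -> bounded_jet k c C' f.
Proof.
move=> CC'; elim: k f => [|k IH] f /= [fC Bf]; split=> //; last by move=> j; exact: IH.
  by move=> x xc; apply: le_trans (fC x xc) CC'.
by move=> x xc; apply: le_trans (fC x xc) CC'.
Qed.

Lemma bounded_jet_ex k c f : exists2 C : R, 0 <= C & bounded_jet k c C f.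
Proof.
elim: k f => [|k IH] f; have [C C0 fC] := box_bounded f c; first by exists C.
have /choice[C' C'P] : forall j, exists C : R, 0 <= C /\ bounded_jet k c C (pd j f).
  by move=> j; have [C1 C10 C1P] := IH (pd j f); exists C1.
have S0 : 0 <= \sum_j C' j by apply: sumr_ge0 => j _; case: (C'P j).
exists (C + \sum_j C' j); first by rewrite addr_ge0.
split=> [x xc|j]; first by apply: le_trans (fC x xc) _; rewrite lerDl.
apply: bounded_jet_leC (C'P j).2; rewrite (bigD1 j) //= addrCA lerDl addr_ge0 //.
by apply: sumr_ge0 => i _; case: (C'P i).
Qed.

Lemma bounded_jet_savg k k' i l c C f : `|l| <= c ->
  bounded_jet k c C f -> bounded_jet k c C (savg k' i l f).
Proof.
move=> lc; elim: k k' f => [|k IH] k' f /= [fC Bf]; split=> //.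
- by move=> x xc; exact: avg_bound fC.
- by move=> x xc; exact: avg_bound fC.
- by move=> j; rewrite pd_savg; exact: IH.
Qed.

Lemma bounded_jet_dq k i l c C f : `|l| <= c ->
  bounded_jet k.+1 c C f -> bounded_jet k c C (dq i l f).
Proof. by move=> lc [_ Bf]; exact: bounded_jet_savg lc (Bf i). Qed.

Lemma sum_deltaE j (F : 'I_n -> R) : \sum_k (delta_mx 0 j : 'rV[R]_n) 0 k * F k = F j.
Proof.
rewrite (bigD1 j) //= mxE !eqxx mul1r big1 ?addr0 // => k kj.
by rewrite mxE (negPf kj) andbF mul0r.
Qed.

Lemma pd_restr i j l f : pd j (restr i l f) = if j == i then 0 else restr i l (pd j f).
Proof.
apply: smoothFun_eq => x; pose w : 'rV[R]_n := if j == i then 0 else delta_mx 0 j.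
have E t : set_coord i l (x + t *: delta_mx 0 j) = set_coord i l x + t *: w.
  apply/rowP => k; rewrite /w !mxE; case: (j =P i) => [->|ji]; rewrite !mxE eqxx /=;
    case: (k =P i) => [ki|ki]; rewrite ?mulr0 ?addr0 //.
  by rewrite (_ : k == j = false) ?mulr0 ?addr0 //; apply/eqP => kj; apply: ji; rewrite -kj.
have [_ d1] := is_derive_line (restr i l f) x (delta_mx 0 j) 0.
have [_ d2] := is_derive_line f (set_coord i l x) w 0.
have e : (fun t : R => restr i l f (x + t *: delta_mx 0 j)) =
    (fun t : R => f (set_coord i l x + t *: w)) by apply/funext => t; rewrite restrE E.
rewrite e {}d2 !scale0r !addr0 sum_deltaE in d1.
rewrite -d1 /w; case: (j == i) => /=; last exact: sum_deltaE.
by apply: big1 => k _; rewrite mxE mul0r.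
Qed.

Lemma bounded_jet_restr k i l c C f : `|l| <= c -> 0 <= C ->
  bounded_jet k c C f -> bounded_jet k c C (restr i l f).
Proof.
move=> lc C0; have bs x : in_box c x -> in_box c (set_coord i l x).
  by move=> xc j; rewrite mxE; case: ifP.
have B0 k' : bounded_jet k' c C (0 : S).
  elim: k' => [|k' IH] /=; split=> //; try by move=> x _; rewrite normr0.
  move=> j.
  suff -> : pd j (0 : S) = 0 :> S by [].
  by apply: smoothFun_eq => x /=; exact: derive_cst.
elim: k f => [|k IH] f /= [fC Bf]; split=> //.
- by move=> x /bs; exact: fC.
- by move=> x /bs; exact: fC.
- by move=> j; rewrite pd_restr; case: ifP => _ //; exact: IH.
Qed.

End DifferenceQuotient.

(** * Newton interpolation in a noncommutative algebra *)

Section AlgHom.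
Context {R : realType} {B : pzRingType} (kappa : R -> B).

Definition is_alghom (M : cinfSpace R) (rho : smoothFun M -> B) : Prop :=
  [/\ {morph rho : f g / f + g}, {morph rho : f g / f * g}
    & forall c, rho (sf_cst M c) = kappa c].

End AlgHom.

Section Newton.
Context {R : realType} {n : nat} {B : pzRingType} (kappa : R -> B).
Local Notation S := (smoothFun (@Rn R n)).
Local Notation "''X_' i" := (Rn_coord i : S).
Local Notation "l %:S" := (sf_cst (Rn n) l : S) (at level 2, format "l %:S").
Implicit Types (f g : S) (i j : 'I_n) (s : seq R) (rho : S -> B) (y b : B) (l : 'I_n -> seq R).

Definition node_prod (a : B) s : B := \prod_(m <- s) (a - kappa m).

(** Newton's formula in Horner form with the last remainder dropped. [rho] evaluates the
    restrictions, which involve only the other variables; repeated nodes produce Taylor terms. *)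
Fixpoint newt1 (a : B) i s rho f : B :=
  if s is m :: s' then rho (restr i m f) + (a - kappa m) * newt1 a i s' rho (dq i m f)
  else 0.

Fixpoint newton_rec (a : 'I_n -> B) l (vs : seq 'I_n) rho : S -> B :=
  if vs is i :: vs' then newt1 (a i) i (l i) (newton_rec a l vs' rho) else rho.

(* Newton interpolation of [f], one variable at a time, at the nodes [l i] of
   the i-th variable, evaluated at [a]. *)
Definition newton (a : 'I_n -> B) l f : B :=
  newton_rec a l (enum 'I_n) (fun g => kappa (g 0)) f.

Hypothesis kappaD : {morph kappa : c d / c + d}.
Hypothesis kappaM : {morph kappa : c d / c * d}.
Hypothesis kappa1 : kappa 1 = 1.
Hypothesis kappaC : forall c b, GRing.comm (kappa c) b.

Lemma kappa0 : kappa 0 = 0.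
Proof. by apply: (@addrI _ (kappa 0)); rewrite -kappaD !addr0. Qed.

Lemma kappaB c d : kappa (c - d) = kappa c - kappa d.
Proof. by apply: (@addIr _ (kappa d)); rewrite -kappaD !subrK. Qed.

Lemma node_prod_cons (a : B) m s : node_prod a (m :: s) = (a - kappa m) * node_prod a s.
Proof. by rewrite /node_prod big_cons. Qed.

Lemma comm_node (a b : B) m : GRing.comm a b -> GRing.comm (a - kappa m) b.
Proof. by move=> ab; apply/commr_sym/commrB; [exact: commr_sym|exact/commr_sym/kappaC]. Qed.

Lemma comm_node_prod (a b : B) s : GRing.comm a b -> GRing.comm (node_prod a s) b.
Proof.
move=> ab; rewrite /node_prod; elim: s => [|m s IH].
  by rewrite big_nil; exact/commr_sym/commr1.
by rewrite big_cons; apply/commr_sym/commrM; apply: commr_sym => //; exact: comm_node.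
Qed.

Lemma comm_newt1 (a b : B) i s rho f : GRing.comm a b ->
  (forall f, GRing.comm (rho f) b) -> GRing.comm (newt1 a i s rho f) b.
Proof.
move=> ab rb; elim: s f => [|m s IH] f /=; first by apply: commr_sym; exact: commr0.
apply/commr_sym/commrD; first exact/commr_sym/rb.
by apply: commrM; apply: commr_sym; [exact: comm_node|exact: IH].
Qed.

Lemma comm_newton_rec (a : 'I_n -> B) l vs rho b f : (forall i, GRing.comm (a i) b) ->
  (forall f, GRing.comm (rho f) b) -> GRing.comm (newton_rec a l vs rho f) b.
Proof.
by move=> ab rb; elim: vs f => [|i vs IH] f //=; exact: comm_newt1.
Qed.

Section OneVariable.
Variables (a : B) (i : 'I_n) (rho : S -> B).
Hypothesis rho_hom : is_alghom kappa rho.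
Hypothesis rhoC : forall f, GRing.comm a (rho f).
Local Notation N := (newt1 a i).
Local Notation Y := (node_prod a).

Let rhoD : {morph rho : f g / f + g}. Proof. by case: rho_hom. Qed.
Let rhoM : {morph rho : f g / f * g}. Proof. by case: rho_hom. Qed.
Let rhoK c : rho c%:S = kappa c. Proof. by case: rho_hom. Qed.

Lemma newt1D s f g : N s rho (f + g) = N s rho f + N s rho g.
Proof.
elim: s f g => [|m s IH] f g /=; first by rewrite addr0.
by rewrite restrD rhoD dqD IH mulrDr addrACA.
Qed.

Lemma newt1_0 s : N s rho 0 = 0.
Proof. by apply: (@addrI _ (N s rho 0)); rewrite -newt1D !addr0. Qed.

(** For the empty list the node product is 1, so [y = 0] and the vanishing interpolant does no harm.
    Here and below [y] expresses identities modulo the node product; in inductions on the nodes the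
    factor [a - kappa m] is absorbed into [y]. *)
Lemma newt1_indep s y f : indep i f -> y * Y s = 0 -> y * N s rho f = y * rho f.
Proof.
move=> fi; case: s => [|m s]; first by rewrite /node_prod big_nil mulr1 => ->; rewrite !mul0r.
by move=> _ /=; rewrite fi dq_indep // newt1_0 mulr0 addr0.
Qed.

Lemma newt1_indepM s f g : indep i f -> N s rho (f * g) = rho f * N s rho g.
Proof.
move=> fi; elim: s g => [|m s IH] g /=; first by rewrite mulr0.
rewrite restrM fi rhoM dq_indepM // IH mulrDr; congr (_ + _).
by rewrite !mulrA (comm_node m (rhoC f)).
Qed.

(** Expanding [f] by [dqE] reduces an extra node to multiplication by a coordinate. The list [s] is
    fixed because [newt1_coordM] calls this for [s] while proving its own claim for a longer
    list. *)
Lemma newt1_cons_of_coordM s :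
  (forall y m f, y * Y s = 0 ->
     y * N s rho (('X_i - m%:S) * f) = y * (a - kappa m) * N s rho f) ->
  forall y m f, y * Y s = 0 -> y * N (m :: s) rho f = y * N s rho f.
Proof.
move=> coordM y m f yY; rewrite [f in RHS](dqE i m) newt1D [RHS]mulrDr.
by rewrite coordM // (newt1_indep (@restr_indep _ _ i m f) yY) /= mulrDr mulrA.
Qed.

Lemma newt1_coordM s y m f : y * Y s = 0 ->
  y * N s rho (('X_i - m%:S) * f) = y * (a - kappa m) * N s rho f.
Proof.
elim: s y m f => [|k s IH] y m f yY; first by rewrite /= !mulr0.
have consE := newt1_cons_of_coordM IH.
rewrite node_prod_cons mulrA in yY.
have -> : N (k :: s) rho (('X_i - m%:S) * f) =
    kappa (k - m) * N (k :: s) rho f + (a - kappa k) * N s rho f.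
  rewrite /= restrM (_ : restr i k ('X_i - m%:S) = (k - m)%:S); last first.
    by apply: smoothFun_eq => x /=; rewrite mxE eqxx.
  rewrite rhoM rhoK dq_coordM newt1D newt1_indepM ?rhoK; last exact: cst_indep.
  by rewrite !mulrDr !mulrA (kappaC (k - m) (a - kappa k)) addrA.
(* Since [y * (a - kappa k)] kills the node product of [s], the node [k] can be restored in the last
   term; then [(k - m) + (a - k) = a - m]. *)
rewrite mulrDr !mulrA -(consE _ k) // -mulrDl -mulrDr; congr (_ * _ * _).
by rewrite kappaB addrC addrA subrK.
Qed.

Lemma newt1_cons s y m f : y * Y s = 0 -> y * N (m :: s) rho f = y * N s rho f.
Proof. by apply: newt1_cons_of_coordM => *; exact: newt1_coordM. Qed.

Lemma comm_newt1_node_prod s s' f : GRing.comm (N s rho f) (Y s').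
Proof.
apply/commr_sym/comm_node_prod/commr_sym; apply: comm_newt1 => [|f'].
  exact: commr_refl.
exact: commr_sym.
Qed.

(** By [dqM] the first factor splits off at the node, and induction handles the rest. The node
    missing in the interpolant of [g] is put back because the interpolant of [dq i m f] commutes
    with the node product. *)
Lemma newt1M s y f g : y * Y s = 0 ->
  y * N s rho (f * g) = y * (N s rho f * N s rho g).
Proof.
elim: s y f g => [|m s IH] y f g yY; first by rewrite /= !mulr0.
rewrite node_prod_cons mulrA in yY.
have NY := comm_newt1_node_prod s s (dq i m f).
have -> : N (m :: s) rho (f * g) =
    rho (restr i m f) * N (m :: s) rho g + (a - kappa m) * N s rho (dq i m f * g).
  rewrite /= restrM rhoM dqM newt1D newt1_indepM; last exact: restr_indep.
  rewrite !mulrDr !mulrA (comm_node m (rhoC _)) addrA; congr (_ + _).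
rewrite mulrDr [y * ((a - _) * _)]mulrA IH // [in RHS]/= mulrDl mulrDr; congr (_ + _).
rewrite -!mulrA [y * _]mulrA [RHS]mulrA -/(newt1 _ _ (m :: s) _ _) !mulrA.
by rewrite newt1_cons // -mulrA NY mulrA yY mul0r.
Qed.

Lemma newt1_hom s : Y s = 0 -> is_alghom kappa (N s rho).
Proof.
move=> Y0; have y1 : 1 * Y s = 0 by rewrite mul1r.
split=> [f g|f g|c]; first exact: newt1D.
  by have := newt1M f g y1; rewrite !mul1r.
by have := newt1_indep (@cst_indep _ _ i c) y1; rewrite !mul1r rhoK.
Qed.

Lemma newt1_coord s : Y s = 0 -> N s rho 'X_i = a.
Proof.
move=> Y0; have y1 : 1 * Y s = 0 by rewrite mul1r.
have X0 : ('X_i - 0%:S) * 1%:S = 'X_i by apply: smoothFun_eq => x /=; ring.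
have := newt1_coordM 0 1%:S y1; have := newt1_indep (@cst_indep _ _ i 1) y1.
by rewrite X0 !mul1r rhoK kappa1 kappa0 subr0 => ->; rewrite mulr1.
Qed.

End OneVariable.

Section Hom.
Variables (a : 'I_n -> B) (l : 'I_n -> seq R).
Hypothesis aC : forall i j, GRing.comm (a i) (a j).
Hypothesis al : forall i, node_prod (a i) (l i) = 0.

Let ev0 g := kappa (g 0).
Let ev0_hom : is_alghom kappa ev0.
Proof. by split=> [f g|f g|c]; [exact: kappaD|exact: kappaM|]. Qed.

Let newton_rec_comm vs i f : GRing.comm (a i) (newton_rec a l vs ev0 f).
Proof.
apply/commr_sym/comm_newton_rec => [j|g]; [exact: aC|exact: kappaC].
Qed.

Lemma newton_rec_hom vs : is_alghom kappa (newton_rec a l vs ev0).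
Proof. by elim: vs => [|i vs IH] //=; apply: newt1_hom => // f; exact: newton_rec_comm. Qed.

Lemma newton_hom : is_alghom kappa (newton a l).
Proof. exact: newton_rec_hom. Qed.

Lemma newton_coord i : newton a l 'X_i = a i.
Proof.
suff h vs : i \in vs -> newton_rec a l vs ev0 'X_i = a i by apply: h; rewrite mem_enum.
elim: vs => // j vs IH; rewrite in_cons /=.
have vh := newton_rec_hom vs; have vc f := newton_rec_comm vs j f.
have [<-|ij] /= := eqVneq i j; first by move=> _; apply: newt1_coord.
move=> /IH <-; have y1 : 1 * node_prod (a j) (l j) = 0 by rewrite al mulr0.
by have := newt1_indep vh (coord_indep ij) y1; rewrite !mul1r.
Qed.

End Hom.

Lemma eq_newt1 (a : B) i s rho rho' (W : S -> Prop) f :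
  (forall m f, W f -> W (dq i m f)) ->
  (forall m f, W f -> rho (restr i m f) = rho' (restr i m f)) ->
  W f -> newt1 a i s rho f = newt1 a i s rho' f.
Proof.
move=> Wd rr; elim: s f => [|m s IH] f Wf //=.
by rewrite rr // IH //; exact: Wd.
Qed.

(** Only functions from which the variables [vs] have been eliminated ever reach [rho]. [W] records
    variables eliminated earlier; [restr] and [dq] both respect this. *)
Lemma eq_newton_rec (a : 'I_n -> B) l vs rho rho' (W : {pred 'I_n}) f :
  (forall f, (forall i, (i \in W) || (i \in vs) -> indep i f) -> rho f = rho' f) ->
  (forall i, i \in W -> indep i f) ->
  newton_rec a l vs rho f = newton_rec a l vs rho' f.
Proof.
elim: vs W f => [|i vs IH] W f rr fW.
  by apply: rr => i; rewrite orbF; exact: fW.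
pose WP f := forall j, j \in W -> indep j f.
apply: (@eq_newt1 _ _ _ _ _ WP) => // [m g gW j jW|m g gW].
  exact/dq_indepT/gW.
apply: (IH [predU1 i & W]) => [h hW|j].
  apply: rr => j; rewrite in_cons => jW; apply: hW.
  by rewrite inE; move: jW; rewrite orbCA orbA.
rewrite inE => /predU1P[->|jW]; first exact: restr_indep.
exact/restr_indepT/gW.
Qed.

(* An algebra homomorphism kills [node_prod], hence the remainder of Newton
   interpolation. *)
Lemma newton_unique (phi : S -> B) l : is_alghom kappa phi ->
  (forall i, node_prod (phi 'X_i) (l i) = 0) ->
  phi =1 newton (fun i => phi 'X_i) l.
Proof.
move=> [phiD phiM phiK] Y0 f.
have phi_node i m : phi ('X_i - m%:S) = phi 'X_i - kappa m.
  by apply: (@addIr _ (kappa m)); rewrite -phiK -phiD !subrK.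
have step i s g : exists q,
    phi g = newt1 (phi 'X_i) i s phi g + node_prod (phi 'X_i) s * phi q.
  elim: s g => [|m s IH] g /=.
    by exists g; rewrite add0r /node_prod big_nil mul1r.
  have [q qE] := IH (dq i m g); exists q.
  rewrite {1}(dqE i m g) phiD phiM phi_node qE node_prod_cons.
  by rewrite mulrDr addrA mulrA.
have phi_rec vs : newton_rec (fun i => phi 'X_i) l vs phi = phi.
  elim: vs => //= i vs ->; apply/funext => g.
  by have [q ->] := step i (l i) g; rewrite Y0 mul0r addr0.
rewrite -[LHS](congr1 (fun h => h f) (phi_rec (enum 'I_n))).
apply: (@eq_newton_rec _ _ _ _ _ pred0) => // g gi.
have -> : g = (g 0)%:S; last exact: phiK.
apply: smoothFun_eq => x /=.
(* A function independent of every variable is constant: its coordinates are set to 0 one after the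
   other. *)
suff h (vs : seq 'I_n) : g x = g (\row_j if j \in vs then 0 else x 0 j).
  rewrite (h (enum 'I_n)); congr (g _); apply/rowP => j.
  by rewrite !mxE mem_enum.
elim: vs => [|i vs ->]; first by congr (g _); apply/rowP => j; rewrite mxE.
have gi0 : indep i g by apply: gi; rewrite mem_enum orbT.
rewrite -{1}(gi0 0) restrE; congr (g _); apply/rowP => j.
by rewrite !mxE in_cons; case: eqP.
Qed.

End Newton.

Section NewtonMorph.
Context {R : realType} {n : nat} {B B' : pzRingType}.
Variables (kappa : R -> B) (kappa' : R -> B') (theta : B -> B').
Hypothesis thetaD : {morph theta : x y / x + y}.
Hypothesis thetaM : {morph theta : x y / x * y}.
Hypothesis theta1 : theta 1 = 1.
Hypothesis thetaK : forall c, theta (kappa c) = kappa' c.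

Lemma morph0 : theta 0 = 0.
Proof. by apply: (@addrI _ (theta 0)); rewrite -thetaD !addr0. Qed.

Lemma morph_node a m : theta (a - kappa m) = theta a - kappa' m.
Proof. by apply: (@addIr _ (kappa' m)); rewrite -thetaK -thetaD !subrK. Qed.

Lemma node_prod_morph a s : theta (node_prod kappa a s) = node_prod kappa' (theta a) s.
Proof.
rewrite /node_prod; elim: s => [|m s IH]; first by rewrite !big_nil.
by rewrite !big_cons thetaM morph_node IH.
Qed.

(** Carries interpolation from sections to matrices at a point, and from complex to real
    matrices. *)
Lemma newton_morph (a : 'I_n -> B) l f :
  theta (newton kappa a l f) = newton kappa' (theta \o a) l f.
Proof.
rewrite /newton; elim: (enum 'I_n) f => [|i vs IH] f /=; first exact: thetaK.
elim: (l i) f => [|m s IHs] f /=; first exact: morph0.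
by rewrite thetaD thetaM morph_node IH IHs.
Qed.

End NewtonMorph.

(** * Functional calculus of commuting matrices *)

Section FunctionalCalculus.
Context {R : realType} {n : nat} {B : pzRingType} (kappa : R -> B).
Local Notation S := (smoothFun (@Rn R n)).
Hypothesis kappaD : {morph kappa : c d / c + d}.
Hypothesis kappaM : {morph kappa : c d / c * d}.
Hypothesis kappa1 : kappa 1 = 1.
Hypothesis kappaC : forall c b, GRing.comm (kappa c) b.
Implicit Types (a : 'I_n -> B) (l : 'I_n -> seq R) (f : S).

Definition annihilates a l := forall i, node_prod kappa (a i) (l i) = 0.

Definition commuting a := forall i j, GRing.comm (a i) (a j).

Definition fcalc a f : B :=
  newton kappa a (xget (fun=> [::]) [set l | annihilates a l]) f.

(** Interpolation at [l] is a homomorphism sending the coordinates to [a]; by [newton_unique] it is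
    also interpolation at the lists picked in [fcalc]. *)
Lemma fcalcE a l f : commuting a -> annihilates a l -> fcalc a f = newton kappa a l f.
Proof.
move=> aC al; have a0 : annihilates a (xget (fun=> [::]) [set l | annihilates a l]).
  by case: xgetP => [l' _ //|/(_ l)].
have N := newton_coord kappaD kappaM kappa1 kappaC aC al.
have hom : is_alghom kappa (newton kappa a l) by exact: newton_hom.
rewrite (newton_unique (l := xget (fun=> [::]) [set l | annihilates a l]) hom).
  by congr newton; apply/funext => i; rewrite N.
by move=> i; rewrite N.
Qed.

Lemma fcalc_hom a l : commuting a -> annihilates a l -> is_alghom kappa (fcalc a).
Proof.
move=> aC al; rewrite (_ : fcalc a = newton kappa a l); first exact: newton_hom.
by apply/funext => f; exact: fcalcE.
Qed.

Lemma fcalc_coord a l i : commuting a -> annihilates a l -> fcalc a (Rn_coord i) = a i.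
Proof. by move=> aC al; rewrite (fcalcE _ aC al); exact: newton_coord. Qed.

Lemma alghom_comm (M : cinfSpace R) (phi : smoothFun M -> B) (f g : smoothFun M) :
  is_alghom kappa phi -> GRing.comm (phi f) (phi g).
Proof. by case=> _ phiM _; rewrite /GRing.comm -!phiM mulrC. Qed.

Lemma fcalc_unique (phi : S -> B) l : is_alghom kappa phi ->
  annihilates (fun i => phi (Rn_coord i)) l ->
  phi =1 fcalc (fun i => phi (Rn_coord i)).
Proof.
move=> ph pl f; have pC : commuting (fun i => phi (Rn_coord i)).
  by move=> i j; exact: alghom_comm.
by rewrite (fcalcE f pC pl); exact: newton_unique.
Qed.

Lemma node_prod_cat (b : B) s s' :
  node_prod kappa b (s ++ s') = node_prod kappa b s * node_prod kappa b s'.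
Proof. by rewrite /node_prod big_cat. Qed.

Lemma annihilates_catl a l l' : annihilates a l -> annihilates a (fun i => l i ++ l' i).
Proof. by move=> al i; rewrite node_prod_cat al mul0r. Qed.

Lemma annihilates_catr a l l' : annihilates a l' -> annihilates a (fun i => l i ++ l' i).
Proof. by move=> al i; rewrite node_prod_cat al mulr0. Qed.

End FunctionalCalculus.

(** * Uniform estimates for commuting real matrices *)

Section RealMatrices.
Context {R : realType} {n : nat}.
Local Notation S := (smoothFun (@Rn R n)).
Implicit Types (l : 'I_n -> seq R) (f : S).

Local Notation kap := (@scalar_mx R _).

Section Scalars.
Variable N : nat.
Lemma scalar_morphD : {morph (kap : R -> 'M[R]_N) : c d / c + d}.
Proof. by move=> c d; exact: raddfD. Qed.
Lemma scalar_morphM : {morph (kap : R -> 'M[R]_N) : c d / c * d}.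
Proof. by move=> c d; exact: scalar_mxM. Qed.
Lemma scalar_central c (A : 'M[R]_N) : GRing.comm (kap c : 'M[R]_N) A.
Proof. by rewrite /GRing.comm -mulmxE scalar_mxC. Qed.
End Scalars.

Section MatrixCalculus.
Variables (N : nat) (A : 'I_n -> 'M[R]_N) (l : 'I_n -> seq R).
Hypothesis AC : commuting A.
Hypothesis Al : annihilates kap A l.

Lemma mx_fcalcE f : fcalc kap A f = newton kap A l f.
Proof. by apply: fcalcE; [exact: scalar_morphD|exact: scalar_morphM| |exact: scalar_central| |]. Qed.

Lemma mx_fcalc_hom : is_alghom kap (fcalc kap A).
Proof.
by apply: fcalc_hom Al => //;
  first [exact: scalar_morphD|exact: scalar_morphM|exact: scalar_central].
Qed.

Lemma mx_fcalc_coord i : fcalc kap A (Rn_coord i) = A i.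
Proof.
by apply: fcalc_coord Al => //;
  first [exact: scalar_morphD|exact: scalar_morphM|exact: scalar_central].
Qed.

End MatrixCalculus.

Definition mx_bound m N (c : R) (A : 'M[R]_(m, N)) := forall i j, `|A i j| <= c.

Lemma mx_bound_le m N (c c' : R) (A : 'M[R]_(m, N)) : c <= c' -> mx_bound c A -> mx_bound c' A.
Proof. by move=> cc' Ac i j; apply: le_trans cc'. Qed.

Lemma mx_boundD m N (c d : R) (A A' : 'M[R]_(m, N)) :
  mx_bound c A -> mx_bound d A' -> mx_bound (c + d) (A + A').
Proof.
by move=> Ac Ad i j; rewrite mxE; apply: le_trans (ler_normD _ _) _; exact: lerD.
Qed.

Lemma mx_boundM N (c d : R) (A A' : 'M[R]_N) :
  mx_bound c A -> mx_bound d A' -> mx_bound (N%:R * (c * d)) (A * A').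
Proof.
move=> Ac Ad i j; rewrite mxE; apply: le_trans (ler_norm_sum _ _ _) _.
rewrite -[N in leRHS]card_ord mulr_natl -sumr_const; apply: ler_sum => k _.
by rewrite normrM; apply: ler_pM.
Qed.

Lemma mx_bound_scalar N (c : R) : mx_bound `|c| (c%:M : 'M[R]_N).
Proof. by move=> i j; rewrite mxE; case: eqP => _; rewrite ?mulr1n ?mulr0n ?normr0. Qed.

Lemma bounded_jet_le k k' c C f : (k <= k')%N ->
  bounded_jet k' c C f -> bounded_jet k c C f.
Proof.
elim: k' k f => [|k' IH] [|k] f //= kk' [fC Bf]; split=> // j.
exact: IH (Bf j).
Qed.

Definition nodes_le (k : nat) (c : R) (s : seq R) :=
  (size s <= k)%N /\ forall m, m \in s -> `|m| <= c.

(** [K'] depends on the number and range of the nodes, not on their position. Each node costs one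
    order of the jet and replaces [K'] by [K + N * 2c * K']: [2c] bounds the entries of [A - m], and
    [N] comes from the matrix product. *)
Lemma newt1_bound N (i : 'I_n) k o (c K : R) : 0 <= c -> 0 <= K ->
  exists2 K' : R, 0 <= K' & forall (A : 'M[R]_N) s (rho : S -> 'M[R]_N),
    mx_bound c A -> nodes_le k c s ->
    (forall f C, 0 <= C -> bounded_jet o c C f -> mx_bound (K * C) (rho f)) ->
    forall f C, 0 <= C -> bounded_jet (o + k) c C f ->
      mx_bound (K' * C) (newt1 kap A i s rho f).
Proof.
move=> c0 K0; elim: k => [|k [K' K'0 IH]].
  exists 0 => // A s rho Ac [s0 _] _ f C C0 _; case: s s0 => // _ j1 j2.
  by rewrite /= mxE normr0 mul0r.
exists (K + N%:R * ((c + c) * K')); first by rewrite addr_ge0 // !mulr_ge0 // addr_ge0.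
move=> A [|m s] rho Ac [/= sk sc] rhoK f C C0 fC.
  by move=> j1 j2; rewrite mxE normr0 mulr_ge0 // addr_ge0 // !mulr_ge0 // addr_ge0.
have mc : `|m| <= c by apply: sc; rewrite mem_head.
rewrite mulrDl -!mulrA; apply: mx_boundD.
  apply: rhoK => //; apply: bounded_jet_restr => //.
  by apply: bounded_jet_le fC; exact: leq_addr.
apply: mx_boundM; last first.
  apply: IH => //; first by split=> // m' m's; apply: sc; rewrite in_cons m's orbT.
  by apply: bounded_jet_dq => //; rewrite addnS in fC.
apply: mx_boundD => // j1 j2; rewrite mxE normrN.
by apply: le_trans (mx_bound_scalar _ _ _) mc.
Qed.

Lemma newton_bound N k (c : R) f : 0 <= c ->
  exists2 K : R, 0 <= K & forall (A : 'I_n -> 'M[R]_N) l,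
    (forall i, mx_bound c (A i)) -> (forall i, nodes_le k c (l i)) ->
    mx_bound K (newton kap A l f).
Proof.
move=> c0; suff h (vs : seq 'I_n) : exists2 K : R, 0 <= K & forall (A : 'I_n -> 'M[R]_N) l,
    (forall i, mx_bound c (A i)) -> (forall i, nodes_le k c (l i)) ->
    forall f C, 0 <= C -> bounded_jet (size vs * k) c C f ->
    mx_bound (K * C) (newton_rec kap A l vs (fun g => kap (g 0)) f).
  have [K K0 KP] := h (enum 'I_n).
  have [C C0 fC] := bounded_jet_ex (size (enum 'I_n) * k) c f.
  by exists (K * C); [exact: mulr_ge0|move=> A l Ac lc; exact: KP].
elim: vs => [|i vs [K K0 IH]].
  exists 1 => // A l Ac lc g C C0 [gC _] /=; rewrite mul1r.
  apply: mx_bound_le (@mx_bound_scalar N (g 0)); apply: gC => j.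
  by rewrite mxE normr0.
have [K' K'0 K'P] := newt1_bound N i k (size vs * k) c0 K0.
exists K' => // A l Ac lc g C C0 gC /=; apply: K'P => //.
  by move=> g' C' C'0; exact: IH.
by rewrite addnC.
Qed.

Lemma newton_intertwine N N' (A : 'I_n -> 'M[R]_N) (A' : 'I_n -> 'M[R]_N') P l f :
  (forall i, A i *m P = P *m A' i) ->
  newton kap A l f *m P = P *m newton kap A' l f.
Proof.
move=> AP; rewrite /newton; elim: (enum 'I_n) f => [|i vs IH] f /=.
  by rewrite mul_scalar_mx mul_mx_scalar.
elim: (l i) f => [|m s IHs] f /=; first by rewrite mul0mx mulmx0.
rewrite mulmxDl mulmxDr IH -!mulmxE -mulmxA IHs !mulmxA; congr (_ + _ *m _).
by rewrite mulmxBl mulmxBr AP mul_scalar_mx mul_mx_scalar.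
Qed.

(** The concatenated lists annihilate both tuples, so both sides become the same interpolation
    formula. [P] may be rectangular, which allows block tuples to be compared with their blocks. *)
Lemma fcalc_intertwine N N' (A : 'I_n -> 'M[R]_N) (A' : 'I_n -> 'M[R]_N') P l l' f :
  commuting A -> commuting A' -> annihilates kap A l -> annihilates kap A' l' ->
  (forall i, A i *m P = P *m A' i) ->
  fcalc kap A f *m P = P *m fcalc kap A' f.
Proof.
move=> AC A'C Al A'l' AP.
have Al2 := annihilates_catl l' Al; have A'l2 := annihilates_catr l A'l'.
rewrite (mx_fcalcE AC Al2) (mx_fcalcE A'C A'l2).
exact: newton_intertwine.
Qed.

Section Blocks.
Variables N N' : nat.
Implicit Types (A : 'I_n -> 'M[R]_N) (X : 'I_n -> 'M[R]_(N, N')).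

Definition ublock A X (A' : 'I_n -> 'M[R]_N') (i : 'I_n) : 'M[R]_(N + N') :=
  block_mx (A i) (X i) 0 (A' i).

(** The off-diagonal part of the commutation of two members of [ublock]. Difference quotients of
    commuting tuples and derivatives of commuting families satisfy it. *)
Definition intertwiner A X (A' : 'I_n -> 'M[R]_N') := forall i j,
  A i *m X j + X i *m A' j = A j *m X i + X j *m A' i.

Lemma ublock_commuting A X (A' : 'I_n -> 'M[R]_N') :
  commuting A -> commuting A' -> intertwiner A X A' -> commuting (ublock A X A').
Proof.
move=> AC A'C XC i j; rewrite /GRing.comm /ublock -!mulmxE !mulmx_block.
rewrite !mulmx0 !mul0mx !addr0 !add0r XC; congr block_mx; [exact: AC|exact: A'C].
Qed.

Lemma node_prod_ublock A X (A' : 'I_n -> 'M[R]_N') i s : exists Z,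
  node_prod kap (ublock A X A' i) s =
  block_mx (node_prod kap (A i) s) Z 0 (node_prod kap (A' i) s).
Proof.
elim: s => [|m s [Z ZE]].
  by exists 0; rewrite /node_prod !big_nil -scalar_mx_block.
exists ((A i - m%:M) *m Z + X i *m node_prod kap (A' i) s).
rewrite !node_prod_cons ZE /ublock scalar_mx_block opp_block_mx add_block_mx.
by rewrite -!mulmxE mulmx_block !oppr0 !addr0 !mul0mx !mulmx0 !addr0 !add0r.
Qed.

(** The nodes [l] clear the upper left block, the nodes [l'] the lower right one. Both products are
    block upper triangular, so multiplying them in this order gives 0. *)
Lemma ublock_annihilates A X (A' : 'I_n -> 'M[R]_N') l l' :
  annihilates kap A l -> annihilates kap A' l' ->
  annihilates kap (ublock A X A') (fun i => l i ++ l' i).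
Proof.
move=> Al A'l' i; rewrite node_prod_cat.
have [Z ->] := node_prod_ublock A X A' i (l i).
have [Z' ->] := node_prod_ublock A X A' i (l' i).
rewrite Al A'l' -mulmxE mulmx_block !mul0mx !mulmx0 !addr0.
by rewrite /block_mx !row_mx0 col_mx0.
Qed.

End Blocks.

Lemma quotient_intertwiner N (A B : 'I_n -> 'M[R]_N) (a : R) :
  commuting A -> commuting B -> intertwiner A (fun i => a *: (A i - B i)) B.
Proof.
move=> AC BC i j; rewrite -!scalemxAr -!scalemxAl -!scalerDr; congr (_ *: _).
rewrite !mulmxBr !mulmxBl !addrA !subrK.
by congr (_ - _); [exact: AC|exact: BC].
Qed.

(** The class on which the estimates are uniform. Node lists are only asked to exist, so they may
    jump from one tuple to the next. *)
Definition real_tuple N k (c : R) (A : 'I_n -> 'M[R]_N) :=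
  [/\ commuting A, forall i, mx_bound c (A i)
    & exists2 l, annihilates kap A l & forall i, nodes_le k c (l i)].

Lemma real_tuple_le N k k' (c c' : R) (A : 'I_n -> 'M[R]_N) :
  (k <= k')%N -> c <= c' -> real_tuple k c A -> real_tuple k' c' A.
Proof.
move=> kk' cc' [AC Ac [l Al lc]]; split=> //; first by move=> i; exact: mx_bound_le (Ac i).
exists l => // i; have [sk sc] := lc i; split; first exact: leq_trans kk'.
by move=> m ms; apply: le_trans cc'; exact: sc.
Qed.

Lemma mx_bound_ublock N N' (c : R) (A : 'I_n -> 'M[R]_N) (A' : 'I_n -> 'M[R]_N') X i :
  0 <= c -> mx_bound c (A i) -> mx_bound c (A' i) -> mx_bound c (X i) ->
  mx_bound c (ublock A X A' i).
Proof.
move=> c0 Ac A'c Xc p q; rewrite /ublock.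
case: (split_ordP p) => p' ->; case: (split_ordP q) => q' ->.
- by rewrite block_mxEul.
- by rewrite block_mxEur.
- by rewrite block_mxEdl mxE normr0.
- by rewrite block_mxEdr.
Qed.

Lemma real_tuple_ublock N N' k k' (c : R) (A : 'I_n -> 'M[R]_N) (A' : 'I_n -> 'M[R]_N') X :
  0 <= c -> real_tuple k c A -> real_tuple k' c A' -> intertwiner A X A' ->
  (forall i, mx_bound c (X i)) -> real_tuple (k + k') c (ublock A X A').
Proof.
move=> c0 [AC Ac [l Al lc]] [A'C A'c [l' A'l' l'c]] XC Xc; split.
- exact: ublock_commuting.
- by move=> i; exact: mx_bound_ublock.
exists (fun i => l i ++ l' i); first exact: ublock_annihilates.
move=> i; have [[sk sc] [sk' sc']] := (lc i, l'c i); split.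
  by rewrite size_cat leq_add.
by move=> m; rewrite mem_cat => /orP[/sc|/sc'].
Qed.

Lemma fcalc_bound N k (c : R) f : 0 <= c -> exists2 K : R, 0 <= K &
  forall A : 'I_n -> 'M[R]_N, real_tuple k c A -> mx_bound K (fcalc kap A f).
Proof.
move=> c0; have [K K0 KP] := newton_bound N k f c0; exists K => // A [AC Ac [l Al lc]].
by rewrite (mx_fcalcE AC Al); exact: KP.
Qed.

(* [ublock A ((A - A') / d) A'] is conjugate to the block diagonal matrix of
   [A] and [A'], so [fcalc] turns divided differences into divided differences. *)
Lemma fcalc_ublock_quotient N k c (A A' : 'I_n -> 'M[R]_N) (d : R) f : d != 0 ->
  real_tuple k c A -> real_tuple k c A' ->
  ursubmx (fcalc kap (ublock A (fun i => d^-1 *: (A i - A' i)) A') f) =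
  d^-1 *: (fcalc kap A f - fcalc kap A' f).
Proof.
move=> d0 [AC _ [l Al _]] [A'C _ [l' A'l' _]].
set X := fun i => _; set T := fcalc _ _ _.
have TC : commuting (ublock A X A').
  by apply: ublock_commuting => //; exact: quotient_intertwiner.
have Tl := ublock_annihilates X Al A'l'.
(* The columns [(1, 0)] and [(-1/d, 1)] span invariant subspaces on which the block tuple acts as
   [A] and as [A']. *)
have h1 : T *m col_mx 1%:M 0 = col_mx 1%:M 0 *m fcalc kap A f.
  apply: (fcalc_intertwine _ TC AC Tl Al) => i; rewrite /ublock mul_block_col mul_col_mx.
  by rewrite !mulmx1 !mulmx0 !mul1mx !mul0mx !addr0.
have h2 : T *m col_mx (- d^-1)%:M 1%:M = col_mx (- d^-1)%:M 1%:M *m fcalc kap A' f.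
  apply: (fcalc_intertwine _ TC A'C Tl A'l') => i; rewrite /ublock mul_block_col mul_col_mx.
  rewrite !mulmx1 !mul1mx !mul0mx !add0r mul_mx_scalar mul_scalar_mx; congr col_mx.
  by rewrite /X scalerBr !scaleNr addrA addNr add0r.
rewrite -(submxK T) !mul_block_col !mul_col_mx in h1 h2.
have [+ _] := eq_col_mx h1; have [+ _] := eq_col_mx h2.
rewrite !mulmx1 mulmx0 addr0 mul1mx mul_mx_scalar mul_scalar_mx => h2' ulE.
by rewrite scalerBr -ulE -scaleNr -h2' scaleNr addrA subrr add0r.
Qed.

Lemma fcalc_lipschitz N k (c : R) f : 0 <= c -> exists2 K : R, 0 <= K &
  forall A A' : 'I_n -> 'M[R]_N, real_tuple k c A -> real_tuple k c A' ->
  forall d : R, 0 < d -> (forall i, mx_bound d (A i - A' i)) ->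
  mx_bound (K * d) (fcalc kap A f - fcalc kap A' f).
Proof.
(* Scaled by [1/d], the corner blocks have entries at most 1; hence the maximum, and hence a [K]
   that does not depend on [d]. *)
move=> c0; have c'0 : 0 <= Num.max c 1 by rewrite le_max c0.
have [K K0 KP] := fcalc_bound (N + N) (k + k) f c'0; exists K => // A A' rA rA' d d0 AA'.
have cc : c <= Num.max c 1 by rewrite le_max lexx.
have rT : real_tuple (k + k) (Num.max c 1) (ublock A (fun i => d^-1 *: (A i - A' i)) A').
  apply: real_tuple_ublock => //; try exact: (real_tuple_le (leqnn k) cc).
    by case: rA rA' => [AC _ _] [A'C _ _]; exact: quotient_intertwiner.
  move=> i p q; rewrite mxE normrM gtr0_norm ?invr_gt0 // le_max; apply/orP; right.
  by rewrite ler_pdivrMl // mulr1; exact: AA'.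
move=> p q.
have : `|ursubmx (fcalc kap (ublock A (fun i => d^-1 *: (A i - A' i)) A') f) p q| <= K.
  by rewrite 2!mxE; exact: KP.
rewrite (fcalc_ublock_quotient f (lt0r_neq0 d0) rA rA') mxE normrM gtr0_norm ?invr_gt0 //.
by rewrite ler_pdivrMl // mulrC.
Qed.

(** The derivative of [f] at the tuple [A] in the direction [X], obtained without a limit. *)
Definition fderiv N (A X : 'I_n -> 'M[R]_N) f : 'M[R]_N :=
  ursubmx (fcalc kap (ublock A X A) f).

(** One larger matrix governs all combinations [p X + q Y]: the tuple with corner row [(X, Y)] over
    two copies of [A] is intertwined with the one with corner [p X + q Y], so the latter's value is
    a fixed corner times the column [(p, q)]. *)
Lemma fderiv_linear N k c (A X Y : 'I_n -> 'M[R]_N) a f : real_tuple k c A ->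
  intertwiner A X A -> intertwiner A Y A ->
  fderiv A (fun i => a *: X i + Y i) f = a *: fderiv A X f + fderiv A Y f.
Proof.
move=> [AC _ [l Al _]] XC YC.
have lin_intertwiner p q : intertwiner A (fun i => p *: X i + q *: Y i) A.
  move=> i j; rewrite !mulmxDr !mulmxDl -!scalemxAr -!scalemxAl.
  by rewrite addrACA -!scalerDr XC YC !scalerDr addrACA.
pose D := ublock A (fun=> 0) A; pose XY i := row_mx (X i) (Y i).
have DC : commuting D by apply: ublock_commuting => // i j; rewrite !mulmx0 !mul0mx.
have Dl : annihilates kap D _ := ublock_annihilates (fun=> 0) Al Al.
have XYC : intertwiner A XY D.
  move=> i j; rewrite /XY /D /ublock !mul_mx_row !mul_row_block.
  by rewrite !mulmx0 !addr0 !add0r !add_row_mx XC YC.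
have WC := ublock_commuting AC DC XYC; have Wl := ublock_annihilates XY Al Dl.
have E p q : fderiv A (fun i => p *: X i + q *: Y i) f =
    ursubmx (fcalc kap (ublock A XY D) f) *m col_mx p%:M q%:M.
  pose Z i := p *: X i + q *: Y i.
  have ZC := ublock_commuting AC AC (lin_intertwiner p q).
  have Zl := ublock_annihilates Z Al Al.
  pose P : 'M[R]_(N + (N + N), N + N) := block_mx 1%:M 0 0 (col_mx p%:M q%:M).
  have := @fcalc_intertwine _ _ (ublock A XY D) (ublock A Z A) P _ _ f WC ZC Wl Zl.
  set W := fcalc _ _ _; set T := fcalc _ _ _ => WP.
  have {}WP : W *m P = P *m T.
    apply: WP => i; rewrite /P /ublock !mulmx_block /D /XY /ublock.
    rewrite mul_row_col mul_block_col !mul_col_mx !mulmx0 !mul0mx !mulmx1 !mul1mx !addr0 !add0r.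
    by rewrite !mul_mx_scalar !mul_scalar_mx.
  move: WP; rewrite /fderiv -/T /P -{1}(submxK W) -{1}(submxK T) !mulmx_block.
  by move=> /eq_block_mx[_ + _ _]; rewrite mulmx0 add0r mul1mx mul0mx addr0 => ->.
have := E a 1; rewrite (_ : (fun i => _) = fun i => a *: X i + Y i); last first.
  by apply/funext => i; rewrite scale1r.
have := E 1 0; rewrite (_ : (fun i => _) = X); last first.
  by apply/funext => i; rewrite scale1r scale0r addr0.
have := E 0 1; rewrite (_ : (fun i => _) = Y); last first.
  by apply/funext => i; rewrite scale1r scale0r add0r.
move=> -> -> ->; rewrite scalemxAr -mulmxDr; congr (_ *m _).
by rewrite scale_col_mx add_col_mx !scale_scalar_mx -!raddfD /= mulr1 mulr0 addr0 add0r.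
Qed.

End RealMatrices.

(** * Smooth dependence on parameters *)

Section SmoothCalculus.
Context {R : realType} {n : nat} {V : normedModType R}.
Local Notation S := (smoothFun (@Rn R n)).
Local Notation kap := (@scalar_mx R _).
Implicit Types (f : S) (U : set V) (x u v h : V).

Lemma ublockB N N' (A B : 'I_n -> 'M[R]_N) (A' B' : 'I_n -> 'M[R]_N') X Y i :
  ublock A X A' i - ublock B Y B' i =
  ublock (fun i => A i - B i) (fun i => X i - Y i) (fun i => A' i - B' i) i.
Proof. by rewrite /ublock opp_block_mx add_block_mx oppr0 addr0. Qed.

Lemma near_mx_bound m N (G : 'I_n -> V -> 'M[R]_(m, N)) x :
  (forall i p q, {for x, continuous (fun u => G i u p q)}) ->
  exists2 c : R, 0 <= c & \forall u \near x, forall i, mx_bound c (G i u).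
Proof.
move=> cG; pose c (t : 'I_n * 'I_m * 'I_N) : R := `|G t.1.1 x t.1.2 t.2| + 1.
have c0 t : 0 <= c t by rewrite addr_ge0.
exists (\sum_t c t); first exact: sumr_ge0.
have near1 : \forall u \near x, forall i p q, `|G i x p q - G i u p q| <= 1.
  apply: filter_forall => i; apply: filter_forall => p; apply: filter_forall => q.
  by have /cvgrPdist_le := cG i p q; exact.
apply: filterS near1 => u Gu i p q; apply: (@le_trans _ _ (c (i, p, q))).
  rewrite /c /= -[X in `|X| <= _](subrKC (G i x p q)).
  by apply: le_trans (ler_normD _ _) _; rewrite lerD2l distrC.
by rewrite (bigD1 (i, p, q)) //= lerDl; exact: sumr_ge0.
Qed.

Definition mx_derive N (A : 'I_n -> V -> 'M[R]_N) v i u : 'M[R]_N :=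
  \matrix_(p, q) 'D_v (fun u => A i u p q) u.

(** The product rule applied to both sides of [A_i A_j = A_j A_i], an identity valid near [x]. *)
Lemma mx_derive_intertwiner N (A : 'I_n -> V -> 'M[R]_N) x v :
  (forall i p q, differentiable (fun u => A i u p q) x) ->
  (\forall u \near x, commuting (A ^~ u)) ->
  intertwiner (A ^~ x) (mx_derive A v ^~ x) (A ^~ x).
Proof.
move=> dA AC; have dM i j p q : 'D_v (fun u => (A i u *m A j u) p q) x =
    (A i x *m mx_derive A v j x + mx_derive A v i x *m A j x) p q.
  rewrite (_ : (fun u => _) = \sum_r ((fun u => A i u p r) * (fun u => A j u r q))); last first.
    by apply/funext => u; rewrite mxE fct_sumE.
  have der i' p' q' : derivable (fun u => A i' u p' q') x v by exact: diff_derivable.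
  rewrite derive_sum; last by move=> r; exact: derivableM.
  rewrite !mxE -big_split; apply: eq_bigr => r _.
  by rewrite deriveM // !mxE /= [X in _ + X]mulrC.
move=> i j; apply/matrixP => p q; rewrite -!dM; apply: near_eq_derive.
by apply: filterS AC => u ACu; have := ACu i j; rewrite /GRing.comm -mulmxE => ->.
Qed.

Definition locally_real_tuple N (A : 'I_n -> V -> 'M[R]_N) x :=
  exists k (c : R), 0 <= c /\ \forall u \near x, real_tuple k c (A ^~ u).

Lemma fcalc_continuous N (A : 'I_n -> V -> 'M[R]_N) x f p q :
  (forall i p q, {for x, continuous (fun u => A i u p q)}) ->
  locally_real_tuple A x ->
  {for x, continuous (fun u => fcalc kap (A ^~ u) f p q)}.
Proof.
move=> cA [k [c [c0 rA]]]; have [K K0 KP] := fcalc_lipschitz N k f c0.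
apply/cvgrPdist_le => e e0; have K1 : 0 < K + 1 by rewrite ltr_wpDl.
pose d := e / (K + 1); have d0 : 0 < d by rewrite divr_gt0.
have nearA : \forall u \near x, forall i p q, `|A i x p q - A i u p q| <= d.
  apply: filter_forall => i; apply: filter_forall => p'; apply: filter_forall => q'.
  by have /cvgrPdist_le := cA i p' q'; exact.
have rx := nbhs_singleton rA.
apply: filterS2 rA nearA => u ru Au.
have := KP _ _ rx ru d d0 _ p q; rewrite 2!mxE => h; apply: le_trans (h _) _.
  by move=> i p' q'; rewrite !mxE; exact: Au.
by rewrite mulrCA ler_piMr ?(ltW e0) // ler_pdivrMr // mul1r lerDl.
Qed.

Section Derivative.
Variables (N : nat) (A : 'I_n -> V -> 'M[R]_N) (x : V) (f : S) (p q : 'I_N).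
Hypothesis dA : forall i p q, differentiable (fun u => A i u p q) x.
Hypothesis rA : locally_real_tuple A x.

Let L v : R := fderiv (A ^~ x) (mx_derive A v ^~ x) f p q.

Let rAx : exists k (c : R), 0 <= c /\ real_tuple k c (A ^~ x).
Proof. by have [k [c [c0 /nbhs_singleton rx]]] := rA; exists k, c. Qed.

Let DC v : intertwiner (A ^~ x) (mx_derive A v ^~ x) (A ^~ x).
Proof.
apply: mx_derive_intertwiner => //; have [k [c [_ nA]]] := rA.
by apply: filterS nA => u [].
Qed.

Let mx_derive_linear a v w i :
  mx_derive A (a *: v + w) i x = a *: mx_derive A v i x + mx_derive A w i x.
Proof. by apply/matrixP => p' q'; rewrite !mxE !deriveE // linearP. Qed.

Let L_linear : linear L.
Proof.
move=> a v w; have [k [c [_ rx]]] := rAx.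
have -> : L (a *: v + w) = fderiv (A ^~ x)
    (fun i => a *: mx_derive A v i x + mx_derive A w i x) f p q.
  by congr (fderiv _ _ _ _ _); apply/funext => i; exact: mx_derive_linear.
by rewrite (fderiv_linear _ _ rx (DC v) (DC w)) 2!mxE.
Qed.

Let mx_derive_bound : exists2 C : R, 0 <= C & forall v i, mx_bound (C * `|v|) (mx_derive A v i x).
Proof.
have /choice[C CP] : forall t : 'I_n * 'I_N * 'I_N, exists C : R, 0 <= C /\
    forall v, `|'D_v (fun u => A t.1.1 u t.1.2 t.2) x| <= C * `|v|.
  move=> [[i p'] q']; have [C C0 CP] := linear_lipschitz (diff_continuous (dA i p' q')).
  by exists C; split; [exact: ltW|move=> v /=; rewrite deriveE].
exists (\sum_t C t); first by apply: sumr_ge0 => t _; case: (CP t).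
move=> v i p' q'; rewrite mxE; apply: le_trans ((CP (i, p', q')).2 v) _.
rewrite ler_wpM2r // (bigD1 (i, p', q')) //= lerDl.
by apply: sumr_ge0 => t _; case: (CP t).
Qed.

Let LM := GRing.isLinear.Build _ _ _ _ _ L_linear.
Let Llin : {linear V -> R} := HB.pack L LM.

Let L0 : L 0 = 0. Proof. exact: (linear0 Llin). Qed.
Let LZ a v : L (a *: v) = a * L v. Proof. by rewrite -[a *: v]addr0 L_linear L0 addr0. Qed.

Let L_continuous : continuous Llin.
Proof.
have [C C0 CP] := mx_derive_bound; have [k [c [c0 rx]]] := rAx.
have cC0 : 0 <= Num.max c C by rewrite le_max c0.
have [K K0 KP] := fcalc_bound (N + N) (k + k) f cC0.
apply/linear_bounded_continuous; exists K; split; first exact: num_real.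
move=> M KM; near=> v; apply: le_trans (ltW KM).
have v1 : `|v| <= 1 by near: v; exact: nbhs0_le.
rewrite /= /L /fderiv 2!mxE; apply: KP; apply: real_tuple_ublock => //.
- by apply: real_tuple_le rx => //; rewrite le_max lexx.
- by apply: real_tuple_le rx => //; rewrite le_max lexx.
move=> i; apply: mx_bound_le (CP v i); rewrite le_max; apply/orP; right.
by rewrite ler_piMr.
Unshelve. all: by end_near. Qed.

(** Divided by [|h|], the remainder is the corner of a difference of two values of the calculus, at
    the block tuples built from the difference quotient and from the derivative. These tuples are
    entrywise within [d], so [fcalc_lipschitz] applies. *)
Let remainder (e : R) : 0 < e -> \forall h \near (0 : V),
  `|fcalc kap (A ^~ (h + x)) f p q - fcalc kap (A ^~ x) f p q - L h| <= e * `|h|.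
Proof.
move=> e0; have [C C0 CP] := mx_derive_bound; have [k [c [c0 nA]]] := rA.
have rx := nbhs_singleton nA.
(* [C] bounds the derivative divided by [|h|]; the difference quotient stays within [d <= 1] of
   it. *)
pose c' := Num.max c (C + 1); have c'0 : 0 <= c' by rewrite le_max c0.
have [K K0 KP] := fcalc_lipschitz (N + N) (k + k) f c'0.
have K1 : 0 < K + 1 by rewrite ltr_wpDl.
pose d := Num.min 1 (e / (K + 1)); have d0 : 0 < d by rewrite lt_min ltr01 divr_gt0.
have near1 : \forall h \near (0 : V), real_tuple k c (A ^~ (h + x)).
  by move: nA; rewrite (near_shift 0 x) /=; apply: filterS => h /=; rewrite subr0.
have near2 : \forall h \near (0 : V), forall i p q,
    `|A i (h + x) p q - A i x p q - mx_derive A h i x p q| <= d * `|h|.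
  apply: filter_forall => i; apply: filter_forall => p'; apply: filter_forall => q'.
  have /eqaddoP /(_ d d0) := diff_locally (dA i p' q').
  by apply: filterS => h; rewrite !fctE /= opprD addrA mxE deriveE.
have near3 : \forall h \near (0 : V), forall i p q, `|A i (h + x) p q - A i x p q| <= d.
  apply: filter_forall => i; apply: filter_forall => p'; apply: filter_forall => q'.
  have : \forall u \near x, `|A i x p' q' - A i u p' q'| <= d.
    by have /cvgrPdist_le := differentiable_continuous (dA i p' q'); exact.
  rewrite (near_shift 0 x) /=; apply: filterS => h /=.
  by rewrite subr0 distrC.
apply: filterS3 near1 near2 near3 => h h1 h2 h3.
have [->|hn0] := eqVneq h 0.
  by rewrite add0r subrr add0r L0 oppr0 !normr0 mulr0.
have t0 : 0 < `|h| by rewrite normr_gt0.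
have tn0 := lt0r_neq0 t0.
have cc' : c <= c' by rewrite le_max lexx.
have LE : L h = `|h| * fderiv (A ^~ x) (fun i => `|h|^-1 *: mx_derive A h i x) f p q.
  rewrite -[h in LHS](scalerKV tn0) LZ; congr (_ * _).
  rewrite /L; congr (fderiv _ _ _ _ _); apply/funext => i.
  by rewrite -[_ *: h]addr0 mx_derive_linear (_ : mx_derive A 0 i x = 0) ?addr0 //;
    apply/matrixP => p' q'; rewrite !mxE derive0.
have [hC _ _] := h1; have [xC _ _] := rx.
have r1 : real_tuple (k + k) c'
    (ublock (A ^~ (h + x)) (fun i => `|h|^-1 *: (A i (h + x) - A i x)) (A ^~ x)).
  apply: real_tuple_ublock => //; try exact: (real_tuple_le (leqnn k) cc').
    exact: quotient_intertwiner.
  move=> i p' q'; rewrite !mxE normrM gtr0_norm ?invr_gt0 // le_max; apply/orP; right.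
  rewrite ler_pdivrMl // mulrDr mulr1.
  rewrite -[X in `|X|](subrK (mx_derive A h i x p' q')); apply: le_trans (ler_normD _ _) _.
  rewrite [leLHS]addrC lerD //; first by rewrite mulrC; exact: CP.
  by apply: le_trans (h2 i p' q') _; rewrite ler_piMl // ge_min lexx.
have r2 : real_tuple (k + k) c'
    (ublock (A ^~ x) (fun i => `|h|^-1 *: mx_derive A h i x) (A ^~ x)).
  apply: real_tuple_ublock => //; try exact: (real_tuple_le (leqnn k) cc').
    by move=> i j; rewrite -!scalemxAr -!scalemxAl -!scalerDr DC.
  move=> i p' q'; rewrite mxE normrM gtr0_norm ?invr_gt0 // le_max; apply/orP; right.
  rewrite ler_pdivrMl //; apply: le_trans (CP h i p' q') _.
  by rewrite mulrC ler_wpM2l // lerDl.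
have := KP _ _ r1 r2 d d0 _ (lshift N p) (rshift N q).
set T1 := fcalc kap (ublock (A ^~ (h + x)) _ _) f.
set T2 := fcalc kap (ublock (A ^~ x) _ _) f.
have E1 : T1 (lshift N p) (rshift N q) = `|h|^-1 * (fcalc kap (A ^~ (h + x)) f p q -
    fcalc kap (A ^~ x) f p q).
  have := fcalc_ublock_quotient f tn0 h1 rx.
  by move=> /matrixP /(_ p q); rewrite 2!mxE => ->; rewrite 3!mxE.
have E2 : L h = `|h| * T2 (lshift N p) (rshift N q) by rewrite LE /fderiv 2!mxE.
rewrite 2!mxE E1 => h4; have {}h4 := h4 _.
rewrite E2 -[X in `|X - _|](mulVKf tn0) -mulrBr normrM normr_id mulrC ler_wpM2r //.
apply: le_trans (h4 _) _ => [i|]; last first.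
  apply: (@le_trans _ _ (K * (e / (K + 1)))); first by rewrite ler_wpM2l // ge_min lexx orbT.
  by rewrite mulrCA ler_piMr ?(ltW e0) // ler_pdivrMr // mul1r lerDl.
rewrite ublockB; apply: mx_bound_ublock; first exact: ltW.
- by move=> p' q'; rewrite !mxE; exact: h3.
- by move=> p' q'; rewrite subrr mxE normr0 ltW.
move=> p' q'; rewrite -scalerBr mxE normrM gtr0_norm ?invr_gt0 // ler_pdivrMl // mulrC.
by have := h2 i p' q'; rewrite !mxE.
Qed.

Lemma fcalc_diff : differentiable (fun u => fcalc kap (A ^~ u) f p q) x /\
  forall v, 'D_v (fun u => fcalc kap (A ^~ u) f p q) x =
    fcalc kap (ublock (A ^~ x) (mx_derive A v ^~ x) (A ^~ x)) f (lshift N p) (rshift N q).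
Proof.
have [dF dE] := @differentiable_of_remainder _ _ (fun u => fcalc kap (A ^~ u) f p q) x Llin
  L_continuous remainder.
by split=> // v; rewrite deriveE // dE /= /L /fderiv 2!mxE.
Qed.

End Derivative.

Lemma fcalc_smooth N (A : 'I_n -> V -> 'M[R]_N) U f p q : open U ->
  (forall i p q, smooth U (fun u => A i u p q)) ->
  (forall x, U x -> locally_real_tuple A x) ->
  smooth U (fun u => fcalc kap (A ^~ u) f p q).
Proof.
move=> oU sA rA k; elim: k N A p q sA rA => [|k IH] N A p q sA rA.
  by move=> x Ux; apply: fcalc_continuous; [move=> i p' q'; exact: (sA i p' q' 0)|exact: rA].
have dA x : U x -> forall i p q, differentiable (fun u => A i u p q) x.
  by move=> Ux i p' q'; exact: (sA i p' q' 1).1.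
split=> [x Ux|v]; first exact: (fcalc_diff f p q (dA x Ux) (rA x Ux)).1.
pose B i u := ublock (A ^~ u) (mx_derive A v ^~ u) (A ^~ u) i.
apply: (@Ck_ext _ _ _ _ (fun u => fcalc kap (B ^~ u) f (lshift N p) (rshift N q))) => //.
  by move=> x Ux; rewrite (fcalc_diff f p q (dA x Ux) (rA x Ux)).2.
have sD i p' q' : smooth U (fun u => mx_derive A v i u p' q').
  rewrite /mx_derive; under eq_fun do rewrite mxE.
  by move=> k'; exact: (sA i p' q' k'.+1).2.
apply: IH => [i p' q'|x Ux].
  rewrite /B /ublock; case: (split_ordP p') => p'' ->; case: (split_ordP q') => q'' ->.
  - by under eq_fun do rewrite block_mxEul; exact: sA.
  - by under eq_fun do rewrite block_mxEur; exact: sD.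
  - by under eq_fun do rewrite block_mxEdl mxE; move=> k'; exact: Ck_cst.
  - by under eq_fun do rewrite block_mxEdr; exact: sA.
have [k' [c [c0 nA]]] := rA x Ux.
have [d d0 nD] := near_mx_bound (G := mx_derive A v) (fun i p q => sD i p q 0 x Ux).
exists (k' + k')%N, (Num.max c d); split; first by rewrite le_max c0.
have nU : nbhs x U by exact: open_nbhs_nbhs.
(* Differentiating the commutation relations at [u] requires them on a whole neighbourhood of
   [u]. *)
have nnA := near_join nA.
near=> u; have ru : real_tuple k' c (A ^~ u) by near: u.
apply: real_tuple_ublock; first by rewrite le_max c0.
- by apply: real_tuple_le ru => //; rewrite le_max lexx.
- by apply: real_tuple_le ru => //; rewrite le_max lexx.
- apply: mx_derive_intertwiner; first by apply: dA; near: u.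
  have : \forall w \near u, real_tuple k' c (A ^~ w) by near: u.
  by apply: filterS => w [].
move=> i; apply: (@mx_bound_le _ _ _ d); first by rewrite le_max lexx orbT.
by move: i; near: u.
Unshelve. all: by end_near. Qed.

End SmoothCalculus.

(** * Inverse square roots, reciprocals and a diffeomorphism onto the cube *)

Section SmoothTools.
Context {R : realType}.
Implicit Types (V : normedModType R).

Lemma Ck_local V k (U : set V) f :
  (forall x, U x -> exists2 W, open W /\ W x & Ck k W f) -> Ck k U f.
Proof.
elim: k f => [|k IH] f loc.
  by move=> x /loc[W [_ Wx]]; exact.
split=> [x /loc[W [_ Wx] [df _]]|v]; first exact: df.
by apply: IH => x /loc[W oWx [_ Df]]; exists W => //; exact: Df.
Qed.

Lemma smooth_local V (U : set V) f :
  (forall x, U x -> exists2 W, open W /\ W x & smooth W f) -> smooth U f.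
Proof. by move=> loc k; apply: Ck_local => x /loc[W oWx sf]; exists W. Qed.

(** Its derivative is [-1/2] times its own cube, so induction on the order of differentiability
    closes. Reciprocals of positive functions are its square. *)
Definition rsqrt (t : R) : R := (Num.sqrt t)^-1.

Lemma rsqrt_comp_diff V (f : V -> R) x : differentiable f x -> 0 < f x ->
  differentiable (rsqrt \o f) x /\
  forall v, 'D_v (rsqrt \o f) x = - 2^-1 * (rsqrt (f x) * rsqrt (f x) * rsqrt (f x)) * 'D_v f x.
Proof.
move=> df f0; have q0 : Num.sqrt (f x) != 0 by rewrite sqrtr_eq0 -ltNge.
have [dS SE] := is_derive1_sqrt f0.
have dr : derivable rsqrt (f x) 1 by exact: derivableV.
have rE : 'D_1 rsqrt (f x) = - 2^-1 * (rsqrt (f x) * rsqrt (f x) * rsqrt (f x)).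
  by rewrite (deriveV q0 dS) SE /rsqrt /GRing.scale /=; field.
have ddr : differentiable rsqrt (f x) by apply/derivable1_diffP.
have dE w : 'd rsqrt (f x) w = w * 'D_1 rsqrt (f x).
  by rewrite deriveE // -[w in LHS]mulr1 -[w * 1]/(w *: 1) linearZ.
have dc : differentiable (rsqrt \o f) x by exact: differentiable_comp.
split=> // v; rewrite deriveE // diff_comp //= dE rE mulrC.
by rewrite [in RHS]deriveE.
Qed.

Lemma Ck_rsqrt V k (U : set V) f : open U -> (forall x, U x -> 0 < f x) ->
  Ck k U f -> Ck k U (rsqrt \o f).
Proof.
move=> oU f0; elim: k => [|k IH] Cf.
  move=> x Ux; apply: continuous_comp; first exact: Cf.
  apply: cvgV; first by rewrite sqrtr_eq0 -ltNge; exact: f0.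
  exact: sqrt_continuous.
have [df Df] := Cf; split=> [x Ux|v].
  exact: (rsqrt_comp_diff (df x Ux) (f0 x Ux)).1.
have Cr := IH (Ck_le Cf).
apply: (@Ck_ext _ _ _ _ (fun x => - 2^-1 *
  ((rsqrt \o f) x * (rsqrt \o f) x * (rsqrt \o f) x) * 'D_v f x)) => //.
  by move=> x Ux; rewrite (rsqrt_comp_diff (df x Ux) (f0 x Ux)).2.
apply: CkM (Df v) => //; apply: CkM => //; first exact: Ck_cst.
by apply: CkM => //; apply: CkM.
Qed.

Lemma smooth_rsqrt V (U : set V) f : open U -> (forall x, U x -> 0 < f x) ->
  smooth U f -> smooth U (rsqrt \o f).
Proof. by move=> oU f0 sf k; exact: Ck_rsqrt. Qed.

Lemma smooth_cst V (U : set V) (a : R) : smooth U (fun=> a).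
Proof. by move=> k; exact: Ck_cst. Qed.

Lemma smoothD V (U : set V) f g : open U -> smooth U f -> smooth U g ->
  smooth U (fun x => f x + g x).
Proof. by move=> oU sf sg k; exact: CkD. Qed.

Lemma smoothM V (U : set V) f g : open U -> smooth U f -> smooth U g ->
  smooth U (fun x => f x * g x).
Proof. by move=> oU sf sg k; exact: CkM. Qed.

Lemma smoothN V (U : set V) f : open U -> smooth U f -> smooth U (fun x => - f x).
Proof.
move=> oU sf; apply: (smooth_ext (f := fun x => -1 * f x)) => //.
  by move=> x _; rewrite mulN1r.
by apply: smoothM => //; exact: smooth_cst.
Qed.

Lemma rsqrtK (t : R) : 0 < t -> rsqrt t * rsqrt t = t^-1.
Proof. by move=> t0; rewrite /rsqrt -invfM -expr2 sqr_sqrtr ?ltW. Qed.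

(* Precomposing with [squash] extends a function on a cube to all of R^d, which
   spares cutoff functions. *)
Definition squash (t : R) : R := t * rsqrt (1 + t * t).
Definition unsquash (t : R) : R := t * rsqrt (1 - t * t).

Lemma squash_lt1 t : `|squash t| < 1.
Proof.
have t0 : 0 < 1 + t * t by rewrite ltr_wpDr // -expr2 sqr_ge0.
rewrite -(@ltr_pXn2r _ 2) ?nnegrE // expr1n real_normK ?num_real //.
rewrite /squash exprMn [rsqrt _ ^+ 2]expr2 rsqrtK // ltr_pdivrMr // mul1r expr2.
by rewrite ltrDr.
Qed.

Lemma unsquashK t : `|t| < 1 -> squash (unsquash t) = t.
Proof.
move=> t1; have y0 : 0 < 1 - t * t.
  by rewrite subr_gt0 -expr2 -real_normK ?num_real // expr_lt1.
have -> : squash (unsquash t) = unsquash t * rsqrt (1 - t * t)^-1.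
  rewrite /squash; congr (_ * rsqrt _).
  rewrite /unsquash mulrACA rsqrtK //.
  by field; rewrite lt0r_neq0.
rewrite /unsquash -mulrA /rsqrt sqrtrV ?ltW // invrK mulVf ?mulr1 //.
by rewrite sqrtr_eq0 -ltNge.
Qed.

Lemma smooth_squash V (U : set V) f : open U -> smooth U f -> smooth U (squash \o f).
Proof.
move=> oU sf; apply: smoothM => //; apply: (smooth_rsqrt (f := fun x => 1 + f x * f x)) => //.
  by move=> x _; rewrite ltr_wpDr // -expr2 sqr_ge0.
by apply: smoothD; [|exact: smooth_cst|exact: smoothM].
Qed.

Lemma smooth_unsquash V (U : set V) f : open U -> (forall x, U x -> `|f x| < 1) ->
  smooth U f -> smooth U (unsquash \o f).
Proof.
move=> oU f1 sf; apply: smoothM => //; apply: (smooth_rsqrt (f := fun x => 1 - f x * f x)) => //.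
  by move=> x Ux; rewrite subr_gt0 -expr2 -real_normK ?num_real // expr_lt1 //; exact: f1.
by apply: smoothD; [|exact: smooth_cst|apply: smoothN => //; exact: smoothM].
Qed.

Lemma smooth_onV (M : cinfSpace R) (W : set M) (f : M -> R) :
  open W -> (forall p, W p -> 0 < f p) ->
  smooth_on W f -> smooth_on W (fun p => (f p)^-1).
Proof.
move=> oW f0 sf c ac; have oU := @chart_open _ _ c _ oW.
apply: (smooth_ext (f := fun v => rsqrt (f (cinv c v)) * rsqrt (f (cinv c v)))) => //.
  by move=> v [_ Wv] /=; rewrite rsqrtK //; exact: f0.
have := smooth_rsqrt (f := f \o cinv c) oU _ (sf c ac); move=> h.
by apply: smoothM => //; apply: h => v [_ Wv]; exact: f0.
Qed.

End SmoothTools.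

(** * Complex matrices with real spectrum *)

Section ComplexMatrices.
Context {R : realType}.
Local Notation C := R[i].
Local Notation Re := (@complex.Re R).
Local Notation Im := (@complex.Im R).

Definition cscalar_mx r (c : R) : 'M[C]_r := (c%:C%C)%:M.

(** Cayley-Hamilton: the nodes are the roots of the characteristic polynomial. Recording that they
    are eigenvalues is what allows them to be bounded. *)
Lemma real_nodes r (A : 'M[C]_r) : (forall z, eigenvalue A z -> Im z = 0) ->
  exists s, [/\ node_prod (cscalar_mx r) A s = 0, (size s <= r)%N
    & forall m, m \in s -> eigenvalue A m%:C%C].
Proof.
case: r A => [|r'] A real.
  by exists [::]; split=> //; apply/matrixP => -[].
have [rs E] := closed_field_poly_normal (char_poly A).
rewrite (monicP (char_poly_monic A)) scale1r in E.
have rsE z : z \in rs -> eigenvalue A z /\ (Re z)%:C%C = z.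
  move=> zrs; have eA : eigenvalue A z by rewrite eigenvalue_root_char E root_prod_XsubC.
  by split=> //; have := real z eA; case: z {zrs eA} => a b /= ->.
exists (map Re rs); split.
- rewrite /node_prod big_map (eq_big_seq (fun z => A - z%:M)).
    rewrite -[RHS](Cayley_Hamilton A) E rmorph_prod; apply: eq_bigr => z _.
    by rewrite rmorphB /= horner_mx_X horner_mx_C.
  by move=> z /rsE[_ zE]; rewrite /cscalar_mx zE.
- by rewrite size_map -ltnS -(size_prod_XsubC rs id) -E size_char_poly.
by move=> m /mapP[z /rsE[eA zE] ->]; rewrite zE.
Qed.

Context {r : nat}.
Local Notation cscalar := (cscalar_mx r).
Implicit Types (A : 'M[C]_r) (z : C).

Lemma cscalarD : {morph cscalar : c d / c + d}.
Proof. by move=> c d; rewrite /cscalar_mx rmorphD raddfD. Qed.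

Lemma cscalarM : {morph cscalar : c d / c * d}.
Proof. by move=> c d; rewrite /cscalar_mx rmorphM -mulmxE scalar_mxM. Qed.

Lemma cscalar1 : cscalar 1 = 1.
Proof. by rewrite /cscalar_mx rmorph1. Qed.

Lemma cscalarC c A : GRing.comm (cscalar c) A.
Proof. by rewrite /GRing.comm -mulmxE scalar_mxC. Qed.

Section ComplexMatrixCalculus.
Variables (n : nat) (A : 'I_n -> 'M[C]_r) (l : 'I_n -> seq R).
Hypothesis AC : commuting A.
Hypothesis Al : annihilates cscalar A l.

Lemma cmx_fcalcE f : fcalc cscalar A f = newton cscalar A l f.
Proof.
by apply: fcalcE; [exact: cscalarD|exact: cscalarM|exact: cscalar1|exact: cscalarC| |].
Qed.

Lemma cmx_fcalc_hom : is_alghom cscalar (fcalc cscalar A).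
Proof.
by apply: fcalc_hom Al => //;
  first [exact: cscalarD|exact: cscalarM|exact: cscalar1|exact: cscalarC].
Qed.

Lemma cmx_fcalc_coord i : fcalc cscalar A (Rn_coord i) = A i.
Proof.
by apply: fcalc_coord Al => //;
  first [exact: cscalarD|exact: cscalarM|exact: cscalar1|exact: cscalarC].
Qed.

End ComplexMatrixCalculus.

Lemma ReD : {morph Re : x y / x + y}. Proof. by move=> [a b] [c d]. Qed.
Lemma ImD : {morph Im : x y / x + y}. Proof. by move=> [a b] [c d]. Qed.
Lemma ReM x y : Re (x * y) = Re x * Re y - Im x * Im y.
Proof. by case: x y => [a b] [c d]. Qed.
Lemma ImM x y : Im (x * y) = Im x * Re y + Re x * Im y.
Proof. by case: x y => [a b] [c d] /=; rewrite addrC. Qed.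

Lemma map_ReM A A' : map_mx Re (A *m A') =
  map_mx Re A *m map_mx Re A' - map_mx Im A *m map_mx Im A'.
Proof.
apply/matrixP => i j; rewrite !mxE (big_morph Re ReD (erefl _)) -sumrB.
by apply: eq_bigr => k _; rewrite !mxE ReM.
Qed.

Lemma map_ImM A A' : map_mx Im (A *m A') =
  map_mx Im A *m map_mx Re A' + map_mx Re A *m map_mx Im A'.
Proof.
apply/matrixP => i j; rewrite !mxE (big_morph Im ImD (erefl _)) -big_split.
by apply: eq_bigr => k _; rewrite !mxE ImM.
Qed.

(** The action on pairs of real and imaginary parts. Real scalars go to real scalar matrices, so
    this commutes with interpolation at real nodes. *)
Definition realify A : 'M[R]_(r + r) :=
  block_mx (map_mx Re A) (- map_mx Im A) (map_mx Im A) (map_mx Re A).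

Lemma realifyD : {morph realify : A A' / A + A'}.
Proof.
move=> A A'; rewrite /realify add_block_mx -opprD.
by congr block_mx; do 1?congr (- _); apply/matrixP => i j; rewrite !mxE ?ReD ?ImD.
Qed.

Lemma realifyM : {morph realify : A A' / A * A'}.
Proof.
move=> A A'; rewrite /realify -!mulmxE mulmx_block map_ReM map_ImM.
rewrite !mulNmx !mulmxN; congr block_mx.
  by rewrite opprD addrC.
by rewrite addrC.
Qed.

Lemma realify_scalar c : realify (cscalar c) = c%:M.
Proof.
rewrite scalar_mx_block /realify.
have -> : map_mx Im (cscalar c) = 0.
  by apply/matrixP => i j; rewrite !mxE; case: (i == j).
have -> : map_mx Re (cscalar c) = c%:M.
  by apply/matrixP => i j; rewrite !mxE; case: (i == j).
by rewrite oppr0.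
Qed.

Lemma realify1 : realify 1 = 1.
Proof. by rewrite -cscalar1 realify_scalar. Qed.

Lemma realify_Re A i j : Re (A i j) = realify A (lshift r i) (lshift r j).
Proof. by rewrite block_mxEul mxE. Qed.

Lemma realify_Im A i j : Im (A i j) = realify A (rshift r i) (lshift r j).
Proof. by rewrite block_mxEdl mxE. Qed.

(** A submultiplicative, real-valued substitute for the modulus, read directly from entries of
    [realify]. *)
Definition norm1c z : R := `|Re z| + `|Im z|.

Lemma norm1cD x y : norm1c (x + y) <= norm1c x + norm1c y.
Proof. by rewrite /norm1c ReD ImD addrACA lerD // ler_normD. Qed.

Lemma norm1cM x y : norm1c (x * y) <= norm1c x * norm1c y.
Proof.
rewrite /norm1c ReM ImM mulrDl !mulrDr -!normrM.
apply: le_trans (lerD (ler_normB _ _) (ler_normD _ _)) _.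
by rewrite addrACA [X in _ <= X]addrACA [X in _ + X <= _]addrC lerD // addrC.
Qed.

Lemma norm1c_ge0 x : 0 <= norm1c x.
Proof. by rewrite addr_ge0. Qed.

Lemma norm1c_sum (I : finType) (F : I -> C) : norm1c (\sum_i F i) <= \sum_i norm1c (F i).
Proof.
apply: (big_ind2 (fun x y => norm1c x <= y)) => //.
  by rewrite /norm1c /= normr0 addr0.
by move=> x1 y1 x2 y2 h1 h2; apply: le_trans (norm1cD _ _) _; exact: lerD.
Qed.

(** Sum the equation [v A = m v] over its [r] columns: each contributes at most [c + c] times the
    total size of [v], one [c] for real and one for imaginary parts. *)
Lemma eigenvalue_bound A (m c : R) : eigenvalue A m%:C%C -> mx_bound c (realify A) ->
  `|m| <= r%:R * (c + c).
Proof.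
move=> /eigenvalueP[v vA v0] Ac.
have A2 i j : norm1c (A i j) <= c + c.
  by rewrite /norm1c realify_Re realify_Im; apply: lerD; exact: Ac.
pose T := \sum_j norm1c (v 0 j).
have T0 : 0 < T.
  rewrite lt_neqAle sumr_ge0 ?andbT; last by move=> j _; exact: norm1c_ge0.
  apply/eqP => T0; case/negP: v0; apply/eqP/rowP => j; rewrite mxE.
  have : norm1c (v 0 j) = 0.
    apply/eqP; move: (esym T0) => /psumr_eq0P -> // i _; exact: norm1c_ge0.
  move=> /eqP; rewrite paddr_eq0 // !normr_eq0.
  by case: (v 0 j) => a b /= /andP[/eqP-> /eqP->].
rewrite -(ler_pM2r T0) /T mulr_sumr.
apply: (@le_trans _ _ (\sum_j \sum_i norm1c (v 0 i) * (c + c))).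
  apply: ler_sum => j _; have /rowP /(_ j) := vA; rewrite !mxE => vAj.
  rewrite (_ : `|m| * _ = norm1c (m%:C%C * v 0 j)).
    rewrite -vAj; apply: le_trans (norm1c_sum _) _; apply: ler_sum => i _.
    by apply: le_trans (norm1cM _ _) _; rewrite ler_wpM2l // norm1c_ge0.
  by rewrite /norm1c ReM ImM /= !mul0r subr0 add0r !normrM mulrDr.
by rewrite sumr_const card_ord -mulr_suml -[leRHS]mulrA mulr_natl [(c + c) * _]mulrC.
Qed.

(* If [phi f] had an eigenvalue [a + i b] with [b != 0], the invertible
   function [(f - a)^2 + b^2] would be sent to a singular matrix. *)
Lemma alghom_real (M : cinfSpace R) (phi : smoothFun M -> 'M[C]_r) f z :
  is_alghom cscalar phi -> eigenvalue (phi f) z -> Im z = 0.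
Proof.
move=> [phiD phiM phiK] /eigenvalueP[v vz v0]; apply/eqP; apply: contraT => bn0.
pose a := Re z; pose b := Im z.
pose g : smoothFun M := f * f + sf_cst M (- (a + a)) * f + sf_cst M (a * a + b * b).
have gE p : g p = (f p - a) ^+ 2 + b ^+ 2 by rewrite /g /=; ring.
have g0 p : 0 < g p by rewrite gE ltr_wpDl ?sqr_ge0 // exprn_even_gt0.
pose ginv := SmoothFun (smooth_onV (@openT _) (fun p _ => g0 p) (sfunP g)).
have gK : g * ginv = sf_cst M 1.
  apply: smoothFun_eq => p; change (g p * (g p)^-1 = 1).
  by rewrite mulfV // lt0r_neq0.
have vg : v *m phi g = 0.
  rewrite !phiD !phiM !phiK !mulmxDr -!mulmxE !mulmxA /cscalar_mx !mul_mx_scalar.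
  rewrite vz -!scalemxAl vz !scalerA -!scalerDl.
  rewrite (_ : _ + _ = 0) ?scale0r // /a /b; case: (z) => x y /=.
  by apply/eqP; rewrite eq_complex /=; apply/andP; split; apply/eqP; ring.
case/negP: v0; rewrite -[v]mulmx1 -[1%:M]/(1 : 'M_r) -cscalar1 -phiK -gK phiM.
by rewrite -mulmxE mulmxA vg mul0mx.
Qed.

Lemma alghom_nodes (M : cinfSpace R) (phi : smoothFun M -> 'M[C]_r) f :
  is_alghom cscalar phi -> exists s, node_prod cscalar (phi f) s = 0.
Proof.
move=> phi_hom; have [z|s [s0 _ _]] := @real_nodes r (phi f); last by exists s.
exact: alghom_real phi_hom.
Qed.

(** By [alghom_real] the images of the coordinates have real spectrum, so nodes exist and both maps
    are the same interpolation. *)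
Lemma alghom_eq n (phi psi : smoothFun (@Rn R n) -> 'M[C]_r) :
  is_alghom cscalar phi -> is_alghom cscalar psi ->
  (forall i, phi (Rn_coord i) = psi (Rn_coord i)) -> phi =1 psi.
Proof.
move=> phi_hom psi_hom E f.
have /choice[l lP] : forall i, exists s, node_prod cscalar (phi (Rn_coord i)) s = 0.
  by move=> i; exact: alghom_nodes.
rewrite (newton_unique phi_hom lP) (newton_unique psi_hom (l := l)) => [|i]; last by rewrite -E.
by congr newton; apply/funext => i; rewrite E.
Qed.

End ComplexMatrices.

(** * Endomorphisms as matrices in a basis *)

Section EndMatrix.
Context {R : realType} {r : nat} {vT : vectType R[i]} (b : r.-tuple vT).
Hypothesis b_basis : basis_of fullv b.
Implicit Types u w : 'End(vT).

Definition end_mx u : 'M[R[i]]_r := \matrix_(i, j) coord b i (u b`_j).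

Lemma end_mxD u w : end_mx (u + w) = end_mx u + end_mx w.
Proof. by apply/matrixP => i j; rewrite !mxE add_lfunE linearD. Qed.

Lemma end_mxZ a u : end_mx (a *: u) = a *: end_mx u.
Proof. by apply/matrixP => i j; rewrite !mxE scale_lfunE linearZ. Qed.

Lemma end_mx1 : end_mx \1%VF = 1%:M.
Proof.
apply/matrixP => i j; rewrite !mxE id_lfunE coord_free ?(basis_free b_basis) //.
by rewrite eq_sym.
Qed.

Lemma end_mxM u w : end_mx (u \o w)%VF = end_mx u *m end_mx w.
Proof.
apply/matrixP => i j; rewrite !mxE comp_lfunE.
rewrite [in LHS](coord_basis b_basis (memvf (w _))) !linear_sum.
by apply: eq_bigr => k _; rewrite !linearZ !mxE mulrC.
Qed.

Lemma end_mx_inj : injective end_mx.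
Proof.
move=> u w /matrixP uw; apply/lfunP => v.
rewrite (coord_basis b_basis (memvf v)) !linear_sum; apply: eq_bigr => j _.
rewrite !linearZ /=; congr (_ *: _).
rewrite (coord_basis b_basis (memvf (u b`_j))) (coord_basis b_basis (memvf (w b`_j))).
by apply: eq_bigr => i _; have := uw i j; rewrite !mxE => ->.
Qed.

(** [eigenvalue] concerns row vectors, so [v] is not the coordinate column of an eigenvector of [u].
    Instead, if [u - z] were injective it would be invertible, and its matrix could not kill [v]. *)
Lemma end_mx_eigenvalue u z : eigenvalue (end_mx u) z -> passmx.leigenvalue u z.
Proof.
move=> /eigenvalueP[v vz v0]; rewrite /passmx.leigenvalue /passmx.leigenspace.
apply/negP => ker0; case/negP: v0.
pose g := u - z *: \1%VF.
have vg : v *m end_mx g = 0.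
  by rewrite /g -scaleN1r end_mxD !end_mxZ end_mx1 scaleN1r mulmxBr vz -scalemxAr mulmx1 subrr.
by rewrite -[v]mulmx1 -end_mx1 -(lker0_compfV ker0) end_mxM mulmxA vg mul0mx.
Qed.

End EndMatrix.

(** * Algebra homomorphisms into sections of End(E) *)

Section Sections.
Context {R : realType} {X : cinfSpace R} {r : nat} {E : bundle X r}.
Implicit Types (s t : endSection E) (p : X).

Definition es_cst (c : R) : endSection E := sf_incl E (sf_cst X c).

Definition section_mx (e : frame E r) p s : 'M[R[i]]_r := end_mx (fvec e p) (s p).

Lemma frame_at p : exists2 e, @frames R X r E e & fdom e p.
Proof. exact: frames_cover. Qed.

Section AtPoint.
Variables (e : frame E r) (p : X).
Hypothesis ep : fdom e p.
Let eb := fvec_basis ep.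

Lemma section_mxD : {morph section_mx e p : s t / s + t}.
Proof. by move=> s t; exact: end_mxD. Qed.

Lemma section_mxM : {morph section_mx e p : s t / s * t}.
Proof. by move=> s t; exact: end_mxM. Qed.

Lemma section_mx_cst c : section_mx e p (es_cst c) = cscalar_mx r c.
Proof. by rewrite /section_mx /es_cst /= end_mxZ end_mx1 // scalemx1. Qed.

Lemma section_mx1 : section_mx e p 1 = 1.
Proof. by rewrite -(cscalar1 (r := r)) -section_mx_cst. Qed.

Lemma section_mxZ a s : section_mx e p (a *: s) = cscalar_mx r a * section_mx e p s.
Proof.
by rewrite -section_mx_cst -section_mxM.
Qed.

Lemma section_mx_inj s t : section_mx e p s = section_mx e p t -> s p = t p.
Proof. exact: (end_mx_inj eb). Qed.

Lemma alg_hom_at (M : cinfSpace R) (phi : smoothFun M -> endSection E) :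
  alg_hom phi -> is_alghom (cscalar_mx r) (fun f => section_mx e p (phi f)).
Proof.
move=> [philin [phi1 phiM]]; split=> [f g|f g|c].
- by have := philin 1 f g; rewrite !scale1r => ->; rewrite section_mxD.
- by rewrite phiM section_mxM.
have -> : sf_cst M c = c *: (1 : smoothFun M) + 0.
  by apply: smoothFun_eq => x /=; rewrite mulr1 addr0.
have phi0 : phi 0 = 0.
  by have := philin (-1) 0 0; rewrite scaler0 addr0 scaleN1r addNr.
by rewrite philin phi0 addr0 phi1 section_mxZ section_mx1 mulr1.
Qed.

End AtPoint.

Lemma alg_hom_unique n (phi psi : smoothFun (@Rn R n) -> endSection E) :
  alg_hom phi -> alg_hom psi ->
  (forall i, phi (Rn_coord i) = psi (Rn_coord i)) -> phi =1 psi.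
Proof.
move=> phi_hom psi_hom eqX f; apply: endSection_eq => p.
have [e _ ep] := frame_at p; apply: (section_mx_inj ep).
apply: (alghom_eq (alg_hom_at ep phi_hom) (alg_hom_at ep psi_hom)) => i.
by rewrite eqX.
Qed.

Lemma sf_comp_hom (M : cinfSpace R) k (F : 'I_k -> smoothFun M)
    (phi : smoothFun M -> endSection E) :
  alg_hom phi -> alg_hom (fun h => phi (sf_comp h F)).
Proof.
move=> [philin [phi1 phiM]]; split=> [a f g|].
  by rewrite -philin; congr phi; exact: smoothFun_eq.
split=> [|f g]; first by rewrite -phi1; congr phi; exact: smoothFun_eq.
by rewrite -phiM; congr phi; exact: smoothFun_eq.
Qed.

Lemma alg_hom_sf_comp (M : cinfSpace R) (phi : smoothFun M -> endSection E) k
    (F F' : 'I_k -> smoothFun M) h :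
  alg_hom phi -> (forall i, phi (F i) = phi (F' i)) ->
  phi (sf_comp h F) = phi (sf_comp h F').
Proof.
move=> phi_hom FF'; move: h; apply: alg_hom_unique; try exact: sf_comp_hom.
by move=> i; rewrite !sf_comp_coord.
Qed.

End Sections.

(** * The ring of operations on the image of a homomorphism *)

Section Admissibility.
Context {R : realType} {X : cinfSpace R} {r : nat} {E : bundle X r}.

Section ImageRing.
Variables (M : cinfSpace R) (phit : smoothFun M -> endSection E).
Hypothesis phit_hom : alg_hom phit.
Local Notation A := {s | range phit s}.

Lemma corestrict_eq F (a : A) : phit F = sval a -> corestrict phit F = a.
Proof.
case: a => s sP /= Fs; rewrite /corestrict; subst s.
by congr exist; exact: Prop_irrelevance.
Qed.

Lemma lift_ex (a : A) : exists F, phit F = sval a.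
Proof. by case: a => s /= [F _ Fs]; exists F. Qed.

Definition lift (a : A) : smoothFun M := projT1 (cid (lift_ex a)).

Lemma liftK (a : A) : phit (lift a) = sval a.
Proof. by rewrite /lift; case: cid. Qed.

(** Computed on chosen preimages; by [alg_hom_sf_comp] any others give the same result. *)
Definition image_op k (h : smoothFun (Rn k)) (a : 'I_k -> A) : A :=
  corestrict phit (sf_comp h (lift \o a)).

Lemma image_op_coord k (i : 'I_k) a : image_op (Rn_coord i) a = a i.
Proof. by apply: corestrict_eq; rewrite sf_comp_coord liftK. Qed.

Lemma image_op_comp k l (g : smoothFun (Rn k)) (h : 'I_k -> smoothFun (Rn l)) a :
  image_op (sf_comp g h) a = image_op g (fun i => image_op (h i) a).
Proof.
apply: corestrict_eq; rewrite sf_comp_comp; apply: alg_hom_sf_comp => // i.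
by rewrite /= liftK.
Qed.

Definition image_ring : cinfRing A := CinfRing image_op_coord image_op_comp.

Lemma image_ring_hom : cinf_hom (sf_cinfRing M) image_ring (corestrict phit).
Proof.
move=> k h a; apply: corestrict_eq; apply: alg_hom_sf_comp => // i.
by rewrite /= liftK.
Qed.

Lemma image_ring_compatible : compatible image_ring.
Proof.
have [philin [phi1 phiM]] := phit_hom.
split=> [a|a|c a] /=.
- rewrite -!liftK -[RHS](_ : phit (1 *: lift (a 0) + lift (a 1)) = _); last first.
    by rewrite philin scale1r.
  by congr phit; apply: smoothFun_eq => x /=; rewrite !mxE mul1r.
- by rewrite -!liftK -phiM; congr phit; apply: smoothFun_eq => x /=; rewrite !mxE.
have phi0 : phit 0 = 0.
  by have := philin (-1) 0 0; rewrite scaler0 addr0 scaleN1r addNr.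
rewrite -phi1 -[RHS]addr0 -phi0 -philin; congr phit; apply: smoothFun_eq => x /=.
by rewrite mulr1 addr0.
Qed.

End ImageRing.

Lemma admissible_of_extension (Y : cinfSpace R) (phi : smoothFun Y -> endSection E)
    (phit : smoothFun (prod_space X Y) -> endSection E) :
  alg_hom phit -> (forall f, phit (pull_snd X f) = phi f) ->
  (forall h, phit (pull_fst Y h) = sf_incl E h) -> admissible phi.
Proof.
move=> phit_hom phitY phitX; exists phit; split=> //.
have S_hom := image_ring_hom phit_hom.
exists (image_ring phit_hom); split=> //; first exact: image_ring_compatible.
exists (corestrict phit \o pull_snd X), (corestrict phit \o pull_fst Y); split=> //.
- split=> k h a.
    rewrite /= -[RHS](S_hom k h (pull_snd X \o a)) /=; congr corestrict.
    by apply: smoothFun_eq.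
  rewrite /= -[RHS](S_hom k h (pull_fst Y \o a)) /=; congr corestrict.
  by apply: smoothFun_eq.
- by split=> k h a; apply: smoothFun_eq.
Qed.

End Admissibility.

(** * Construction of the homomorphism *)

Section Slices.
Context {R : realType} {X : cinfSpace R} {n : nat}.
Local Notation P := (prod_space X (@Rn R n)).
Implicit Types (F G : smoothFun P).

Lemma prod_chart_smooth F (c : chart R X (sdim X)) : atlas c ->
  smooth [set w : 'rV[R]_(sdim X + n) | ccod c (lsubmx w)]
    (fun w => F (cinv c (lsubmx w), rsubmx w)).
Proof.
move=> ac; have aP : @atlas R P (@prod_chart R X (Rn n) c (Rn_chart n)).
  by exists c => //; exists (Rn_chart n).
by apply: smooth_sub (sfunP F aP) => w /= cw; split.
Qed.

Lemma slice_smooth F p : smooth [set: 'rV[R]_n] (fun v => F (p, v)).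
Proof.
have [c ac cp] := atlas_cover p.
apply: (smooth_ext (f := fun v => F (cinv c (lsubmx (row_mx (cmap c p) v)),
    rsubmx (row_mx (cmap c p) v)))); first exact: openT.
  by move=> v _; rewrite row_mxKl row_mxKr cmapK.
apply: (smooth_comp_mx (h := fun v => row_mx (cmap c p) v) _ _ _ (prod_chart_smooth F ac)).
- exact: openT.
- by move=> v _ /=; rewrite row_mxKl; exact: cmap_cod.
move=> i; case: (split_ordP i) => j ->.
  by under eq_fun do rewrite row_mxEl; exact: smooth_cst.
by under eq_fun do rewrite row_mxEr; exact: smooth_coord.
Qed.

Definition slice F p : smoothFun (@Rn R n) := SmoothFun ((smooth_on_RnP _).2 (slice_smooth F p)).

Lemma insert_smooth d (G : smoothFun (@Rn R (d + n))) (s : 'rV[R]_d) :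
  smooth [set: 'rV[R]_n] (fun v => G (row_mx s v)).
Proof.
apply: (smooth_comp_mx (h := fun v => row_mx s v) _ _ _ (sfun_smooth G)) => //.
  exact: openT.
move=> i; case: (split_ordP i) => j ->.
  by under eq_fun do rewrite row_mxEl; exact: smooth_cst.
by under eq_fun do rewrite row_mxEr; exact: smooth_coord.
Qed.

Definition insert d (G : smoothFun (@Rn R (d + n))) s : smoothFun (@Rn R n) :=
  SmoothFun ((smooth_on_RnP _).2 (insert_smooth G s)).

Section Cube.
Variables (u0 : 'rV[R]_(sdim X)) (e : R).
Hypothesis e0 : 0 < e.

(** Balls of row vectors are sup-norm cubes, so each coordinate can be rescaled separately. *)
Definition cube_of (s : 'rV[R]_(sdim X)) : 'rV[R]_(sdim X) := \row_j (u0 0 j + e * squash (s 0 j)).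
Definition of_cube (u : 'rV[R]_(sdim X)) : 'rV[R]_(sdim X) :=
  \row_j unsquash (e^-1 * (u 0 j - u0 0 j)).

Lemma cube_of_ball s : ball u0 e (cube_of s).
Proof.
split=> // i j; rewrite ord1 mxE /ball /= opprD addrA subrr add0r normrN normrM gtr0_norm //.
by rewrite gtr_pMr // squash_lt1.
Qed.

Lemma of_cube_lt1 u j : ball u0 e u -> `|e^-1 * (u 0 j - u0 0 j)| < 1.
Proof.
move=> [_ /(_ 0 j)]; rewrite /ball /= => uj.
by rewrite normrM gtr0_norm ?invr_gt0 // ltr_pdivrMl // mulr1 distrC.
Qed.

Lemma of_cubeK u : ball u0 e u -> cube_of (of_cube u) = u.
Proof.
move=> bu; apply/rowP => j; rewrite !mxE unsquashK; last exact: of_cube_lt1.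
by rewrite mulVKf ?lt0r_neq0 // subrKC.
Qed.

Lemma of_cube_smooth j : smooth (ball u0 e) (fun u => of_cube u 0 j).
Proof.
rewrite /of_cube; under eq_fun do rewrite mxE.
have oB : open (ball u0 e) by exact: ball_open.
apply: (@smooth_unsquash R 'rV[R]_(sdim X) (ball u0 e)
  (fun u : 'rV[R]_(sdim X) => e^-1 * (u 0 j - u0 0 j))) => //.
  by move=> u; exact: of_cube_lt1.
apply: smoothM => //; first exact: smooth_cst.
by apply: smoothD => //; [exact: smooth_coord|exact: smooth_cst].
Qed.

Lemma cube_extension_smooth F (c : chart R X (sdim X)) (z : 'I_n -> smoothFun (@Rn R n)) :
  atlas c -> ball u0 e `<=` ccod c ->
  smooth [set: 'rV[R]_(sdim X + n)]
    (fun w => F (cinv c (cube_of (lsubmx w)), \row_i z i (rsubmx w))).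
Proof.
move=> ac bc; pose h (w : 'rV[R]_(sdim X + n)) : 'rV[R]_(sdim X + n) :=
  row_mx (cube_of (lsubmx w)) (\row_i z i (rsubmx w)).
apply: (smooth_ext (f := fun w => F (cinv c (lsubmx (h w)), rsubmx (h w)))); first exact: openT.
  by move=> w _; rewrite /h row_mxKl row_mxKr.
apply: (smooth_comp_mx (h := h) _ _ _ (prod_chart_smooth F ac)); first exact: openT.
  by move=> w _ /=; rewrite /h row_mxKl; apply: bc; exact: cube_of_ball.
move=> i; rewrite /h; case: (split_ordP i) => j ->.
  under eq_fun do rewrite row_mxEl mxE.
  apply: smoothD; [exact: openT|exact: smooth_cst|].
  apply: smoothM; [exact: openT|exact: smooth_cst|].
  apply: (smooth_squash (f := fun w => lsubmx w 0 j)); first exact: openT.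
  by under eq_fun do rewrite mxE; exact: smooth_coord.
under eq_fun do rewrite row_mxEr mxE.
apply: (smooth_comp_mx (h := rsubmx) _ _ _ (sfun_smooth (z j))) => //; first exact: openT.
by move=> k; under eq_fun do rewrite mxE; exact: smooth_coord.
Qed.

Definition cube_extension F c z ac bc : smoothFun (@Rn R (sdim X + n)) :=
  SmoothFun ((smooth_on_RnP _).2 (@cube_extension_smooth F c z ac bc)).

Lemma insert_cube_extension F c z ac bc u : ball u0 e u ->
  insert (@cube_extension F c z ac bc) (of_cube u) = sf_comp (slice F (cinv c u)) z.
Proof.
by move=> bu; apply: smoothFun_eq => v /=; rewrite row_mxKl row_mxKr of_cubeK.
Qed.

End Cube.
End Slices.

(** * Interpolation in the fibres *)

Section Construction.
Context {R : realType} {X : cinfSpace R} {r : nat} {E : bundle X r} {n : nat}.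
Variables (m : 'I_n -> endSection E).
Hypothesis m_comm : forall i j, m i * m j = m j * m i.
Hypothesis m_real : forall i (p : X) (a : R[i]),
  passmx.leigenvalue (m i p) a -> complex.Im a = 0.

Let section_nodes p : exists l : 'I_n -> seq R,
  forall i, node_prod (@es_cst R X r E) (m i) (l i) p = 0.
Proof.
have [e _ ep] := @frame_at R X r E p.
have /choice[l lP] : forall i, exists s,
    node_prod (cscalar_mx r) (section_mx e p (m i)) s = 0.
  move=> i; have [z zi|s [s0 _ _]] := @real_nodes _ r (section_mx e p (m i)); last by exists s.
  by apply: (m_real (i := i) (p := p)); apply: end_mx_eigenvalue zi; exact: fvec_basis.
exists l => i; rewrite -[RHS]/((0 : endSection E) p); apply: (section_mx_inj ep).
rewrite (node_prod_morph (section_mxD _ _) (section_mxM ep) (section_mx1 ep) (section_mx_cst ep)).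
by rewrite lP /section_mx /=; apply/matrixP => j k; rewrite !mxE zero_lfunE linear0.
Qed.

Definition nodes_at p : 'I_n -> seq R := projT1 (cid (section_nodes p)).

Lemma nodes_atP p i : node_prod (@es_cst R X r E) (m i) (nodes_at p i) p = 0.
Proof. by rewrite /nodes_at; case: cid. Qed.

(** Interpolation takes place in the ring of global sections, with nodes that annihilate at [p]
    only, and is then evaluated at [p]; this makes it independent of any frame. *)
Definition fiber_calculus (G : X -> smoothFun (@Rn R n)) p : 'End(E p) :=
  newton (@es_cst R X r E) m (nodes_at p) (G p) p.

Section Frame.
Variables (e : frame E r) (p : X).
Hypothesis ep : fdom e p.

Lemma section_mx_commuting : commuting (fun i => section_mx e p (m i)).
Proof. by move=> i j; rewrite /GRing.comm -!section_mxM // m_comm. Qed.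

Lemma section_mx_annihilates :
  annihilates (cscalar_mx r) (fun i => section_mx e p (m i)) (nodes_at p).
Proof.
move=> i; have := nodes_atP p i.
rewrite -(node_prod_morph (section_mxD e p) (section_mxM ep) (section_mx1 ep) (section_mx_cst ep)).
rewrite /section_mx => ->; apply/matrixP => j k; by rewrite !mxE zero_lfunE linear0.
Qed.

Lemma fiber_calculusE G : end_mx (fvec e p) (fiber_calculus G p) =
  fcalc (cscalar_mx r) (fun i => section_mx e p (m i)) (G p).
Proof.
rewrite (cmx_fcalcE section_mx_commuting section_mx_annihilates).
exact: (newton_morph (section_mxD e p) (section_mxM ep) (section_mx_cst ep)).
Qed.

Lemma fiber_calculus_hom :
  is_alghom (cscalar_mx r) (fcalc (cscalar_mx r) (fun i => section_mx e p (m i))).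
Proof.
exact: (cmx_fcalc_hom section_mx_commuting section_mx_annihilates).
Qed.

Let B i := realify (section_mx e p (m i)).

Lemma realify_commuting : commuting B.
Proof. by move=> i j; rewrite /GRing.comm /B -!realifyM -!section_mxM // m_comm. Qed.

Lemma realify_annihilates l :
  annihilates (cscalar_mx r) (fun i => section_mx e p (m i)) l -> annihilates (@scalar_mx R _) B l.
Proof.
move=> al i; rewrite /B.
rewrite -(node_prod_morph (@realifyD _ _) (@realifyM _ _) (@realify1 _ _) (@realify_scalar _ _)).
rewrite al; rewrite (morph0 (@realifyD R r)); done.
Qed.

Lemma realify_fiber_calculus G :
  realify (end_mx (fvec e p) (fiber_calculus G p)) = fcalc (@scalar_mx R _) B (G p).
Proof.
rewrite fiber_calculusE (cmx_fcalcE section_mx_commuting section_mx_annihilates).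
rewrite (mx_fcalcE realify_commuting (realify_annihilates section_mx_annihilates)).
exact: (newton_morph (@realifyD _ _) (@realifyM _ _) (@realify_scalar _ _)).
Qed.

(** The nodes come from the complex matrices: at most [r] of them despite the size [r + r], and
    bounded by [eigenvalue_bound], which supplies the second term of the maximum. *)
Lemma realify_real_tuple (c : R) : 0 <= c -> (forall i, mx_bound c (B i)) ->
  real_tuple r (Num.max c (r%:R * (c + c))) B.
Proof.
move=> c0 Bc; have cc : c <= Num.max c (r%:R * (c + c)) by rewrite le_max lexx.
split; [exact: realify_commuting|by move=> i; exact: mx_bound_le (Bc i)|].
have /choice[l lP] : forall i, exists s,
    [/\ node_prod (cscalar_mx r) (section_mx e p (m i)) s = 0, (size s <= r)%N
      & forall k, k \in s -> eigenvalue (section_mx e p (m i)) k%:C%C].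
  move=> i; apply: real_nodes => z zi.
  by apply: (m_real (i := i) (p := p)); apply: end_mx_eigenvalue zi; exact: fvec_basis.
exists l; first by apply: realify_annihilates => i; case: (lP i).
move=> i; have [_ sr se] := lP i; split=> // k /se ek.
by rewrite le_max; apply/orP; right; exact: eigenvalue_bound ek (Bc i).
Qed.

End Frame.

End Construction.

(** * Smoothness in the base point and extension to the product *)

Section Existence.
Context {R : realType} {X : cinfSpace R} {r : nat} {E : bundle X r} {n : nat}.
Variables (m : 'I_n -> endSection E).
Hypothesis m_comm : forall i j, m i * m j = m j * m i.
Hypothesis m_real : forall i (p : X) (a : R[i]),
  passmx.leigenvalue (m i p) a -> complex.Im a = 0.
Variable z : 'I_n -> smoothFun (@Rn R n).
Local Notation P := (prod_space X (@Rn R n)).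
Local Notation kap := (@scalar_mx R _).
Implicit Types F G : smoothFun P.

(** With [z] inverse to the coordinate system [y], the function [y i] becomes the standard
    coordinate, for which [m i] is substituted. *)
Definition ext_at F (p : X) : smoothFun (@Rn R n) := sf_comp (slice F p) z.

Section Smoothness.
Variables (e : frame E r) (c : chart R X (sdim X)) (F : smoothFun P).
Hypothesis ee : @frames R X r E e.
Hypothesis ac : atlas c.
Let U := ccod c `&` cinv c @^-1` fdom e.
Let oU : open U. Proof. exact: (@chart_open _ _ c _ (fdom_open e)). Qed.
Let d := sdim X.
Let B i (u : 'rV[R]_d) := realify (section_mx e (cinv c u) (m i)).

Let B_smooth i a b : smooth U (fun u => B i u a b).
Proof.
have s1 k l : smooth U (fun u => complex.Re (section_mx e (cinv c u) (m i) k l)).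
  rewrite /section_mx /end_mx; under eq_fun do rewrite mxE.
  exact: (esecP (m i) ee k l).1 ac.
have s2 k l : smooth U (fun u => complex.Im (section_mx e (cinv c u) (m i) k l)).
  rewrite /section_mx /end_mx; under eq_fun do rewrite mxE.
  exact: (esecP (m i) ee k l).2 ac.
rewrite /B /realify; case: (split_ordP a) => k ->; case: (split_ordP b) => l ->.
- by under eq_fun do rewrite block_mxEul mxE; exact: s1.
- by under eq_fun do rewrite block_mxEur 2!mxE; apply: smoothN => //; exact: s2.
- by under eq_fun do rewrite block_mxEdl mxE; exact: s2.
- by under eq_fun do rewrite block_mxEdr mxE; exact: s1.
Qed.

Section NearPoint.
Variables (u0 : 'rV[R]_d) (eps : R).
Hypothesis eps0 : 0 < eps.
Hypothesis bU : ball u0 eps `<=` U.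
Let W : set 'rV[R]_d := ball u0 eps.
Let oW : open W. Proof. exact: ball_open. Qed.

(* The base coordinates enter as scalar matrices, read through [of_cube] since
   [cube_extension] is defined on all of R^(d+n). *)
Let A (k : 'I_(d + n)) (u : 'rV[R]_d) : 'M[R]_(r + r) :=
  match fintype.split k with
  | inl j => (of_cube u0 eps u 0 j)%:M
  | inr i => B i u
  end.

Let Al j u : A (lshift n j) u = (of_cube u0 eps u 0 j)%:M.
Proof. by rewrite /A; case: split_ordP => k /eqP; rewrite ?eq_lshift ?eq_lrshift // => /eqP ->. Qed.

Let Ar i u : A (rshift d i) u = B i u.
Proof. by rewrite /A; case: split_ordP => k /eqP; rewrite ?eq_rshift ?eq_rlshift // => /eqP ->. Qed.

Let A_smooth k a b : smooth W (fun u => A k u a b).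
Proof.
case: (split_ordP k) => j ->.
  have -> : (fun u => A (lshift n j) u a b) = fun u => of_cube u0 eps u 0 j *+ (a == b).
    by apply/funext => u; rewrite Al [LHS]mxE.
  by case: (a == b); [exact: (of_cube_smooth u0 eps0 j)|exact: smooth_cst].
by under eq_fun do rewrite Ar; exact: smooth_sub (@B_smooth j a b).
Qed.

Let A_commuting u : W u -> commuting (A ^~ u).
Proof.
move=> /bU[_ eu] k k'; case: (split_ordP k) => j ->; first by rewrite Al; exact: scalar_central.
case: (split_ordP k') => j' ->; first by rewrite Al; exact/commr_sym/scalar_central.
by rewrite !Ar; exact: (realify_commuting m_comm eu).
Qed.

Let A_real_tuple x : W x -> locally_real_tuple A x.
Proof.
move=> Wx; have [c1 c10 nA] := near_mx_bound (G := A) (fun k a b => A_smooth k a b 0 x Wx).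
have Ux := bU Wx.
have [c2 c20 nB] := near_mx_bound (G := B) (fun i a b => B_smooth i a b 0 x Ux).
have cS (i : 'I_1) a b : {for x, continuous (fun u => of_cube u0 eps u a b)}.
  by rewrite (ord1 a); exact: (of_cube_smooth u0 eps0 b 0 x Wx).
have [c3 c30 nS] := near_mx_bound (G := fun _ u => of_cube u0 eps u) cS.
(* [c1] bounds the entries of [A], the middle term the eigenvalue nodes of [B], and [c3] the single
   nodes of the scalar matrices. These need one node even if [r = 0], hence [maxn r 1]. *)
pose c' := Num.max c1 (Num.max (Num.max c2 (r%:R * (c2 + c2))) c3).
exists (maxn r 1), c'; split; first by rewrite le_max c10.
have nW : nbhs x W by exact: open_nbhs_nbhs.
near=> u; have Wu : W u by near: u.
have [_ eu] := bU Wu.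
have Bc2 : forall i, mx_bound c2 (B i u) by near: u.
have [_ _ [l Bl lc]] := realify_real_tuple m_comm m_real eu c20 Bc2.
split; first exact: A_commuting.
  move=> k; apply: (@mx_bound_le _ _ _ c1); first by rewrite le_max lexx.
  by move: k; near: u.
have nodesA k : exists s, node_prod kap (A k u) s = 0 /\ nodes_le (maxn r 1) c' s.
  case: (split_ordP k) => j ->.
    exists [:: of_cube u0 eps u 0 j]; split.
      by rewrite /node_prod big_seq1 Al subrr.
    split=> [|a]; first exact: leq_maxr.
    rewrite inE => /eqP ->; rewrite !le_max; apply/orP; right; apply/orP; right.
    suff h : forall i : 'I_1, mx_bound c3 (of_cube u0 eps u) by exact: (h ord0 0 j).
    by near: u.
  exists (l j); rewrite Ar; split; first exact: Bl.
  have [sr sc] := lc j; split; first exact: leq_trans (leq_maxl _ _).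
  by move=> a /sc h; rewrite le_max; apply/orP; right; rewrite le_max h.
have /choice[l' l'P] := nodesA.
by exists l' => k; case: (l'P k).
Unshelve. all: by end_near. Qed.

(** Moves the dependence on [u] from the function into the matrices, as [fcalc_smooth] treats a
    fixed function. Both sides are homomorphisms in [G] with equal values on coordinates. *)
Let insert_fcalc u (G : smoothFun (@Rn R (d + n))) : W u ->
  fcalc kap (B ^~ u) (insert G (of_cube u0 eps u)) = fcalc kap (A ^~ u) G.
Proof.
move=> Wu; have [_ eu] := bU Wu.
have BC := realify_commuting m_comm eu.
have Bl := realify_annihilates (section_mx_annihilates m_real eu).
have [hD hM hK] := mx_fcalc_hom BC Bl.
pose psi (G : smoothFun (@Rn R (d + n))) := fcalc kap (B ^~ u) (insert G (of_cube u0 eps u)).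
have psi_hom : is_alghom kap psi.
  split=> [f g|f g|a]; rewrite /psi.
  - by rewrite -hD; congr fcalc; exact: smoothFun_eq.
  - by rewrite -hM; congr fcalc; exact: smoothFun_eq.
  - by rewrite -hK; congr fcalc; exact: smoothFun_eq.
have psiX : (fun k => psi (Rn_coord k)) = A ^~ u.
  apply/funext => k; rewrite /psi; case: (split_ordP k) => j ->.
    rewrite Al -hK; congr fcalc; apply: smoothFun_eq => v /=.
    by rewrite row_mxEl.
  rewrite Ar /B -(mx_fcalc_coord BC Bl j).
  by congr fcalc; apply: smoothFun_eq => v /=; rewrite row_mxEr.
have [_ [_ [_ /nbhs_singleton [_ _ [l Al' _]]]]] := A_real_tuple Wu.
rewrite -psiX in Al' *.
by apply: fcalc_unique Al' _ => //;
  first [exact: scalar_morphD|exact: scalar_morphM|exact: scalar_central].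
Qed.

Lemma fiber_calculus_ball_smooth a b : smooth W (fun u =>
  realify (end_mx (fvec e (cinv c u))
    (fiber_calculus m_real (ext_at F) (cinv c u))) a b).
Proof.
have bc : ball u0 eps `<=` ccod c by move=> u /bU[].
apply: (smooth_ext (f := fun u =>
  fcalc kap (A ^~ u) (cube_extension eps0 F z ac bc) a b)) => //.
  move=> u Wu; have [_ eu] := bU Wu.
  by rewrite (realify_fiber_calculus m_comm m_real eu) -insert_fcalc // insert_cube_extension.
exact: fcalc_smooth.
Qed.

End NearPoint.

Lemma fiber_calculus_chart_smooth a b : smooth U (fun u =>
  realify (end_mx (fvec e (cinv c u))
    (fiber_calculus m_real (ext_at F) (cinv c u))) a b).
Proof.
apply: smooth_local => u0 Uu0.
have /nbhs_ballP[eps /= eps0 bU] : nbhs u0 U by exact: open_nbhs_nbhs.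
exists (ball u0 eps); first by split; [exact: ball_open|exact: ballxx].
exact: fiber_calculus_ball_smooth.
Qed.

End Smoothness.

Lemma ext_smooth F : smooth_section (fiber_calculus m_real (ext_at F)).
Proof.
move=> e ee i j.
have sm a b : smooth_on (fdom e) (fun p =>
    realify (end_mx (fvec e p) (fiber_calculus m_real (ext_at F) p)) a b).
  by move=> c ac; exact: fiber_calculus_chart_smooth.
have oe := fdom_open e; split.
  apply: smooth_on_ext (sm (lshift r i) (lshift r j)) => // p ep.
  by rewrite -realify_Re mxE.
apply: smooth_on_ext (sm (rshift r i) (lshift r j)) => // p ep.
by rewrite -realify_Im mxE.
Qed.

Definition ext F : endSection E := EndSection (ext_smooth F).

Lemma section_mx_ext e p F : fdom e p -> section_mx e p (ext F) =
  fcalc (cscalar_mx r) (fun i => section_mx e p (m i)) (ext_at F p).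
Proof. by move=> ep; exact: fiber_calculusE. Qed.

Lemma ext_hom : alg_hom ext.
Proof.
have fh e p (ep : fdom e p) := fiber_calculus_hom m_comm m_real ep.
split=> [a F G|].
  apply: endSection_eq => p; have [e _ ep] := @frame_at R X r E p.
  have [hD hM hK] := fh e p ep; apply: (section_mx_inj ep).
  rewrite section_mxD section_mxZ // !section_mx_ext // -hK -hM -hD; congr fcalc.
  exact: smoothFun_eq.
split=> [|F G]; apply: endSection_eq => p; have [e _ ep] := @frame_at R X r E p;
  have [hD hM hK] := fh e p ep; apply: (section_mx_inj ep).
  rewrite section_mx_ext // section_mx1 // -(@cscalar1 R r) -hK; congr fcalc.
  exact: smoothFun_eq.
rewrite section_mxM // !section_mx_ext // -hM; congr fcalc.
exact: smoothFun_eq.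
Qed.

Lemma ext_pull_fst h : ext (pull_fst (Rn n) h) = sf_incl E h.
Proof.
apply: endSection_eq => p; have [e _ ep] := @frame_at R X r E p.
have [hD hM hK] := fiber_calculus_hom m_comm m_real ep; apply: (section_mx_inj ep).
have -> : section_mx e p (sf_incl E h) = section_mx e p (es_cst (h p)) by [].
rewrite section_mx_ext // section_mx_cst // -hK; congr fcalc.
exact: smoothFun_eq.
Qed.

Lemma ext_pull_snd (y : 'I_n -> smoothFun (@Rn R n)) i :
  (forall v, \row_i y i (\row_j z j v) = v) -> ext (pull_snd X (y i)) = m i.
Proof.
move=> yz; apply: endSection_eq => p; have [e _ ep] := @frame_at R X r E p.
apply: (section_mx_inj ep); rewrite section_mx_ext //.
rewrite (_ : ext_at _ p = Rn_coord i); last first.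
  by apply: smoothFun_eq => v /=; have /rowP /(_ i) := yz v; rewrite mxE.
exact: (cmx_fcalc_coord (section_mx_commuting m_comm ep) (section_mx_annihilates m_real ep) i).
Qed.

End Existence.

Theorem theorem3p2p1 (R : realType) (X : cinfSpace R) (hX : is_manifold X)
    (r : nat) (E : bundle X r)
    (n : nat) (y : 'I_n -> smoothFun (@Rn R n)) (hy : global_coordinates y)
    (m : 'I_n -> endSection E)
    (hcomm : forall i j : 'I_n, m i * m j = m j * m i)
    (hreal : forall (i : 'I_n) (p : X) (a : R[i]),
       passmx.leigenvalue (m i p) a -> complex.Im a = 0) :
  exists! phi : smoothFun (@Rn R n) -> endSection E,
    [/\ alg_hom phi, admissible phi & forall i : 'I_n, phi (y i) = m i].
Proof.
have [z [zy yz]] := hy; have ext_h := ext_hom hcomm hreal z.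
have pull_hom : alg_hom (fun f => ext hcomm hreal z (pull_snd X f)).
  have [lin [one mul]] := ext_h; split=> [a f g|].
    by rewrite -lin; congr ext; exact: smoothFun_eq.
  split=> [|f g]; first by rewrite -one; congr ext; exact: smoothFun_eq.
  by rewrite -mul; congr ext; exact: smoothFun_eq.
exists (fun f => ext hcomm hreal z (pull_snd X f)); split.
  split=> //; last by move=> i; exact: ext_pull_snd.
  by apply: (admissible_of_extension ext_h) => // h; exact: ext_pull_fst.
move=> psi [psi_hom _ psi_y]; apply/funext => f.
(* Writing [f] as a function of [y] turns agreement on the [y i] into agreement on the standard
   coordinates, where [alg_hom_unique] applies. *)
have fE : f = sf_comp (sf_comp f z) y by apply: smoothFun_eq => v /=; rewrite zy.
rewrite [in LHS]fE [in RHS]fE.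
apply: (alg_hom_unique (phi := fun g => ext hcomm hreal z (pull_snd X (sf_comp g y)))
  (psi := fun g => psi (sf_comp g y))).
- exact: (sf_comp_hom y pull_hom).
- exact: (sf_comp_hom y psi_hom).
by move=> i; rewrite !sf_comp_coord psi_y ext_pull_snd.
Qed.
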